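(* Let $\Phi$ be a unit norm tight frame in $\mathbb{R}^d$ with $K$ atoms, frame constant $A=K/d$, coherence $\mu$ and lower isometry constant $\delta_S\le\mu S$, where $1\le S\le K$. Let $y_n=\Phi x_n$, $n=1,\dots,N$, with $x_n$ i.i.d. drawn from a symmetric probability distribution $\nu$ on $S^{K-1}$, and assume there is $\kappa>0$ with $$\nu\Big(\min_{p,\sigma}\Big(\|P_{I_p}(\Phi)\Phi c_{p,\sigma}(x)\|_2-\max_{|I|\le S,\ I\ne I_p}\|P_I(\Phi)\Phi c_{p,\sigma}(x)\|_2\Big)\ge2\kappa\Big)=1,\quad I_p:=p^{-1}(\{1,\dots,S\}).$$ Let $\gamma_S^2:=\mathbb{E}_x(c_1^2(x)+\dots+c_S^2(x))$, $\lambda:=\frac{\gamma_S^2}{S}-\frac{1-\gamma_S^2}{K-S}$ and $C_S:=\big(1-\frac{S}{d(1-\delta_S)}\big)^2$. If for some $0<q<1/4$, $$N^{-q}+N^{-2q}/K\le\frac{\kappa^2(1-\delta_S)}{68\sqrt S\log(5AK^S/\lambda)},$$ then, except with probability $\exp\Big(-\frac{N^{1-4q}\lambda^2S^2C_S}{4K^2A}+Kd\log\big(\frac{NKA}{\lambda S}\big)\Big)$, there is a local maximum $\tilde\Psi$ of $$\max_{\Psi\in\mathcal D}\frac1N\sum_{n=1}^N\max_{|I|\le S}\|P_I(\Psi)y_n\|_2^2$$ (equivalently a local minimum of $\min_{\Psi\in\mathcal D,X\in\mathcal X_S}\|Y-\Psi X\|_F^2$) with $\max_k\|\tilde\psi_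k-\phi_k\|_2\le2N^{-q}$.
   Context: $\mathcal D$ is the set of dictionaries $\Psi=(\psi_1,\dots,\psi_K)$, $\psi_i\in\mathbb{R}^d$, $\|\psi_i\|_2=1$; $P_I(\Psi)=\Psi_I\Psi_I^\dagger$ is the orthogonal projection onto the span of $(\psi_i)_{i\in I}$. $Y=(y_1,\dots,y_N)$; $\mathcal X_S$ is the set of $K\times N$ matrices with at most $S$ nonzeros per column. The lower isometry constant is $\delta_S=\max_{|I|\le S}\big(1-\lambda_{\min}(\Phi_I^\star\Phi_I)\big)$. Unit norm tight frame: $\sum_i|\langle\phi_i,v\rangle|^2=A\|v\|_2^2$; coherence $\mu=\max_{i\ne j}|\langle\phi_i,\phi_j\rangle|$. Symmetric measure on $S^{K-1}$: invariant under coordinate sign flips and permutations. $c(x)$ is the non-increasing rearrangement of $(|x_i|)_i$, $c_{p,\sigma}(x)(i)=\sigma_ic_{p(i)}(x)$. *)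

(* Defs.v *)
From HB Require Import structures.
From mathcomp Require Import all_boot all_order all_algebra fingroup perm.
From mathcomp Require Import all_classical all_reals all_analysis.
Set Implicit Arguments. Unset Strict Implicit. Unset Printing Implicit Defensive.
Import Order.TTheory GRing.Theory Num.Theory.
Local Open Scope ring_scope.
Local Open Scope classical_set_scope.

(** A type alias of R^K (column vectors) carrying a pointed structure, so
    that it can be equipped with a generated sigma-algebra below. *)
Definition cvec (R : realType) (K : nat) : Type := 'cV[R]_K.
HB.instance Definition _ (R : realType) (K : nat) := Choice.on (cvec R K).
HB.instance Definition _ (R : realType) (K : nat) := isPointed.Build (cvec R K) 0.

Section defs.
Variable R : realType.

Definition dotv n (u v : 'cV[R]_n) : R := \sum_i u i 0 * v i 0.
Definition vnorm n (v : 'cV[R]_n) : R := Num.sqrt (\sum_i v i 0 ^+ 2).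

Definition dictionary d K (Psi : 'M[R]_(d, K)) : Prop :=
  forall k : 'I_K, vnorm (col k Psi) = 1.

Definition unit_norm_tight_frame d K (Phi : 'M[R]_(d, K)) (A : R) : Prop :=
  dictionary Phi /\
  forall v : 'cV[R]_d, \sum_i (dotv (col i Phi) v) ^+ 2 = A * vnorm v ^+ 2.

Definition coherence d K (Phi : 'M[R]_(d, K)) : R :=
  \big[Num.max/0]_(ij : 'I_K * 'I_K | ij.1 != ij.2)
     `|dotv (col ij.1 Phi) (col ij.2 Phi)|.

(** Orthogonal projection (as a d x d matrix acting on columns) onto the span
    of the rows of B:  C^T (C C^T)^{-1} C  where the rows of C = row_base B
    form a basis of that span. *)
Definition projmx m n (B : 'M[R]_(m, n)) : 'M[R]_n :=
  let C := row_base B in C^T *m invmx (C *m C^T) *m C.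

Definition Pproj d K (Psi : 'M[R]_(d, K)) (I : {set 'I_K}) : 'M[R]_d :=
  projmx (\matrix_(i < K, j < d) (if i \in I then Psi j i else 0)).

Definition subcols d K (Phi : 'M[R]_(d, K)) (I : {set 'I_K}) : 'M[R]_(d, #|I|) :=
  \matrix_(i < d, j < #|I|) Phi i (enum_val j).

Definition lambda_min n (M : 'M[R]_n) : R := inf [set a | eigenvalue M a].

Definition lower_isometry_const d K (S : nat) (Phi : 'M[R]_(d, K)) : R :=
  sup ((fun I : {set 'I_K} =>
          1 - lambda_min ((subcols Phi I)^T *m subcols Phi I)) @`
       [set I : {set 'I_K} | (0 < #|I| <= S)%N]).

(** c(x): non-increasing rearrangement of (|x_i|)_i; c x i is the
    (i+1)-th largest absolute value (0-indexed). *)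
Definition rearr K (x : 'cV[R]_K) (i : nat) : R :=
  nth 0 (sort (fun a b : R => b <= a) [seq `|x j 0| | j <- enum 'I_K]) i.

Definition c_ps K (p : 'S_K) (s : 'I_K -> bool) (x : 'cV[R]_K) : 'cV[R]_K :=
  \col_i ((-1) ^+ s i * rearr x (p i)).

(** I_p = p^{-1}({1,...,S}) (0-indexed: p i < S). *)
Definition Ip K (S : nat) (p : 'S_K) : {set 'I_K} := [set i | (p i < S)%N].

(** Measurable structure on R^K: sigma-algebra generated by the coordinate
    maps (i.e. the Borel sigma-algebra of R^K). *)
Definition coord_sets (K : nat) : set (set (cvec R K)) :=
  [set E | exists (i : 'I_K) (B : set R), measurable B /\
           E = (fun x : cvec R K => (x : 'cV[R]_K) i 0) @^-1` B].
Definition vecM (K : nat) := g_sigma_algebraType (@coord_sets K).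

Definition symmetric_measure K (nu : probability (vecM K) R) : Prop :=
  (forall (s : 'I_K -> bool) (B : set (vecM K)), measurable B ->
     nu ((fun x : vecM K => (\col_i ((-1) ^+ s i * x i 0) : vecM K)) @^-1` B)
     = nu B) /\
  (forall (p : 'S_K) (B : set (vecM K)), measurable B ->
     nu ((fun x : vecM K => (\col_i x (p i) 0 : vecM K)) @^-1` B) = nu B).

Definition iid_with_law d0 (Omega : measurableType d0) (P : probability Omega R)
  N K (X : 'I_N -> Omega -> vecM K) (nu : probability (vecM K) R) : Prop :=
  (forall n, measurable_fun setT (X n)) /\
  forall B : 'I_N -> set (vecM K), (forall n, measurable (B n)) ->
    P (\bigcap_(n in [set: 'I_N]) (X n @^-1` B n)) = (\prod_(n < N) nu (B n))%E.

Definition topS_sq K (S : nat) (x : 'cV[R]_K) : R :=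
  \sum_(i < K | (i < S)%N) rearr x i ^+ 2.
Definition gammaS2 K (S : nat) (nu : probability (vecM K) R) : R :=
  fine (\int[nu]_x (topS_sq S x)%:E)%E.

Definition objective d K N (S : nat) (Y : 'I_N -> 'cV[R]_d) (Psi : 'M[R]_(d, K)) : R :=
  N%:R^-1 * \sum_(n < N)
     \big[Num.max/0]_(I : {set 'I_K} | (#|I| <= S)%N) vnorm (Pproj Psi I *m Y n) ^+ 2.

Definition dict_dist d K (Psi Psi' : 'M[R]_(d, K)) : R :=
  \big[Num.max/0]_(k < K) vnorm (col k Psi - col k Psi').

Definition local_max_on_D d K (F : 'M[R]_(d, K) -> R) (Psi : 'M[R]_(d, K)) : Prop :=
  dictionary Psi /\
  exists2 eps : R, 0 < eps &
    forall Psi' : 'M[R]_(d, K), dictionary Psi' -> dict_dist Psi' Psi < eps ->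
      F Psi' <= F Psi.

End defs.

(* Main.v *)
(** By compactness and continuity the objective attains its maximum over the
    dictionaries within [2 N^-q] of [Phi], so it suffices that every dictionary
    [Psi] at distance exactly [2 N^-q] does worse than [Phi].

    For one [Psi], the symmetry of [nu] allows averaging over the signs and
    orderings of the coefficients.  If the support [I_p] stayed optimal for
    [Psi], the mean loss would be [lambda] times the mean over [p] of the summed squared
    distances from the atoms [phi_i], [i] in [I_p], to the span of
    [(psi_i)_(i in I_p)].  The projections onto the two spans differ by [O(N^-q)],
    so by the gap condition and a subgaussian bound on the signs, [I_p] fails to
    be optimal only with exponentially small probability.  The second moment of
    the loss is controlled by its mean, hence a Chernoff bound whose rate is
    linear in the mean loss.

    The gap condition also makes every [S + 1] atoms of [Phi] quantitatively
    independent: compare, for [J] of size [S + 1], the supports [J \ j] and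
    [J \ l].  This bounds the residual distances from below in terms of
    [max_k |psi_k - phi_k|], and makes the objective Lipschitz, so that a union
    bound over a finite grid covers all the boundary dictionaries. *)

Require Import Defs.
From HB Require Import structures.
From mathcomp Require Import all_boot all_order all_algebra fingroup perm.
From mathcomp Require Import all_classical all_reals all_analysis.
From mathcomp Require Import measurable_realfun ring lra.
Import Order.TTheory GRing.Theory Num.Theory.
Local Open Scope ring_scope.
Local Open Scope classical_set_scope.
Set Implicit Arguments.
Unset Strict Implicit.

(** The projection distance is measured by the residual itself, as [sqrt resid / kappa], and not by
    the crude [O(eps)], where [eps = N^-q]. Second moment and mean loss are then multiples of the
    same sum, and the Chernoff parameter [theta] does not depend on [eps]. The crude distance [rho]
    serves only to make the bad sign patterns rare.

    The stated failure probability fixes the size of the grid at [Q^(K d)] with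
    [Q = N K A / (lambda S)], whatever mesh is required. If that probability bound is at least 1,
    the exceptional event can be the whole space; if not, the inequality between its two exponents
    forces [N] to be so large that the required mesh fits into [Q] cells per entry.

    The assumption controls [eps * sqrt S * L] with [L = ln (5 A K^S / lambda)]. Since
    [L >= S / 2 + 1], it also controls [eps * S], which perturbing [S + 1] atoms at once requires.
    Being satisfiable by a positive [eps], it moreover gives [lambda > 0] and [delta_S < 1]. *)

(** * Inner product and norm of column vectors *)

Section EuclideanVectors.
Variable R : realType.
Implicit Types (n : nat).

Lemma dotvE n (u v : 'cV[R]_n) : dotv u v = (u^T *m v) 0 0.
Proof. by rewrite /dotv mxE; apply: eq_bigr => i _; rewrite mxE. Qed.

Lemma dotvC n (u v : 'cV[R]_n) : dotv u v = dotv v u.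
Proof. by apply: eq_bigr => i _; rewrite mulrC. Qed.

Lemma dotvDl n (u v w : 'cV[R]_n) : dotv (u + v) w = dotv u w + dotv v w.
Proof. by rewrite -big_split; apply: eq_bigr => i _; rewrite mxE mulrDl. Qed.

Lemma dotvZl n a (u v : 'cV[R]_n) : dotv (a *: u) v = a * dotv u v.
Proof. by rewrite [RHS]mulr_sumr; apply: eq_bigr => i _; rewrite mxE mulrA. Qed.

Lemma dotvNl n (u v : 'cV[R]_n) : dotv (- u) v = - dotv u v.
Proof. by rewrite -scaleN1r dotvZl mulN1r. Qed.

Lemma dotvBl n (u v w : 'cV[R]_n) : dotv (u - v) w = dotv u w - dotv v w.
Proof. by rewrite dotvDl dotvNl. Qed.

Lemma dotvDr n (u v w : 'cV[R]_n) : dotv u (v + w) = dotv u v + dotv u w.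
Proof. by rewrite dotvC dotvDl !(dotvC u). Qed.

Lemma dotvZr n a (u v : 'cV[R]_n) : dotv u (a *: v) = a * dotv u v.
Proof. by rewrite dotvC dotvZl dotvC. Qed.

Lemma dotvNr n (u v : 'cV[R]_n) : dotv u (- v) = - dotv u v.
Proof. by rewrite dotvC dotvNl dotvC. Qed.

Lemma dotvBr n (u v w : 'cV[R]_n) : dotv u (v - w) = dotv u v - dotv u w.
Proof. by rewrite dotvDr dotvNr. Qed.

Lemma dotv0l n (v : 'cV[R]_n) : dotv 0 v = 0.
Proof. by rewrite -(scale0r 0) dotvZl mul0r. Qed.

Lemma dotv0r n (v : 'cV[R]_n) : dotv v 0 = 0.
Proof. by rewrite dotvC dotv0l. Qed.

Lemma dotv_suml n (I : Type) (r : seq I) (P : pred I) (F : I -> 'cV[R]_n) v :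
  dotv (\sum_(i <- r | P i) F i) v = \sum_(i <- r | P i) dotv (F i) v.
Proof.
by apply: (big_morph (fun u => dotv u v)) => [x y|]; rewrite (dotvDl, dotv0l).
Qed.

Lemma dotv_sumr n (I : Type) (r : seq I) (P : pred I) (F : I -> 'cV[R]_n) v :
  dotv v (\sum_(i <- r | P i) F i) = \sum_(i <- r | P i) dotv v (F i).
Proof. by rewrite dotvC dotv_suml; apply: eq_bigr => i _; rewrite dotvC. Qed.

Lemma dotv_mulmxl m n (M : 'M[R]_(m, n)) u v :
  dotv (M *m u) v = dotv u (M^T *m v).
Proof. by rewrite !dotvE trmx_mul mulmxA. Qed.

Lemma dotv_ge0 n (u : 'cV[R]_n) : 0 <= dotv u u.
Proof. by apply: sumr_ge0 => i _; rewrite -expr2 sqr_ge0. Qed.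

Lemma dotv_eq0 n (u : 'cV[R]_n) : dotv u u = 0 -> u = 0.
Proof.
move=> /eqP; rewrite psumr_eq0; last by move=> i _; rewrite -expr2 sqr_ge0.
move=> /allP u0; apply/colP => i; rewrite mxE.
by have := u0 i; rewrite mem_index_enum -expr2 sqrf_eq0 => /(_ isT)/eqP.
Qed.

Lemma vnorm_sqr n (u : 'cV[R]_n) : vnorm u ^+ 2 = dotv u u.
Proof.
rewrite /vnorm sqr_sqrtr; last by apply: sumr_ge0 => i _; rewrite sqr_ge0.
by apply: eq_bigr => i _; rewrite expr2.
Qed.

Lemma vnorm_ge0 n (u : 'cV[R]_n) : 0 <= vnorm u.
Proof. exact: sqrtr_ge0. Qed.

Lemma vnorm0 n : vnorm (0 : 'cV[R]_n) = 0.
Proof. by apply/eqP; rewrite -sqrf_eq0 vnorm_sqr dotv0l. Qed.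

Lemma vnormZ n a (u : 'cV[R]_n) : vnorm (a *: u) = `|a| * vnorm u.
Proof.
apply/eqP; rewrite -(@eqrXn2 _ 2) ?mulr_ge0 ?vnorm_ge0 ?normr_ge0 //.
by rewrite exprMn !vnorm_sqr dotvZl dotvZr mulrA -expr2 -normrX ger0_norm ?sqr_ge0.
Qed.

Lemma vnormN n (u : 'cV[R]_n) : vnorm (- u) = vnorm u.
Proof. by rewrite -scaleN1r vnormZ normrN1 mul1r. Qed.

Lemma vnormBC n (u v : 'cV[R]_n) : vnorm (u - v) = vnorm (v - u).
Proof. by rewrite -vnormN opprB. Qed.

Lemma ler_vnorm n m (u : 'cV[R]_n) (v : 'cV[R]_m) :
  dotv u u <= dotv v v -> vnorm u <= vnorm v.
Proof. by rewrite -!vnorm_sqr ler_sqr // nnegrE vnorm_ge0. Qed.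

Lemma ler_vnorm_dotv n m (u : 'cV[R]_n) (v : 'cV[R]_m) :
  vnorm u <= vnorm v -> dotv u u <= dotv v v.
Proof. by rewrite -!vnorm_sqr ler_sqr // nnegrE vnorm_ge0. Qed.

Lemma dotv_orthD n (u v : 'cV[R]_n) :
  dotv u v = 0 -> dotv (u + v) (u + v) = dotv u u + dotv v v.
Proof. by move=> uv; rewrite dotvDl !dotvDr (dotvC v u) uv addr0 add0r. Qed.

Lemma dotv_CS n (u v : 'cV[R]_n) : dotv u v ^+ 2 <= dotv u u * dotv v v.
Proof.
have [v0|v0] := eqVneq (dotv v v) 0.
  by rewrite (dotv_eq0 v0) !dotv0r expr0n mulr0.
have vp : 0 < dotv v v by rewrite lt_def v0 dotv_ge0.
have := dotv_ge0 (u - (dotv u v / dotv v v) *: v).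
rewrite !(dotvBl, dotvBr, dotvZl, dotvZr) (dotvC v u).
rewrite (_ : _ - _ = (dotv u u * dotv v v - dotv u v ^+ 2) / dotv v v); last by field.
by rewrite pmulr_lge0 ?invr_gt0 // subr_ge0.
Qed.

Lemma dotv_le_vnorm n (u v : 'cV[R]_n) : `|dotv u v| <= vnorm u * vnorm v.
Proof.
rewrite -ler_sqr ?nnegrE ?normr_ge0 ?mulr_ge0 ?vnorm_ge0 //.
by rewrite exprMn !vnorm_sqr -normrX ger0_norm ?sqr_ge0 ?dotv_CS.
Qed.

Lemma vnormD n (u v : 'cV[R]_n) : vnorm (u + v) <= vnorm u + vnorm v.
Proof.
rewrite -ler_sqr ?nnegrE ?addr_ge0 ?vnorm_ge0 //.
rewrite sqrrD !vnorm_sqr !(dotvDl, dotvDr) (dotvC v u).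
have := le_trans (ler_norm _) (dotv_le_vnorm u v); lra.
Qed.

Lemma vnorm_sub_ge n (u v : 'cV[R]_n) : vnorm u - vnorm v <= vnorm (u - v).
Proof. by rewrite lerBlDr -{1}(subrK v u) vnormD. Qed.

Lemma vnorm_sum n (I : Type) (r : seq I) (P : pred I) (F : I -> 'cV[R]_n) :
  vnorm (\sum_(i <- r | P i) F i) <= \sum_(i <- r | P i) vnorm (F i).
Proof.
apply: (big_ind2 (fun u a => vnorm u <= a)) => //; first by rewrite vnorm0.
by move=> u a v b ua vb; apply: le_trans (vnormD _ _) (lerD ua vb).
Qed.

Lemma ler_coord_vnorm n (u : 'cV[R]_n) i : `|u i 0| <= vnorm u.
Proof.
rewrite -ler_sqr ?nnegrE ?normr_ge0 ?vnorm_ge0 // vnorm_sqr -normrX.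
rewrite ger0_norm ?sqr_ge0 // /dotv (bigD1 i) //= -expr2 lerDl.
by apply: sumr_ge0 => j _; rewrite -expr2 sqr_ge0.
Qed.

End EuclideanVectors.

(** * Orthogonal projection onto a row space *)

Section OrthogonalProjections.
Variable R : realType.

Lemma gram_unitmx m n (C : 'M[R]_(m, n)) : row_free C -> C *m C^T \in unitmx.
Proof.
move=> Cfree; rewrite -row_free_unit -kermx_eq0; apply/eqP/row_matrixP => i.
rewrite row0; set u := row i _.
have /sub_kermxP uCC : (u <= kermx (C *m C^T))%MS by rewrite row_sub.
suff uC : u *m C = 0 by apply: (row_free_inj Cfree); rewrite uC mul0mx.
apply: trmx_inj; rewrite trmx0; apply: dotv_eq0.
by rewrite dotvE trmxK trmx_mul mulmxA -(mulmxA u) uCC mul0mx mxE.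
Qed.

Lemma projmxP m n (B : 'M[R]_(m, n)) :
  exists2 C : 'M[R]_(\rank B, n),
    (C :=: B)%MS /\ C *m C^T \in unitmx
    & projmx B = C^T *m invmx (C *m C^T) *m C.
Proof.
exists (row_base B) => //; split; first exact: eq_row_base.
by apply: gram_unitmx; exact: row_base_free.
Qed.

Variables (m n : nat) (B : 'M[R]_(m, n)).

Lemma projmx_sym : (projmx B)^T = projmx B.
Proof.
have [C _ ->] := projmxP B.
by rewrite !trmx_mul trmx_inv trmx_mul !trmxK mulmxA.
Qed.

Lemma projmx_sub (v : 'cV[R]_n) : ((projmx B *m v)^T <= B)%MS.
Proof.
rewrite trmx_mul projmx_sym; have [C [CB _] ->] := projmxP B.
by rewrite !mulmxA -CB submxMl.
Qed.

Lemma projmx_id (v : 'cV[R]_n) : (v^T <= B)%MS -> projmx B *m v = v.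
Proof.
move=> vB; apply: trmx_inj; rewrite trmx_mul projmx_sym; move: vB.
have [C [CB Cu] ->] := projmxP B; rewrite -CB => /submxP[D ->].
by rewrite !mulmxA -(mulmxA D) -[D *m _ *m _]mulmxA mulmxV // mulmx1.
Qed.

Lemma projmx_idem : projmx B *m projmx B = projmx B.
Proof.
have [C [_ Cu] ->] := projmxP B.
rewrite !mulmxA -(mulmxA _ C C^T).
by rewrite -[_ *m invmx _ *m (C *m _)]mulmxA mulVmx // mulmx1.
Qed.

Lemma projmx_trace : \tr (projmx B) = (\rank B)%:R.
Proof.
have [C [_ Cu] ->] := projmxP B.
by rewrite mxtrace_mulC mulmxA mulmxV // mxtrace1.
Qed.

End OrthogonalProjections.

(** * Projections onto spans of atoms and the distances between them *)

Section DictionaryProjections.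
Variable R : realType.
Variables (d K : nat).
Implicit Types (Phi Psi : 'M[R]_(d, K)) (I J : {set 'I_K}) (v w : 'cV[R]_d).

(** Coefficients keep all [K] coordinates, so vectors supported on different sets can be subtracted
    without reindexing. *)
Definition supp_in I (a : 'cV[R]_K) : Prop := forall k, k \notin I -> a k 0 = 0.

Lemma supp_in_sub I J a : I \subset J -> supp_in I a -> supp_in J a.
Proof. by move=> IJ aI k kJ; apply: aI; apply: contra kJ; exact: (fintype.subsetP IJ). Qed.

Lemma mulmx_colE Phi (a : 'cV[R]_K) : Phi *m a = \sum_k a k 0 *: col k Phi.
Proof.
apply/colP => i; rewrite mxE summxE; apply: eq_bigr => k _.
by rewrite !mxE mulrC.
Qed.

Lemma mulmx_delta Phi k : Phi *m delta_mx k 0 = col k Phi.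
Proof. by rewrite colE. Qed.

Lemma supp_in_delta I k : k \in I -> supp_in I (delta_mx k 0).
Proof.
by move=> kI j jI; rewrite mxE eqxx andbT; case: eqP => // jk; rewrite jk kI in jI.
Qed.

Lemma sum_supp_in (V : lmodType R) I (a : 'cV[R]_K) (F : 'I_K -> V) :
  supp_in I a -> \sum_k a k 0 *: F k = \sum_(k in I) a k 0 *: F k.
Proof.
move=> aI; rewrite [LHS](bigID (mem I)) /= [X in _ + X]big1 ?addr0 //.
by move=> k /aI ->; rewrite scale0r.
Qed.

Let sel Psi I := \matrix_(i < K, j < d) (if i \in I then Psi j i else 0).

(** Passes between the row space inside [projmx] and combinations of the atoms in [I]; the zero rows
    contribute nothing. *)
Let sub_selP Psi I v :
  reflect (exists2 a, supp_in I a & v = Psi *m a) (v^T <= sel Psi I)%MS.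
Proof.
apply: (iffP idP) => [/submxP[D vD]|[a aI ->]].
  exists (\col_k (if k \in I then D 0 k else 0)).
    by move=> k kI; rewrite mxE (negbTE kI).
  apply/colP => j; move/rowP: vD => /(_ j); rewrite !mxE => ->.
  by apply: eq_bigr => k _; rewrite !mxE; case: ifP; rewrite ?mulr0 // mulrC.
apply/submxP; exists a^T; apply/rowP => j; rewrite !mxE.
apply: eq_bigr => k _; rewrite !mxE mulrC.
by case: ifPn => // /aI ->; rewrite !mul0r.
Qed.

Lemma Pproj_sym Psi I : (Pproj Psi I)^T = Pproj Psi I.
Proof. exact: projmx_sym. Qed.

Lemma Pproj_idem Psi I : Pproj Psi I *m Pproj Psi I = Pproj Psi I.
Proof. exact: projmx_idem. Qed.

Lemma Pproj_id Psi I a : supp_in I a -> Pproj Psi I *m (Psi *m a) = Psi *m a.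
Proof. by move=> aI; apply: projmx_id; apply/sub_selP; exists a. Qed.

Lemma Pproj_col Psi I k : k \in I -> Pproj Psi I *m col k Psi = col k Psi.
Proof. by move=> kI; rewrite -mulmx_delta Pproj_id //; exact: supp_in_delta. Qed.

Lemma Pproj_ran Psi I v : exists2 a, supp_in I a & Pproj Psi I *m v = Psi *m a.
Proof. by apply/sub_selP; exact: projmx_sub. Qed.

Lemma Pproj_dot Psi I v w : dotv (Pproj Psi I *m v) w = dotv v (Pproj Psi I *m w).
Proof. by rewrite dotv_mulmxl Pproj_sym. Qed.

Lemma Pproj_idemv Psi I v : Pproj Psi I *m (Pproj Psi I *m v) = Pproj Psi I *m v.
Proof. by rewrite mulmxA Pproj_idem. Qed.

Lemma Pproj_orth Psi I v w : dotv (v - Pproj Psi I *m v) (Pproj Psi I *m w) = 0.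
Proof. by rewrite dotvBl Pproj_dot Pproj_idemv -Pproj_dot subrr. Qed.

Lemma Pproj_pyth Psi I v :
  dotv v v = dotv (Pproj Psi I *m v) (Pproj Psi I *m v)
           + dotv (v - Pproj Psi I *m v) (v - Pproj Psi I *m v).
Proof.
by rewrite -{1 2}(subrK (Pproj Psi I *m v) v) (dotv_orthD (Pproj_orth Psi I v v)) addrC.
Qed.

(** [Psi *m a] lies in the span, so subtracting it leaves the residual of [v] unchanged, and a
    residual is no longer than the vector it comes from. *)
Lemma Pproj_min Psi I v a : supp_in I a ->
  dotv (v - Pproj Psi I *m v) (v - Pproj Psi I *m v)
    <= dotv (v - Psi *m a) (v - Psi *m a).
Proof.
move=> aI; rewrite (Pproj_pyth Psi I (v - Psi *m a)).
rewrite mulmxBr (Pproj_id _ aI) opprB addrA subrK.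
by rewrite lerDr dotv_ge0.
Qed.

Lemma Pproj_le Psi I v : dotv (Pproj Psi I *m v) (Pproj Psi I *m v) <= dotv v v.
Proof. by rewrite (Pproj_pyth Psi I v) lerDl dotv_ge0. Qed.

Lemma vnorm_Pproj Psi I v : vnorm (Pproj Psi I *m v) <= vnorm v.
Proof. by apply: ler_vnorm; exact: Pproj_le. Qed.

Lemma Pproj_vnorm2 Psi I v :
  vnorm (Pproj Psi I *m v) ^+ 2 = dotv v (Pproj Psi I *m v).
Proof. by rewrite vnorm_sqr Pproj_dot Pproj_idemv. Qed.

(** The trace is the rank, and the masked matrix factors through [#|I|] coordinates. *)
Lemma Pproj_trace_le Psi I : \tr (Pproj Psi I) <= #|I|%:R.
Proof.
rewrite projmx_trace ler_nat -/(sel Psi I).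
suff -> : sel Psi I = (\matrix_(i < K, j < #|I|) ((i == enum_val j)%:R : R))
                      *m (subcols Psi I)^T.
  by apply: leq_trans (mxrankM_maxl _ _) _; exact: rank_leq_col.
apply/matrixP => i j; rewrite !mxE; case: ifPn => iI.
  rewrite (bigD1 (enum_rank_in iI i)) //= !mxE enum_rankK_in // eqxx mul1r.
  rewrite big1 ?addr0 // => k ki; rewrite !mxE; case: eqP => [ik|]; last by rewrite mul0r.
  by case/eqP: ki; apply: enum_val_inj; rewrite enum_rankK_in.
rewrite big1 // => k _; rewrite !mxE; case: eqP => [ik|]; last by rewrite mul0r.
by rewrite ik enum_valP in iI.
Qed.

Lemma Pproj_trace_dim Psi I : \tr (Pproj Psi I) <= d%:R.
Proof. by rewrite projmx_trace ler_nat rank_leq_col. Qed.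

Lemma Pproj_trace_ge Psi I :
  (forall a, supp_in I a -> Psi *m a = 0 -> a = 0) -> #|I|%:R <= \tr (Pproj Psi I).
Proof.
move=> indep; rewrite projmx_trace ler_nat -/(sel Psi I).
have sub : ((subcols Psi I)^T <= sel Psi I)%MS.
  apply/row_subP => j; rewrite -tr_col; apply/sub_selP.
  exists (delta_mx (enum_val j) 0); first by apply: supp_in_delta; exact: enum_valP.
  by rewrite mulmx_delta; apply/colP => k; rewrite !mxE.
suff /eqP <- : row_free (subcols Psi I)^T by exact: mxrankS sub.
rewrite -kermx_eq0; apply/eqP/row_matrixP => i; rewrite row0.
set u := row i _.
have /sub_kermxP uS : (u <= kermx (subcols Psi I)^T)%MS by rewrite row_sub.
clearbody u; pose a : 'cV[R]_K := \sum_(j < #|I|) u 0 j *: delta_mx (enum_val j) 0.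
have aE k (kI : k \in I) : a k 0 = u 0 (enum_rank_in kI k).
  rewrite /a summxE (bigD1 (enum_rank_in kI k)) //= !mxE enum_rankK_in // !eqxx mulr1.
  rewrite big1 ?addr0 // => j jk; rewrite !mxE; case: eqP => [kj|]; last by rewrite mulr0.
  by case/eqP: jk; apply: enum_val_inj; rewrite enum_rankK_in.
have aI : supp_in I a.
  move=> k kI; rewrite summxE big1 // => j _; rewrite !mxE; case: eqP => [kj|]; last by rewrite mulr0.
  by rewrite kj enum_valP in kI.
have a0 : a = 0.
  apply: indep => //; apply: trmx_inj; rewrite trmx0 -uS mulmx_sumr raddf_sum /=.
  rewrite mulmx_sum_row; apply: eq_bigr => j _.
  by rewrite -scalemxAr linearZ /= mulmx_delta; congr (_ *: _); apply/rowP => k; rewrite !mxE.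
by apply/rowP => j; have := aE _ (enum_valP j); rewrite enum_valK_in a0 !mxE => <-.
Qed.

(** Write [v = w + P v] with [P w = 0]. Then [P v - P' v] is the sum of the orthogonal vectors
    [P v - P' (P v)] and [- P' w], bounded by [eta] times the orthogonal parts [P v] and [w] of [v].
    Hence no constant is lost. *)
Lemma proj_dist (P P' : 'M[R]_d) (eta : R) v :
    P^T = P -> P'^T = P' -> P *m P = P -> P' *m P' = P' ->
    (forall w, vnorm (P *m w - P' *m (P *m w)) <= eta * vnorm (P *m w)) ->
    (forall w, vnorm (P' *m w - P *m (P' *m w)) <= eta * vnorm (P' *m w)) ->
  0 <= eta -> vnorm (P *m v - P' *m v) <= eta * vnorm v.
Proof.
move=> symP symP' idP idP' PP' P'P eta0.
have dP u w : dotv (P *m u) w = dotv u (P *m w) by rewrite dotv_mulmxl symP.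
have dP' u w : dotv (P' *m u) w = dotv u (P' *m w) by rewrite dotv_mulmxl symP'.
have iP u : P *m (P *m u) = P *m u by rewrite mulmxA idP.
have iP' u : P' *m (P' *m u) = P' *m u by rewrite mulmxA idP'.
have [w wE Pw] : exists2 w, v = w + P *m v & P *m w = 0.
  by exists (v - P *m v); rewrite ?subrK // mulmxBr iP subrr.
have P'w : vnorm (P' *m w) <= eta * vnorm w.
  have : vnorm (P' *m w) ^+ 2 <= eta * vnorm w * vnorm (P' *m w).
    rewrite vnorm_sqr dP' iP'.
    (* As [P w = 0], only the part of [P' w] outside the range of [P] pairs with [w], and the second
       one-sided bound controls that part. *)
    have -> : dotv w (P' *m w) = dotv w (P' *m w - P *m (P' *m w)).
      by rewrite dotvBr -(dP w) Pw dotv0l subr0.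
    apply: le_trans (ler_norm _) _; apply: le_trans (dotv_le_vnorm _ _) _.
    by rewrite -mulrA mulrCA ler_wpM2l ?vnorm_ge0.
  have [->|n0] := eqVneq (vnorm (P' *m w)) 0; first by rewrite mulr_ge0 ?vnorm_ge0.
  by rewrite expr2 ler_pM2r // lt_def n0 vnorm_ge0.
have E : P *m v - P' *m v = (P *m v - P' *m (P *m v)) - P' *m w.
  by rewrite -addrA -opprD -mulmxDr [P *m v + w]addrC -wE.
have : vnorm (P *m v - P' *m v) ^+ 2 <= (eta * vnorm v) ^+ 2.
  have o : dotv (P *m v - P' *m (P *m v)) (- (P' *m w)) = 0.
    by rewrite dotvNr dotvBl (dP' _ (P' *m w)) iP' subrr oppr0.
  rewrite E vnorm_sqr (dotv_orthD o) dotvNl dotvNr opprK.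
  rewrite -!vnorm_sqr exprMn.
  have -> : vnorm v ^+ 2 = vnorm (P *m v) ^+ 2 + vnorm w ^+ 2.
    have wv : dotv w (P *m v) = 0 by rewrite -dP Pw dotv0l.
    by rewrite !vnorm_sqr {1 2}wE (dotv_orthD wv) addrC.
  rewrite mulrDr -!exprMn lerD // ler_sqr ?nnegrE ?mulr_ge0 ?vnorm_ge0 //.
by rewrite ler_sqr // nnegrE ?mulr_ge0 ?vnorm_ge0.
Qed.

(** Cauchy-Schwarz in each row: the operator norm is at most the Frobenius norm. *)
Lemma vnorm_mulmx_supp I (F : 'I_K -> 'cV[R]_d) (e : R) (a : 'cV[R]_K) :
    0 <= e -> \sum_(k in I) dotv (F k) (F k) <= e ^+ 2 ->
  vnorm (\sum_(k in I) a k 0 *: F k) <= e * vnorm a.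
Proof.
move=> e0 Fe; rewrite -ler_sqr ?nnegrE ?mulr_ge0 ?vnorm_ge0 // exprMn !vnorm_sqr.
rewrite /dotv; apply: (@le_trans _ _ (\sum_j (\sum_(k in I) F k j 0 ^+ 2) * \sum_k a k 0 * a k 0)).
  apply: ler_sum => j _; rewrite -expr2.
  have := dotv_CS (\col_k (if k \in I then F k j 0 else 0)) a.
  have -> : dotv (\col_k (if k \in I then F k j 0 else 0)) a = (\sum_(k in I) a k 0 *: F k) j 0.
    rewrite summxE /dotv [RHS]big_mkcond; apply: eq_bigr => k _; rewrite !mxE.
    by case: ifP => _; rewrite ?mul0r // mulrC.
  move/le_trans; apply; rewrite ler_wpM2r ?dotv_ge0 // /dotv [leRHS]big_mkcond.
  by apply: ler_sum => k _; rewrite !mxE; case: ifP => _; rewrite ?mul0r // expr2.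
rewrite -mulr_suml ler_wpM2r ?dotv_ge0 // exchange_big /=.
apply: le_trans Fe; apply: ler_sum => k _; rewrite le_eqVlt; apply/orP; left.
by apply/eqP/eq_bigr => j _; rewrite expr2.
Qed.

Lemma inj_unitmx n (T : 'M[R]_n) : (forall x : 'cV[R]_n, T *m x = 0 -> x = 0) -> T \in unitmx.
Proof.
move=> inj; rewrite -unitmx_tr -row_free_unit -kermx_eq0; apply/eqP/row_matrixP => i.
rewrite row0; have /sub_kermxP u0 : (row i (kermx T^T) <= kermx T^T)%MS by rewrite row_sub.
by apply: trmx_inj; rewrite trmx0; apply: inj; apply: trmx_inj; rewrite trmx_mul trmxK u0 trmx0.
Qed.

(** A point of one span has coefficients of norm at most its own norm over [s]; using them with the
    other atoms moves it by at most [D / s] times its norm. Both directions are needed for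
    [proj_dist]. *)
Lemma Pproj_dist_lip Phi Psi I (s D : R) v : 0 < s -> 0 <= D ->
    (forall a, supp_in I a -> s * vnorm a <= vnorm (Phi *m a)) ->
    (forall a, supp_in I a -> s * vnorm a <= vnorm (Psi *m a)) ->
    \sum_(k in I) dotv (col k Phi - col k Psi) (col k Phi - col k Psi) <= D ^+ 2 ->
  vnorm (Pproj Phi I *m v - Pproj Psi I *m v) <= D / s * vnorm v.
Proof.
move=> s0 D0 sPhi sPsi PhiPsi.
have aux Ph Ps w : (forall a, supp_in I a -> s * vnorm a <= vnorm (Ph *m a)) ->
    \sum_(k in I) dotv (col k Ph - col k Ps) (col k Ph - col k Ps) <= D ^+ 2 ->
    vnorm (Pproj Ph I *m w - Pproj Ps I *m (Pproj Ph I *m w)) <= D / s * vnorm (Pproj Ph I *m w).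
  move=> sP PP; have [a aI ->] := Pproj_ran Ph I w.
  apply: (@le_trans _ _ (vnorm (Ph *m a - Ps *m a))); first by apply/ler_vnorm/Pproj_min.
  apply: (@le_trans _ _ (D * vnorm a)).
    rewrite !mulmx_colE -sumrB (eq_bigr (fun k => a k 0 *: (col k Ph - col k Ps))); last first.
      by move=> k _; rewrite scalerBr.
    by rewrite (sum_supp_in _ aI); exact: vnorm_mulmx_supp.
  by rewrite -mulrA ler_wpM2l // mulrC ler_pdivlMr // mulrC sP.
apply: proj_dist; rewrite ?Pproj_sym ?Pproj_idem //.
- by move=> w; exact: aux.
- move=> w; apply: aux => //; apply: le_trans PhiPsi; apply: ler_sum => k _.
  by rewrite -opprB dotvNl dotvNr opprK.
- by rewrite divr_ge0 // ltW.
Qed.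

(* The residuals of the atoms of [Phi] control both one-sided angles between
   the two spans, because [Pproj Psi I] maps the span of [Phi] onto that of
   [Psi]. *)
Lemma Pproj_dist_res Phi Psi I (s e : R) v : 0 < s -> 0 <= e -> 2 * e <= s ->
    (forall a, supp_in I a -> s * vnorm a <= vnorm (Phi *m a)) ->
    \sum_(k in I) dotv (col k Phi - Pproj Psi I *m col k Phi)
                       (col k Phi - Pproj Psi I *m col k Phi) <= e ^+ 2 ->
  vnorm (Pproj Phi I *m v - Pproj Psi I *m v) <= 2 * e / s * vnorm v.
Proof.
move=> s0 e0 es sPhi He.
have res a : supp_in I a ->
    vnorm (Phi *m a - Pproj Psi I *m (Phi *m a)) <= e * vnorm a.
  move=> aI; rewrite mulmx_colE mulmx_sumr -sumrB.
  rewrite (eq_bigr (fun k => a k 0 *: (col k Phi - Pproj Psi I *m col k Phi))); last first.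
    by move=> k _; rewrite -scalemxAr scalerBr.
  by rewrite (sum_supp_in _ aI); exact: vnorm_mulmx_supp.
have low a : supp_in I a -> s / 2 * vnorm a <= vnorm (Pproj Psi I *m (Phi *m a)).
  move=> aI; have := vnorm_sub_ge (Phi *m a) (Phi *m a - Pproj Psi I *m (Phi *m a)).
  rewrite subKr; have := res a aI; have := sPhi a aI.
  have : 2 * e * vnorm a <= s * vnorm a by rewrite ler_wpM2r ?vnorm_ge0.
  lra.
pose t k := projT1 (cid2 (Pproj_ran Psi I (col k Phi))).
have tI k : supp_in I (t k) by rewrite /t; case: cid2.
have tE k : Pproj Psi I *m col k Phi = Psi *m t k by rewrite /t; case: cid2.
(* Coefficients of the projected atoms on [I], the identity elsewhere, so coordinates outside [I]
   are preserved. Injectivity, from [low], makes [T] invertible, and every point of the span of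
   [Psi] over [I] becomes the projection of some [Phi *m a]. *)
pose T : 'M[R]_K := \matrix_(i, k) (if k \in I then t k i 0 else (i == k)%:R).
have TI i x : i \notin I -> (T *m x) i 0 = x i 0.
  move=> iI; rewrite mxE (bigD1 i) //= !mxE (negbTE iI) eqxx mul1r big1 ?addr0 //.
  move=> k ki; rewrite !mxE; case: ifP => kI; first by rewrite tI // mul0r.
  by rewrite eq_sym (negbTE ki) mul0r.
have TE x : supp_in I x -> T *m x = \sum_(k in I) x k 0 *: t k.
  move=> xI; apply/colP => i; rewrite mxE summxE [RHS]big_mkcond; apply: eq_bigr => k _.
  by rewrite !mxE; case: ifPn => [_|/xI ->]; rewrite ?mulr0 // mulrC.
have PsiT x : supp_in I x -> Psi *m (T *m x) = Pproj Psi I *m (Phi *m x).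
  move=> xI; rewrite TE // mulmx_sumr mulmx_colE mulmx_sumr.
  under [RHS]eq_bigr do rewrite -scalemxAr.
  rewrite (sum_supp_in _ xI); apply: eq_bigr => k _.
  by rewrite -scalemxAr tE.
have Tunit : T \in unitmx.
  apply: inj_unitmx => x Tx.
  have xI : supp_in I x by move=> k kI; rewrite -TI // Tx mxE.
  have := low x xI; rewrite -PsiT // Tx mulmx0 vnorm0 => sx.
  apply: dotv_eq0; rewrite -vnorm_sqr; apply/eqP; rewrite sqrf_eq0 eq_le vnorm_ge0 andbT.
  by rewrite -(pmulr_rle0 _ (_ : 0 < s / 2)) // divr_gt0.
have onto w : exists2 a, supp_in I a & Pproj Psi I *m w = Pproj Psi I *m (Phi *m a).
  have [b bI Pb] := Pproj_ran Psi I w.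
  have bT : T *m (invmx T *m b) = b by rewrite mulmxA mulmxV // mul1mx.
  have xI : supp_in I (invmx T *m b) by move=> k kI; rewrite -TI // bT bI.
  by exists (invmx T *m b) => //; rewrite -PsiT // bT.
apply: proj_dist; rewrite ?Pproj_sym ?Pproj_idem //.
- move=> w; have [a aI ->] := Pproj_ran Phi I w.
  apply: le_trans (res a aI) _.
  apply: (@le_trans _ _ (e / s * vnorm (Phi *m a))).
    by rewrite -mulrA ler_wpM2l // mulrC ler_pdivlMr // mulrC sPhi.
  rewrite ler_wpM2r ?vnorm_ge0 // ler_wpM2r ?invr_ge0 ?(ltW s0) //; lra.
- move=> w; have [a aI wa] := onto w.
  apply: (@le_trans _ _ (vnorm (Pproj Psi I *m w - Phi *m a))).
    by apply/ler_vnorm/Pproj_min.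
  rewrite wa vnormBC; apply: le_trans (res a aI) _.
  have -> : e * vnorm a = 2 * e / s * (s / 2 * vnorm a) by field; rewrite gt_eqF.
  by rewrite ler_wpM2l ?low // divr_ge0 ?mulr_ge0 // ltW.
- by rewrite divr_ge0 ?mulr_ge0 // ltW.
Qed.

End DictionaryProjections.

(** * Averages over signs and orderings *)

Section SignsAndPermutations.
Variable R : realType.
Variable K : nat.
Implicit Types (x : 'cV[R]_K) (p : 'S_K) (I : {set 'I_K}).

Lemma rearr_ge0 x i : 0 <= rearr x i.
Proof.
rewrite /rearr; set t := sort _ _; have [it|it] := ltnP i (size t); last first.
  by rewrite nth_default.
have : nth 0 t i \in t by rewrite mem_nth.
by rewrite mem_sort => /mapP[j _ ->].
Qed.

Lemma rearr_mono x i j : (i <= j)%N -> rearr x j <= rearr x i.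
Proof.
move=> ij; have [jK|jK] := ltnP j K; last first.
  by rewrite [leLHS]/rearr nth_default ?rearr_ge0 // size_sort size_map size_enum_ord.
rewrite /rearr; apply: (sorted_leq_nth (leT := fun a b : R => b <= a)) => //.
- by move=> b a c ba cb; exact: le_trans cb ba.
- by apply: sort_sorted => a b; exact: le_total.
- by rewrite inE size_sort size_map size_enum_ord (leq_ltn_trans ij).
- by rewrite inE size_sort size_map size_enum_ord.
Qed.

Lemma rearr_perm x : exists p, forall j, `|x j 0| = rearr x (p j).
Proof.
pose t := [tuple of [seq `|x j 0| | j <- enum 'I_K]].
have st : size (sort (fun a b : R => b <= a) t) == K.
  by rewrite size_sort size_map size_enum_ord.
have /tuple_permP [p tp] : perm_eq (Tuple st) [tuple `|x j 0| | j < K].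
  by rewrite /= perm_sort.
exists p^-1%g => j; rewrite /rearr /= tp.
rewrite (nth_map j) ?size_enum_ord ?ltn_ord // nth_ord_enum.
by rewrite tnth_mktuple permKV.
Qed.

(** Links the orbit in the gap condition to the orbit of [x] under the symmetries of its law. *)
Lemma c_ps_self x : exists p, exists s : {ffun 'I_K -> bool}, x = c_ps p s x.
Proof.
have [p xp] := rearr_perm x; exists p, [ffun j => x j 0 < 0].
apply/colP => j; rewrite mxE ffunE -xp; case: ltrP => [x0|x0].
  by rewrite expr1 mulN1r ltr0_norm // opprK.
by rewrite expr0 mul1r ger0_norm.
Qed.

Lemma sum_rearr_sqr x : \sum_(i < K) rearr x i ^+ 2 = dotv x x.
Proof.
have [p xp] := rearr_perm x.
rewrite (reindex_inj (@perm_inj _ p)) /=; apply: eq_bigr => j _.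
by rewrite -xp -expr2 real_normK // num_real.
Qed.

(** For distinct [i] and [j], flipping the sign at [i] is an involution that negates every
    summand. *)
Lemma sum_sign (i j : 'I_K) :
  \sum_(s : {ffun 'I_K -> bool}) (-1) ^+ s i * (-1) ^+ s j
    = if i == j then #|{ffun 'I_K -> bool}|%:R else 0 :> R.
Proof.
case: eqP => [<-|/eqP ij].
  rewrite (eq_bigr (fun=> 1)) ?sumr_const // => s _.
  by rewrite -exprD addnn -mul2n exprM sqrrN expr1n expr1n.
pose flip (s : {ffun 'I_K -> bool}) := [ffun k => s k (+) (k == i)].
have flipK : involutive flip.
  by move=> s; apply/ffunP => k; rewrite !ffunE -addbA addbb addbF.
set S := \sum_s _; suff : S = - S by move=> /eqP; rewrite -addr_eq0 -mulr2n mulrn_eq0 => /eqP.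
rewrite {1}/S (reindex_inj (inv_inj flipK)) /= /S -sumrN; apply: eq_bigr => s _.
rewrite !ffunE eqxx addbT eq_sym (negbTE ij) addbF -mulNr; congr (_ * _).
by case: (s i); rewrite ?expr0 ?expr1 ?opprK.
Qed.

Lemma sum_sign_vnorm m (M : 'M[R]_(m, K)) (c : 'I_K -> R) :
  \sum_(s : {ffun 'I_K -> bool}) vnorm (M *m \col_i ((-1) ^+ s i * c i)) ^+ 2
  = #|{ffun 'I_K -> bool}|%:R * \sum_i c i ^+ 2 * vnorm (col i M) ^+ 2.
Proof.
transitivity (\sum_(s : {ffun 'I_K -> bool}) \sum_i \sum_j
    ((-1) ^+ s i * (-1) ^+ s j) * (c i * c j * dotv (col i M) (col j M))).
  apply: eq_bigr => s _; rewrite vnorm_sqr mulmx_colE dotv_suml.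
  apply: eq_bigr => i _; rewrite dotv_sumr; apply: eq_bigr => j _.
  by rewrite dotvZl dotvZr !mxE; ring.
rewrite exchange_big mulr_sumr /=; apply: eq_bigr => i _.
rewrite exchange_big /= (bigD1 i) //= -mulr_suml sum_sign eqxx.
rewrite big1 ?addr0 ?vnorm_sqr; first by ring.
by move=> j ji; rewrite -mulr_suml sum_sign eq_sym (negbTE ji) mul0r.
Qed.

Lemma Ip_exists (S : nat) I : #|I| = S -> exists p, Ip S p = I.
Proof.
move=> IS; pose l := enum I ++ enum (~: I).
have lall k : k \in l by rewrite mem_cat !mem_enum inE; case: (k \in I).
have sl : size l = K by rewrite size_cat -!cardE cardsC card_ord.
have ltl k : (index k l < K)%N by rewrite -[X in (_ < X)%N]sl index_mem.
have inj : injective (fun k => Ordinal (ltl k)).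
  by move=> k k' [kk']; rewrite -(nth_index k (lall k)) kk' nth_index.
exists (perm inj); apply/setP => k; rewrite inE permE /= index_cat mem_enum.
case: ifPn => kI; first by rewrite -IS cardE index_mem mem_enum.
by apply/negbTE; rewrite -leqNgt -cardE IS leq_addr.
Qed.

Lemma card_Ip S p : (S <= K)%N -> #|Ip S p| = S.
Proof.
move=> SK; rewrite /Ip -sum1_card.
rewrite (eq_bigl (fun i => p i < S)%N); last by move=> i; rewrite inE.
rewrite (reindex_inj (@perm_inj _ p^-1%g)) /=.
rewrite (eq_bigl (fun i : 'I_K => i < S)%N); last by move=> i; rewrite permKV.
by rewrite -(big_ord_widen K (fun=> 1%N) SK) sum1_card card_ord.
Qed.

Lemma sumr_const_set (T : finType) (P : pred T) (c : R) :
  \sum_(t | P t) c = #|[set t | P t]%SET|%:R * c.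
Proof.
rewrite (eq_bigl (mem (finset P))) ?sumr_const ?mulr_natl //.
by move=> t; rewrite /= inE.
Qed.

(** Composing with the transposition of [i] and [j] preserves [Ip S p = I] when both indices lie on
    the same side of [I]. *)
Lemma sum_Ip_swap S (f : nat -> R) I i j : (i \in I) = (j \in I) ->
  \sum_(p | Ip S p == I) f (p i) = \sum_(p | Ip S p == I) f (p j).
Proof.
move=> ijI; rewrite [RHS](reindex_inj (mulgI (tperm i j))) /=.
have tI k : (tperm i j k \in I) = (k \in I) by case: tpermP => // ->.
have Ipt p : Ip S p = I -> Ip S (tperm i j * p)%g = I.
  by move=> pI; apply/setP => k; rewrite inE permM -[RHS]tI -pI inE.
apply: eq_big => [p|p _]; last by rewrite permM tpermR.
apply/eqP/eqP => pI; first exact: Ipt.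
by rewrite -[p]mul1g -(tperm2 i j) -mulgA; exact: Ipt.
Qed.

(** By [sum_Ip_swap] every index of [I] gives the same sum; after adding these sums, each [p] maps
    [I] onto the first [S] positions. *)
Lemma sum_Ip_in S (f : nat -> R) I i : #|I| = S -> i \in I ->
  S%:R * (\sum_(p | Ip S p == I) f (p i))
    = #|[set p | Ip S p == I]%SET|%:R * \sum_(j < K | (j < S)%N) f j.
Proof.
move=> IS iI; transitivity (\sum_(k in I) \sum_(p | Ip S p == I) f (p k)).
  rewrite [RHS](eq_bigr (fun=> \sum_(p | Ip S p == I) f (p i))); last first.
    by move=> k kI; apply: (sum_Ip_swap S f); rewrite kI iI.
  by rewrite sumr_const IS mulr_natl.
rewrite exchange_big /= (eq_bigr (fun=> \sum_(j < K | (j < S)%N) f j)).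
  by rewrite sumr_const_set.
move=> p /eqP <-; rewrite [RHS](reindex_inj (@perm_inj _ p)) /=.
by apply: eq_bigl => k; rewrite inE.
Qed.

Lemma sum_Ip_notin S (f : nat -> R) I i : #|I| = S -> i \notin I ->
  (K%:R - S%:R) * (\sum_(p | Ip S p == I) f (p i))
    = #|[set p | Ip S p == I]%SET|%:R * \sum_(j < K | ~~ (j < S)%N) f j.
Proof.
move=> IS iI; transitivity (\sum_(k | k \notin I) \sum_(p | Ip S p == I) f (p k)).
  rewrite [RHS](eq_bigr (fun=> \sum_(p | Ip S p == I) f (p i))); last first.
    by move=> k kI; apply: (sum_Ip_swap S f); rewrite (negbTE kI) (negbTE iI).
  have := cardC I; rewrite card_ord IS => cE.
  have -> : K%:R - S%:R = #|[predC I]|%:R :> R.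
    by rewrite -[X in X%:R - _ = _]cE natrD addrAC subrr add0r.
  by rewrite [RHS]sumr_const mulr_natl.
rewrite exchange_big /= (eq_bigr (fun=> \sum_(j < K | ~~ (j < S)%N) f j)).
  by rewrite sumr_const_set.
move=> p /eqP <-; rewrite [RHS](reindex_inj (@perm_inj _ p)) /=.
by apply: eq_bigl => k; rewrite inE.
Qed.

Lemma sum_Ip_weight S (f : nat -> R) I (W : 'I_K -> R) :
    (0 < S < K)%N -> #|I| = S ->
  \sum_(p | Ip S p == I) \sum_i f (p i) * W i
    = #|[set p | Ip S p == I]%SET|%:R *
      ((\sum_(j < K | (j < S)%N) f j) / S%:R * (\sum_(i in I) W i)
     + (\sum_(j < K | ~~ (j < S)%N) f j) / (K%:R - S%:R) * (\sum_(i | i \notin I) W i)).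
Proof.
move=> /andP[S0 SK] IS; rewrite exchange_big /= (bigID (mem I)) /=.
have nS : S%:R != 0 :> R by rewrite pnatr_eq0 -lt0n.
have nKS : K%:R - S%:R != 0 :> R by rewrite subr_eq0 eqr_nat gtn_eqF.
rewrite mulrDr !mulr_sumr; congr (_ + _); apply: eq_bigr => i iI; rewrite -mulr_suml.
  have /(canRL (mulKf nS)) -> := sum_Ip_in f IS iI; by field.
have /(canRL (mulKf nKS)) -> := sum_Ip_notin f IS iI; by field.
Qed.

End SignsAndPermutations.

(** * Deterministic consequences of the gap condition *)

Section GapConsequences.

(** The gap hypothesis at one [x]; a single such unit vector already yields the quantitative
    independence of the atoms. *)
Definition gap_separated (R : realType) (d K S : nat) (Phi : 'M[R]_(d, K)) (kappa : R)
    (x : 'cV[R]_K) : Prop :=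
  forall (p : 'S_K) (s : 'I_K -> bool),
    2 * kappa <=
      vnorm (Pproj Phi (Ip S p) *m (Phi *m c_ps p s x))
      - \big[Num.max/0]_(I : {set 'I_K} | (#|I| <= S)%N && (I != Ip S p))
           vnorm (Pproj Phi I *m (Phi *m c_ps p s x)).

Variable R : realType.
Variables (d K S : nat) (Phi : 'M[R]_(d, K)) (A : R).
Implicit Types (x : 'cV[R]_K) (p : 'S_K) (I J : {set 'I_K}).

(** The squared cosine of the angle between the unit atom [i] of [Phi] and the span of [Psi] over
    [I]. *)
Definition atom_energy (Psi : 'M[R]_(d, K)) I i : R :=
  vnorm (Pproj Psi I *m col i Phi) ^+ 2.

(** Pointwise counterpart of [lambda]: it is affine in [topS_sq], whose mean is [gammaS2]. *)
Definition topS_gap x : R :=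
  topS_sq S x / S%:R - (1 - topS_sq S x) / (K%:R - S%:R).

Hypothesis tight : unit_norm_tight_frame Phi A.

(** Tightness gives [|Phi^T y|^2 = A |y|^2] for [y = Phi x]; combine it with
    [|y|^2 <= |x| |Phi^T y|]. *)
Lemma tight_vnorm_le x : vnorm (Phi *m x) ^+ 2 <= A * vnorm x ^+ 2.
Proof.
have h : vnorm (Phi^T *m (Phi *m x)) ^+ 2 = A * vnorm (Phi *m x) ^+ 2.
  rewrite -(tight.2 (Phi *m x)) vnorm_sqr /dotv; apply: eq_bigr => i _.
  rewrite -expr2; congr (_ ^+ 2); rewrite mxE; apply: eq_bigr => j _.
  by rewrite !mxE.
have c : vnorm (Phi *m x) ^+ 2 <= vnorm x * vnorm (Phi^T *m (Phi *m x)).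
  by rewrite vnorm_sqr dotv_mulmxl; apply: le_trans (ler_norm _) (dotv_le_vnorm _ _).
have [y0|y0] := eqVneq (vnorm (Phi *m x)) 0.
  have [x0|x0] := eqVneq (vnorm x) 0; first by rewrite y0 x0 expr0n mulr0.
  rewrite y0 expr0n /= mulr_ge0 ?sqr_ge0 //.
  have xp : 0 < vnorm x ^+ 2 by rewrite exprn_even_gt0.
  (* A nonzero [x] provides an index, hence a unit atom, whose frame identity shows [A >= 0]. *)
  have K0 : exists i : 'I_K, x i 0 != 0.
    apply/existsP; apply: contraNT x0 => /existsPn x0.
    suff -> : x = 0 by rewrite vnorm0.
    by apply/colP => i; rewrite mxE; have := x0 i; rewrite negbK => /eqP.
  have [i _] := K0; have := tight.2 (col i Phi); rewrite (tight.1 i) expr1n mulr1 => <-.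
  by apply: sumr_ge0 => k _; exact: sqr_ge0.
have yp : 0 < vnorm (Phi *m x) ^+ 2 by rewrite exprn_even_gt0.
have : (vnorm (Phi *m x) ^+ 2) ^+ 2 <= A * vnorm x ^+ 2 * vnorm (Phi *m x) ^+ 2.
  rewrite mulrAC -h mulrC -exprMn ler_sqr // nnegrE ?mulr_ge0 ?vnorm_ge0 // ltW //.
by rewrite {1}expr2 ler_pM2r.
Qed.

(** By tightness the total energy depends only on the rank of the projection, not on its
    position. *)
Lemma sum_atom_energy Psi I : \sum_i atom_energy Psi I i = A * \tr (Pproj Psi I).
Proof.
rewrite /mxtrace mulr_sumr.
transitivity (\sum_i \sum_k dotv (col i Phi) (col k (Pproj Psi I)) ^+ 2).
  apply: eq_bigr => i _; rewrite /atom_energy vnorm_sqr; apply: eq_bigr => k _.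
  rewrite -expr2; congr (_ ^+ 2); rewrite mxE; apply: eq_bigr => j _.
  by rewrite -{1}Pproj_sym !mxE mulrC.
rewrite exchange_big /=; apply: eq_bigr => k _; rewrite (tight.2 _); congr (_ * _).
rewrite -{2}(Pproj_idem Psi I) vnorm_sqr mxE; apply: eq_bigr => j _.
by rewrite -{1}Pproj_sym !mxE.
Qed.

Lemma atom_energy_in Psi I i : Psi = Phi -> i \in I -> atom_energy Psi I i = 1.
Proof. by move=> -> iI; rewrite /atom_energy Pproj_col // tight.1 expr1n. Qed.

Lemma atom_energy_res Psi I i :
  atom_energy Psi I i = 1 - dotv (col i Phi - Pproj Psi I *m col i Phi)
                                 (col i Phi - Pproj Psi I *m col i Phi).
Proof.
have := Pproj_pyth Psi I (col i Phi).
rewrite -[X in X = _]vnorm_sqr tight.1 expr1n => ->.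
by rewrite addrK /atom_energy vnorm_sqr.
Qed.

Lemma sum_sign_energy Psi I p x :
  \sum_(s : {ffun 'I_K -> bool}) vnorm (Pproj Psi I *m (Phi *m c_ps p s x)) ^+ 2
  = #|{ffun 'I_K -> bool}|%:R * \sum_i rearr x (p i) ^+ 2 * atom_energy Psi I i.
Proof.
rewrite (eq_bigr (fun s : {ffun 'I_K -> bool} =>
  vnorm (Pproj Psi I *m Phi *m \col_i ((-1) ^+ s i * rearr x (p i))) ^+ 2)); last first.
  by move=> s _; rewrite -mulmxA.
rewrite sum_sign_vnorm; congr (_ * _); apply: eq_bigr => i _.
by rewrite /atom_energy colE -mulmxA -colE.
Qed.

Lemma topS_sq_compl x : vnorm x = 1 ->
  \sum_(j < K | ~~ (j < S)%N) rearr x j ^+ 2 = 1 - topS_sq S x.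
Proof.
move=> x1; have := sum_rearr_sqr x; rewrite -vnorm_sqr x1 expr1n.
rewrite (bigID (fun j : 'I_K => (j < S)%N)) /= => <-.
by rewrite /topS_sq addrAC subrr add0r.
Qed.

Lemma topS_sq_ge0 x : 0 <= topS_sq S x.
Proof. by apply: sumr_ge0 => i _; exact: sqr_ge0. Qed.

Lemma topS_sq_le1 x : vnorm x = 1 -> topS_sq S x <= 1.
Proof.
move=> x1; rewrite -subr_ge0 -topS_sq_compl //.
by apply: sumr_ge0 => i _; exact: sqr_ge0.
Qed.

Hypothesis SK : (0 < S < K)%N.

Let S0 : 0 < S%:R :> R. Proof. by rewrite ltr0n; case/andP: SK. Qed.
Let KS0 : 0 < K%:R - S%:R :> R. Proof. by rewrite subr_gt0 ltr_nat; case/andP: SK. Qed.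

Lemma topS_gap_le x : vnorm x = 1 -> topS_gap x <= S%:R^-1.
Proof.
move=> x1; have s1 := topS_sq_le1 x1; rewrite /topS_gap.
have : topS_sq S x / S%:R <= S%:R^-1 by rewrite ler_piMl // invr_ge0 ltW.
have : 0 <= (1 - topS_sq S x) / (K%:R - S%:R) by rewrite divr_ge0 ?subr_ge0 // ltW // -subr_gt0.
lra.
Qed.

(* Averaging over all sign patterns and over all orderings [p] with [Ip S p = I]
   replaces [rearr x (p i) ^+ 2] by its mean over [I], respectively over the
   complement of [I]; tightness then leaves only the atoms in [I]. *)
Lemma sum_energy_diff Psi Psi' I I' x : vnorm x = 1 -> #|I| = S ->
    \sum_i atom_energy Psi I i <= \sum_i atom_energy Psi' I' i ->
  \sum_(p | Ip S p == I) \sum_(s : {ffun 'I_K -> bool})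
    (vnorm (Pproj Psi I *m (Phi *m c_ps p s x)) ^+ 2
     - vnorm (Pproj Psi' I' *m (Phi *m c_ps p s x)) ^+ 2)
  <= #|{ffun 'I_K -> bool}|%:R * #|[set p | Ip S p == I]%SET|%:R *
     (topS_gap x * \sum_(i in I) (atom_energy Psi I i - atom_energy Psi' I' i)).
Proof.
move=> x1 IS trle.
rewrite (eq_bigr (fun p : 'S_K => #|{ffun 'I_K -> bool}|%:R *
   \sum_i rearr x (p i) ^+ 2 * (atom_energy Psi I i - atom_energy Psi' I' i))); last first.
  move=> p _; rewrite sumrB !sum_sign_energy -mulrBr -sumrB; congr (_ * _).
  by apply: eq_bigr => i _; rewrite mulrBr.
rewrite -mulr_sumr -mulrA ler_wpM2l ?ler0n //.
rewrite (sum_Ip_weight (fun j => rearr x j ^+ 2) _ SK IS) ler_wpM2l ?ler0n //.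
rewrite topS_sq_compl // -/(topS_sq S x) /topS_gap.
have : 0 <= (1 - topS_sq S x) / (K%:R - S%:R).
  by rewrite divr_ge0 ?subr_ge0 ?topS_sq_le1 // -subr_ge0 ltW.
have : \sum_(i in I) (atom_energy Psi I i - atom_energy Psi' I' i)
     + \sum_(i | i \notin I) (atom_energy Psi I i - atom_energy Psi' I' i) <= 0.
  by rewrite -(bigID (mem I) xpredT) /= sumrB subr_le0.
set a := \sum_(i in I) _; set b := \sum_(i | _) _.
move: (_ / S%:R) (_ / (K%:R - S%:R)) => c1 c2 ab c20.
have : c2 * (a + b) <= 0 by rewrite mulr_ge0_le0.
lra.
Qed.

Variable kappa : R.
Hypothesis kappa0 : 0 < kappa.
Variable x0 : 'cV[R]_K.
Hypothesis x01 : vnorm x0 = 1.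
Hypothesis gap0 : gap_separated S Phi kappa x0.

Let sqr_gap (k a b : R) : 0 < k -> 0 <= a -> a + 2 * k <= b ->
  4 * k ^+ 2 <= b ^+ 2 - a ^+ 2.
Proof.
move=> k0 a0 ab; have -> : 4 * k ^+ 2 = 2 * k * (2 * k) by ring.
by rewrite subr_sqr; apply: ler_pM; lra.
Qed.

Lemma gap_le p (s : 'I_K -> bool) I : (#|I| <= S)%N -> I != Ip S p ->
  vnorm (Pproj Phi I *m (Phi *m c_ps p s x0)) + 2 * kappa
    <= vnorm (Pproj Phi (Ip S p) *m (Phi *m c_ps p s x0)).
Proof.
move=> IS Ip; have := gap0 p s; rewrite lerBrDr addrC; apply: le_trans; rewrite lerD2r.
by apply: le_bigmax_cond; rewrite IS Ip.
Qed.

(** If [a l] were nonzero, atom [l] could be dropped from [I] without shrinking the span. The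
    competitor [I :\ l] is covered by the gap condition, which ranges over all sets of at most [S]
    atoms. *)
Lemma gap_indep I a : #|I| = S -> supp_in I a -> Phi *m a = 0 -> a = 0.
Proof.
move=> IS aI Pa; apply/colP => l; rewrite mxE; apply/eqP; apply: contraTT isT => al.
have lI : l \in I by apply: contraNT al => /aI ->.
have [p pI] := Ip_exists IS.
have := @gap_le p (fun=> false) (I :\ l); rewrite pI.
have cardIl : (#|I :\ l| <= S)%N by rewrite -IS subset_leq_card // subD1set.
have neqIl : I :\ l != I by apply: contraTneq lI => <-; rewrite !inE eqxx.
set y := Phi *m _ => /(_ cardIl neqIl) gapI; exfalso.
suff h : vnorm (Pproj Phi I *m y) <= vnorm (Pproj Phi (I :\ l) *m y).
  by have := le_trans gapI h; rewrite gerDl leNgt mulr_gt0.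
apply: ler_vnorm; have [b bI Pb] := Pproj_ran Phi I y.
have supp : supp_in (I :\ l) (b - (b l 0 / a l 0) *: a).
  move=> k; rewrite !inE negb_and negbK !mxE => /orP[/eqP ->|kI].
    by rewrite divfK // subrr.
  by rewrite (aI k kI) (bI k kI) mulr0 subr0.
have := Pproj_min Phi y supp; rewrite mulmxBr -scalemxAr Pa scaler0 subr0 -Pb.
have := Pproj_pyth Phi I y; have := Pproj_pyth Phi (I :\ l) y; lra.
Qed.

Hypothesis A0 : 0 <= A.

(** Together with the reverse bound for [Phi], which rests on independence, this is the comparison
    of traces that [sum_energy_diff] requires. *)
Lemma frame_trace Psi I : #|I| = S -> \sum_i atom_energy Psi I i <= A * S%:R.
Proof. by move=> IS; rewrite sum_atom_energy ler_wpM2l // -IS Pproj_trace_le. Qed.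

Lemma frame_trace_Phi I : #|I| = S -> A * S%:R <= \sum_i atom_energy Phi I i.
Proof.
move=> IS; rewrite sum_atom_energy ler_wpM2l // -IS Pproj_trace_ge // => a.
by apply: gap_indep.
Qed.

(* Comparing [J :\ j] with [J :\ l] in the averaged gap condition isolates the
   distance from the atom [l] to the span of the rest of [J]. *)
Lemma atom_dist J l : #|J| = S.+1 -> l \in J ->
  4 * kappa ^+ 2 * S%:R <= dotv (col l Phi - Pproj Phi (J :\ l) *m col l Phi)
                                (col l Phi - Pproj Phi (J :\ l) *m col l Phi).
Proof.
move=> JS lJ; have cardJ k : k \in J -> #|J :\ k| = S.
  by move=> kJ; have := cardsD1 k J; rewrite kJ JS add1n => -[].
(* A second index exists because [S] is positive; [J :\ j] contains [l] while [J :\ l] does not. *)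
have [j jJl] : exists j, j \in J :\ l.
  by apply/set0Pn; rewrite -card_gt0 cardJ //; case/andP: SK.
have [jl jJ] := setD1P jJl.
have IS := cardJ _ jJ; have I'S := cardJ _ lJ.
have II' : J :\ l != J :\ j.
  by apply: contraTneq (jJl) => ->; rewrite !inE eqxx.
have := sum_energy_diff x01 IS (le_trans (frame_trace Phi IS) (frame_trace_Phi I'S)).
set n := #|[set p | _]%SET|; set m := #|{ffun _ -> _}|.
have n0 : 0 < n%:R :> R.
  rewrite ltr0n card_gt0; have [p pI] := Ip_exists IS.
  by apply/set0Pn; exists p; rewrite inE pI.
have m0 : 0 < m%:R :> R by rewrite ltr0n /m card_ffun card_bool expn_gt0.
move=> up; have low : m%:R * n%:R * (4 * kappa ^+ 2) <=
    \sum_(p | Ip S p == J :\ j) \sum_(s : {ffun 'I_K -> bool})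
    (vnorm (Pproj Phi (J :\ j) *m (Phi *m c_ps p s x0)) ^+ 2
     - vnorm (Pproj Phi (J :\ l) *m (Phi *m c_ps p s x0)) ^+ 2).
  apply: (@le_trans _ _ (\sum_(p | Ip S p == J :\ j) \sum_(s : {ffun 'I_K -> bool}) 4 * kappa ^+ 2)).
    rewrite (eq_bigr (fun=> m%:R * (4 * kappa ^+ 2))).
      by rewrite sumr_const_set -/n [leRHS]mulrCA [leRHS]mulrA.
    by move=> p _; rewrite sumr_const [RHS]mulr_natl.
  apply: ler_sum => p /eqP pI; apply: ler_sum => s _.
  have := @gap_le p s (J :\ l); rewrite pI I'S leqnn => /(_ isT II').
  by apply: sqr_gap => //; exact: vnorm_ge0.
have := le_trans low up; rewrite ler_pM2l ?mulr_gt0 //.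
rewrite (bigD1 l) /=; last by rewrite !inE eq_sym jl.
(* Every other atom of [J :\ j] lies in both supports and has energy 1 in each. *)
rewrite big1 ?addr0; last first.
  move=> i /andP[iI il]; rewrite atom_energy_in // atom_energy_in ?subrr //.
  by move: iI; rewrite !inE il => /andP[_ ->].
rewrite atom_energy_in // ?inE ?lJ ?(eq_sym l) ?jl //.
rewrite atom_energy_res subKr; set D := dotv _ _ => h.
have D0 : 0 <= D by exact: dotv_ge0.
have : topS_gap x0 * D <= S%:R^-1 * D by rewrite ler_wpM2r // topS_gap_le.
by move/(le_trans h); rewrite ler_pdivlMl // mulrC.
Qed.

Lemma card_extend I n : (#|I| <= n <= K)%N -> exists2 J : {set 'I_K}, I \subset J & #|J| = n.
Proof.
elim: n => [|n IH]; first by rewrite leqn0 => /andP[/eqP I0 _]; exists I.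
move=> /andP[]; rewrite leq_eqVlt => /orP[/eqP In _|In nK]; first by exists I.
have [|J IJ Jn] := IH; first by rewrite -ltnS In ltnW.
have [j jJ] : exists j, j \in ~: J.
  by apply/set0Pn; rewrite -card_gt0 cardsCs finset.setCK card_ord Jn subn_gt0.
exists (j |: J); first by apply: fintype.subset_trans IJ (finset.subsetUr _ _).
by move: jJ; rewrite finset.in_setC cardsU1 => ->; rewrite Jn.
Qed.

(** Divided by [a k], the vector [Phi *m a] is atom [k] minus a combination of [S] other atoms, and
    [atom_dist] bounds its length. *)
Lemma frame_coord_low J a k : (#|J| <= S.+1)%N -> supp_in J a ->
  2 * kappa * Num.sqrt S%:R * `|a k 0| <= vnorm (Phi *m a).
Proof.
move=> JS aJ; have [->|ak] := eqVneq (a k 0) 0; first by rewrite normr0 mulr0 vnorm_ge0.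
have [|J' JJ' J'S] := @card_extend J S.+1; first by rewrite JS; case/andP: SK.
have kJ' : k \in J' by apply: contraNT ak => kJ'; rewrite (supp_in_sub JJ' aJ).
have := atom_dist J'S kJ'.
have supp : supp_in (J' :\ k) (delta_mx k 0 - (a k 0)^-1 *: a).
  move=> i; rewrite !inE negb_and negbK !mxE => /orP[/eqP ->|iJ].
    by rewrite !eqxx mulVf // subrr.
  rewrite (supp_in_sub JJ' aJ iJ) mulr0 subr0 andbT; case: eqP => // ik.
  by rewrite ik kJ' in iJ.
move=> /le_trans/(_ (Pproj_min Phi (col k Phi) supp)).
rewrite mulmxBr mulmx_delta subKr -scalemxAr dotvZl dotvZr mulrA -expr2 -vnorm_sqr.
rewrite exprVn ler_pdivlMl ?exprn_even_gt0 // => h.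
rewrite -ler_sqr ?nnegrE ?vnorm_ge0 ?mulr_ge0 ?sqrtr_ge0 ?(ltW kappa0) //.
rewrite !exprMn sqr_sqrtr ?ler0n // real_normK ?num_real //.
by apply: le_trans h; rewrite le_eqVlt; apply/orP; left; apply/eqP; ring.
Qed.

(** [frame_coord_low] bounds each squared coefficient with a factor [S] to spare; summing over at
    most [S] coordinates uses up exactly this factor. *)
Lemma frame_low I a : (#|I| <= S)%N -> supp_in I a ->
  2 * kappa * vnorm a <= vnorm (Phi *m a).
Proof.
move=> IS aI; have h k := frame_coord_low k (leqW IS) aI.
rewrite -ler_sqr ?nnegrE ?vnorm_ge0 ?mulr_ge0 ?vnorm_ge0 ?(ltW kappa0) //.
rewrite exprMn (vnorm_sqr a) -(ler_pM2l S0).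
have hk k : 4 * kappa ^+ 2 * S%:R * (a k 0 * a k 0) <= vnorm (Phi *m a) ^+ 2.
  have := h k; rewrite -ler_sqr ?nnegrE ?vnorm_ge0 ?mulr_ge0 ?sqrtr_ge0 ?(ltW kappa0) //.
  rewrite !exprMn sqr_sqrtr ?ler0n // real_normK ?num_real //; apply: le_trans.
  by rewrite le_eqVlt; apply/orP; left; apply/eqP; ring.
have -> : S%:R * ((2 * kappa) ^+ 2 * dotv a a) =
    \sum_(k in I) 4 * kappa ^+ 2 * S%:R * (a k 0 * a k 0).
  rewrite -mulr_sumr /dotv (bigID (mem I)) /= [X in _ + X]big1 ?addr0; first by ring.
  by move=> k /aI ->; rewrite mul0r.
apply: le_trans (ler_sum _ (fun k _ => hk k)) _.
by rewrite sumr_const -[_ *+ #|I|]mulr_natl ler_wpM2r ?sqr_ge0 // ler_nat.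
Qed.

End GapConsequences.

(** * Stability under small changes of the atoms *)

Section Perturbation.
Variable R : realType.
Variables (d K S : nat) (Phi Psi : 'M[R]_(d, K)) (r : R).
Implicit Types (p : 'S_K) (I J : {set 'I_K}) (a : 'cV[R]_K).

(** The energy that the atoms in [I] lose when [Phi] is replaced by [Psi], by [atom_energy_res]. *)
Definition resid I : R :=
  \sum_(k in I) dotv (col k Phi - Pproj Psi I *m col k Phi)
                     (col k Phi - Pproj Psi I *m col k Phi).

Lemma resid_ge0 I : 0 <= resid I.
Proof. by apply: sumr_ge0 => k _; exact: dotv_ge0. Qed.

Hypothesis r0 : 0 <= r.
Hypothesis near : forall k, vnorm (col k Phi - col k Psi) <= r.

Lemma sum_near I : (#|I| <= S)%N ->
  \sum_(k in I) dotv (col k Phi - col k Psi) (col k Phi - col k Psi)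
    <= (r * Num.sqrt S%:R) ^+ 2.
Proof.
move=> IS; apply: (@le_trans _ _ (\sum_(k in I) r ^+ 2)).
  by apply: ler_sum => k _; rewrite -vnorm_sqr ler_sqr ?nnegrE ?vnorm_ge0.
rewrite sumr_const exprMn sqr_sqrtr ?ler0n // -[_ *+ #|I|]mulr_natr.
by rewrite ler_wpM2l ?sqr_ge0 // ler_nat.
Qed.

Lemma near_low (s : R) I a : (#|I| <= S)%N -> 2 * (r * Num.sqrt S%:R) <= s ->
    (forall a, supp_in I a -> s * vnorm a <= vnorm (Phi *m a)) -> supp_in I a ->
  s / 2 * vnorm a <= vnorm (Psi *m a).
Proof.
move=> IS rs sPhi aI.
have e0 : 0 <= r * Num.sqrt S%:R by rewrite mulr_ge0 ?sqrtr_ge0.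
have := vnorm_mulmx_supp a e0 (sum_near IS).
rewrite -(sum_supp_in _ aI).
rewrite (eq_bigr (fun k => a k 0 *: col k Phi - a k 0 *: col k Psi)); last first.
  by move=> k _; rewrite scalerBr.
rewrite sumrB -!mulmx_colE => h.
have := vnorm_sub_ge (Phi *m a) (Phi *m a - Psi *m a); rewrite subKr.
have := sPhi _ aI.
have : 2 * (r * Num.sqrt S%:R) * vnorm a <= s * vnorm a by rewrite ler_wpM2r ?vnorm_ge0.
lra.
Qed.

(** Every coefficient is at most [|Phi a| / c], so moving at most [S + 1] atoms by [r] changes the
    image by at most half of [|Phi a|]. *)
Lemma near_coord_low (c : R) J a l : (#|J| <= S.+1)%N -> 0 < c -> 2 * (S.+1%:R * r) <= c ->
    (forall k, c * `|a k 0| <= vnorm (Phi *m a)) -> supp_in J a ->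
  c / 2 * `|a l 0| <= vnorm (Psi *m a).
Proof.
move=> JS c0 rc cPhi aJ.
have h : vnorm (Phi *m a - Psi *m a) <= S.+1%:R * (r * (vnorm (Phi *m a) / c)).
  rewrite !mulmx_colE -sumrB.
  rewrite (eq_bigr (fun k => a k 0 *: (col k Phi - col k Psi))); last first.
    by move=> k _; rewrite scalerBr.
  rewrite (sum_supp_in _ aJ) -!mulmx_colE; apply: le_trans (vnorm_sum _ _ _) _.
  apply: (@le_trans _ _ (\sum_(k in J) r * (vnorm (Phi *m a) / c))).
    apply: ler_sum => k _; rewrite vnormZ mulrC; apply: ler_pM => //.
      exact: vnorm_ge0.
    by rewrite ler_pdivlMr // mulrC.
  rewrite sumr_const -[_ *+ #|J|]mulr_natl ler_wpM2r ?ler_nat //.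
  by rewrite !mulr_ge0 ?vnorm_ge0 // invr_ge0 ltW.
have h2 : 2 * vnorm (Phi *m a - Psi *m a) <= vnorm (Phi *m a).
  apply: (@le_trans _ _ (2 * (S.+1%:R * r) * (vnorm (Phi *m a) / c))).
    by rewrite -!mulrA ler_wpM2l.
  apply: le_trans (ler_wpM2r _ rc) _; first by rewrite mulr_ge0 ?vnorm_ge0 // invr_ge0 ltW.
  by rewrite mulrCA divff ?gt_eqF // mulr1.
have := vnorm_sub_ge (Phi *m a) (Phi *m a - Psi *m a); rewrite subKr.
have := cPhi l; lra.
Qed.

Lemma resid_le I : (#|I| <= S)%N -> resid I <= (r * Num.sqrt S%:R) ^+ 2.
Proof.
move=> IS; apply: le_trans (sum_near IS); apply: ler_sum => k kI.
rewrite -[X in _ <= dotv (_ - X) (_ - X)]mulmx_delta; apply: Pproj_min.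
exact: supp_in_delta.
Qed.

End Perturbation.

(** * Lower bound for the mean residual *)

Section ResidualLowerBound.
Variable R : realType.
Variables (d K S : nat) (Phi Psi : 'M[R]_(d, K)).
Implicit Types (p : 'S_K) (I J : {set 'I_K}) (a : 'cV[R]_K).

Hypothesis Phi1 : dictionary Phi.
Hypothesis Psi1 : dictionary Psi.
Variable c : R.
Hypothesis c0 : 0 <= c.
Hypothesis c1 : c <= 1.
Hypothesis low : forall J a l, (#|J| <= S.+1)%N -> supp_in J a ->
  c * `|a l 0| <= vnorm (Psi *m a).
Hypothesis SK : (0 < S < K)%N.

Let S0 : 0 < S%:R :> R. Proof. by rewrite ltr0n; case/andP: SK. Qed.

(* [Pproj Psi J *m z] has small coefficients outside [k] only if it is nearly
   parallel to the atom [k], which is excluded by orthogonality. *)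
Lemma orth_res_low J k (z : 'cV[R]_d) : #|J| = S.+1 -> k \in J ->
    dotv z (col k Psi) = 0 ->
  c ^+ 2 / S%:R * dotv z z <=
    \sum_(l in J :\ k) dotv (z - Pproj Psi (J :\ l) *m z) (z - Pproj Psi (J :\ l) *m z).
Proof.
move=> JS kJ zk; have [a aJ Pa] := Pproj_ran Psi J z.
set q := dotv (z - Pproj Psi J *m z) (z - Pproj Psi J *m z).
have q0 : 0 <= q by exact: dotv_ge0.
have cardJ l : l \in J -> #|J :\ l| = S.
  by move=> lJ; have := cardsD1 l J; rewrite lJ JS add1n => -[].
(* Without atom [l] the coefficient there is zero, so the best approximation differs from [Psi *m a]
   by a combination whose coefficient at [l] is [a l]. *)
have step l : l \in J :\ k -> q + c ^+ 2 * a l 0 ^+ 2 <=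
    dotv (z - Pproj Psi (J :\ l) *m z) (z - Pproj Psi (J :\ l) *m z).
  move=> lJk; have [b bJ Pb] := Pproj_ran Psi (J :\ l) z.
  have supp : supp_in J (a - b).
    by move=> i iJ; rewrite !mxE aJ // bJ ?subrr // !inE negb_and iJ orbT.
  have o : dotv (z - Pproj Psi J *m z) (Psi *m (a - b)) = 0.
    by rewrite -(Pproj_id Psi supp) Pproj_orth.
  have -> : z - Pproj Psi (J :\ l) *m z = z - Pproj Psi J *m z + Psi *m (a - b).
    by rewrite mulmxBr -Pa -Pb addrA subrK.
  rewrite (dotv_orthD o) lerD2l -vnorm_sqr.
  have := @low J (a - b) l; rewrite JS leqnn => /(_ isT supp).
  rewrite !mxE (bJ l) ?subr0 ?inE ?eqxx // => h.
  rewrite -(real_normK (num_real (a l 0))) -exprMn ler_sqr ?nnegrE ?vnorm_ge0 //.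
  by rewrite mulr_ge0.
apply: le_trans (ler_sum _ step); rewrite big_split /= sumr_const cardJ //.
rewrite -mulr_sumr (Pproj_pyth Psi J z) -/q mulrDr addrC lerD //; last first.
  rewrite -[q *+ S]mulr_natl ler_wpM2r // ler_pdivrMr //.
  apply: (@le_trans _ _ 1); first by rewrite exprn_ile1.
  by rewrite -natrM ler1n muln_gt0 andbb; case/andP: SK.
rewrite -mulrA ler_wpM2l ?sqr_ge0 // ler_pdivrMl // Pa.
set u := \sum_(l in J :\ k) a l 0 *: col l Psi.
have Pu : Psi *m a = a k 0 *: col k Psi + u.
  rewrite mulmx_colE (sum_supp_in _ aJ) (bigD1 k) //=; congr (_ + _).
  by apply: eq_bigl => i; rewrite !inE andbC.
have ok : dotv (Psi *m a) (col k Psi) = 0.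
  by rewrite -Pa Pproj_dot Pproj_col.
(* Being orthogonal to atom [k], the projection pairs with itself only through [u]. *)
have vu : vnorm (Psi *m a) <= vnorm u.
  have : vnorm (Psi *m a) ^+ 2 <= vnorm u * vnorm (Psi *m a).
    rewrite vnorm_sqr {2}Pu dotvDr dotvZr ok mulr0 add0r mulrC.
    exact: le_trans (ler_norm _) (dotv_le_vnorm _ _).
  have [->|n0] := eqVneq (vnorm (Psi *m a)) 0; first by rewrite vnorm_ge0.
  by rewrite expr2 ler_pM2r // lt_def n0 vnorm_ge0.
apply: le_trans (ler_vnorm_dotv vu) _.
pose a' : 'cV[R]_K := \col_l (if l \in J :\ k then a l 0 else 0).
have uE : u = \sum_(l in J :\ k) a' l 0 *: col l Psi.
  by apply: eq_bigr => l lJ; rewrite mxE lJ.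
have := @vnorm_mulmx_supp R d K (J :\ k) (fun l => col l Psi) (Num.sqrt S%:R) a' (sqrtr_ge0 _).
rewrite -uE sqr_sqrtr ?ler0n // => /(_ _) h.
have {}h : vnorm u <= Num.sqrt S%:R * vnorm a'.
  apply: h; rewrite (eq_bigr (fun=> 1)) ?sumr_const ?cardJ // => l _.
  by rewrite -vnorm_sqr Psi1 expr1n.
rewrite -vnorm_sqr; apply: (@le_trans _ _ ((Num.sqrt S%:R * vnorm a') ^+ 2)).
  by rewrite ler_sqr // nnegrE ?mulr_ge0 ?vnorm_ge0 ?sqrtr_ge0.
rewrite exprMn sqr_sqrtr ?ler0n // vnorm_sqr ler_wpM2l ?ler0n // /dotv.
rewrite [leRHS]big_mkcond; apply: ler_sum => l _; rewrite !mxE.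
by case: ifP; rewrite ?mulr0 // expr2.
Qed.

Variables (r : R) (k : 'I_K).
Hypothesis far : vnorm (col k Phi - col k Psi) = r.

(** All indices are equally likely to land in the first [n] positions, and each [p] sends exactly
    [n] indices there. *)
Lemma card_perm_lt (i : 'I_K) n : (n <= K)%N ->
  (K * #|[set p : 'S_K | (p i < n)%N]%SET| = n * #|{: 'S_K}|)%N.
Proof.
move=> nK; transitivity (\sum_(j < K) #|[set p : 'S_K | (p j < n)%N]%SET|)%N.
  rewrite (eq_bigr (fun=> #|[set p : 'S_K | (p i < n)%N]%SET|)).
    by rewrite sum_nat_const card_ord.
  move=> j _; rewrite -!sum1_card (reindex_inj (mulgI (tperm i j))) /=.
  by apply: eq_bigl => p; rewrite !inE permM tpermR.
rewrite (eq_bigr (fun j : 'I_K => \sum_(p : 'S_K | p j < n) 1)%N); last first.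
  by move=> j _; rewrite -sum1_card; apply: eq_bigl => p; rewrite inE.
rewrite (exchange_big_dep xpredT) //= (eq_bigr (fun=> n)).
  by rewrite sum_nat_const mulnC.
move=> p _; rewrite -[RHS](card_Ip p nK) -sum1_card.
by apply: eq_bigl => j; rewrite inE.
Qed.

Let SK1 : (S < K)%N. Proof. by case/andP: SK. Qed.

(** Exchanging positions [j] and [S] expels the index at position [j]. For [j = S] the transposition
    is trivial and the index at position [S] is the one removed. *)
Lemma Ip_tperm p (j : 'I_K) : (j <= S)%N ->
  Ip S (p * tperm j (Ordinal SK1))%g = Ip S.+1 p :\ (p^-1)%g j.
Proof.
move=> jS; apply/setP => i; rewrite !inE permM ltnS.
rewrite -(inj_eq (@perm_inj _ p)) permKV.
case: tpermP => [->|pi|].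
- by rewrite eqxx ltnn.
- rewrite pi /= leqnn andbT ltn_neqAle jS andbT.
  by rewrite -(inj_eq val_inj) /= eq_sym.
- move=> /eqP -> /eqP; rewrite -(inj_eq val_inj) /= => piS.
  by rewrite ltn_neqAle piS.
Qed.

(** A random support of size [S] is a random set of size [S + 1] with a random element removed. The
    larger set contains [k] in a fraction [(S + 1) / K] of the orderings, and there [orth_res_low]
    applies; only the residual of atom [k] is kept. *)
Lemma sum_resid_low :
  #|{: 'S_K}|%:R * ((r ^+ 2 - r ^+ 4 / 4) * c ^+ 2) <=
    S%:R * (K%:R * \sum_p resid Phi Psi (Ip S p)).
Proof.
pose f I : R := if k \in I then dotv (col k Phi - Pproj Psi I *m col k Phi)
                                 (col k Phi - Pproj Psi I *m col k Phi) else 0.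
have f0 I : 0 <= f I by rewrite /f; case: ifP => // _; exact: dotv_ge0.
have fres I : f I <= resid Phi Psi I.
  rewrite /f; case: ifP => [kI|_]; last exact: resid_ge0.
  rewrite /resid (bigD1 k) //= lerDl; apply: sumr_ge0 => i _; exact: dotv_ge0.
have shift (j : 'I_K) : (j <= S)%N -> \sum_p f (Ip S p) = \sum_p f (Ip S.+1 p :\ (p^-1)%g j).
  move=> jS; rewrite (reindex_inj (mulIg (tperm j (Ordinal SK1)))) /=.
  by apply: eq_bigr => p _; rewrite Ip_tperm.
have sumf : S.+1%:R * \sum_p f (Ip S p) = \sum_p \sum_(l in Ip S.+1 p) f (Ip S.+1 p :\ l).
  transitivity (\sum_(j < K | (j < S.+1)%N) \sum_p f (Ip S p)).
    rewrite -(big_ord_widen K (fun=> \sum_p f (Ip S p)) SK1) sumr_const card_ord.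
    by rewrite mulr_natl.
  rewrite (eq_bigr _ (fun j => @shift j)) exchange_big /=; apply: eq_bigr => p _.
  rewrite (reindex_inj (@perm_inj _ p)) /=; apply: eq_big => l; rewrite ?inE //.
  by rewrite permK.
pose al := dotv (col k Phi) (col k Psi).
have alE : al = 1 - r ^+ 2 / 2.
  have := vnorm_sqr (col k Phi - col k Psi); rewrite far dotvBl !dotvBr.
  rewrite (dotvC (col k Psi)) -/al -!vnorm_sqr Phi1 Psi1; lra.
(* Subtracting a multiple of atom [k] of [Psi] keeps the residual for supports containing [k]; the
   squared norm of [z] is the squared sine of the angle between the two atoms. *)
pose z := col k Phi - al *: col k Psi.
have zk : dotv z (col k Psi) = 0.
  by rewrite dotvBl dotvZl -vnorm_sqr Psi1 expr1n mulr1 subrr.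
have zz : dotv z z = r ^+ 2 - r ^+ 4 / 4.
  rewrite [in LHS]/z dotvBr dotvZr zk mulr0 subr0 dotvBl -vnorm_sqr Phi1 dotvZl.
  by rewrite (dotvC (col k Psi)) -/al alE; field.
have fz I : k \in I -> f I = dotv (z - Pproj Psi I *m z) (z - Pproj Psi I *m z).
  move=> kI; rewrite /f kI; suff -> : z - Pproj Psi I *m z = col k Phi - Pproj Psi I *m col k Phi by [].
  by rewrite /z mulmxBr -scalemxAr Pproj_col // opprB addrA subrK.
have step p : k \in Ip S.+1 p -> c ^+ 2 / S%:R * dotv z z <= \sum_(l in Ip S.+1 p) f (Ip S.+1 p :\ l).
  move=> kJ; apply: le_trans (orth_res_low (card_Ip p SK1) kJ zk) _.
  rewrite [leRHS](bigID (fun l => l == k)) /= -[leLHS]add0r lerD ?sumr_ge0 //.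
  rewrite le_eqVlt; apply/orP; left; apply/eqP; apply: eq_big => l.
    by rewrite !inE andbC.
  by rewrite !inE => /andP[lk lJ]; rewrite fz // !inE eq_sym lk; rewrite inE in kJ.
have tot : #|[set p : 'S_K | (p k < S.+1)%N]%SET|%:R * (c ^+ 2 / S%:R * dotv z z)
    <= S.+1%:R * \sum_p f (Ip S p).
  rewrite sumf -sumr_const_set [leRHS](bigID (fun p : 'S_K => (p k < S.+1)%N)) /=.
  rewrite -[leLHS]addr0 lerD //; last by apply: sumr_ge0 => p _; apply: sumr_ge0.
  by apply: ler_sum => p pk; apply: step; rewrite inE.
have card := card_perm_lt k SK1.
have le_f : \sum_p f (Ip S p) <= \sum_p resid Phi Psi (Ip S p) by apply: ler_sum => p _.
move: le_f tot; set F := \sum_p f (Ip S p); set G := \sum_p resid Phi Psi (Ip S p) => le_f tot.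
apply: (@le_trans _ _ (S%:R * (K%:R * F))); last first.
  by rewrite ler_wpM2l ?ler_wpM2l // ltW.
have S1 : 0 < S.+1%:R :> R by rewrite ltr0n.
rewrite -(ler_pM2l S1).
have -> : S.+1%:R * (#|{: 'S_K}|%:R * ((r ^+ 2 - r ^+ 4 / 4) * c ^+ 2)) =
   K%:R * S%:R * (#|[set p : 'S_K | (p k < S.+1)%N]%SET|%:R * (c ^+ 2 / S%:R * dotv z z)).
  rewrite mulrA -natrM -card natrM zz; field; rewrite gt_eqF //.
have -> : S.+1%:R * (S%:R * (K%:R * F)) = K%:R * S%:R * (S.+1%:R * F) by ring.
by rewrite ler_wpM2l // mulr_ge0 // ltW.
Qed.

End ResidualLowerBound.

(** * Subgaussian bounds for random signs *)

Section ExponentialBounds.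
Variable R : realType.

(** Only [1 + v <= expR v] is used; the range of [u] makes [1 - 3 u + u^2] nonnegative. *)
Lemma expR_le_quad (u : R) : u <= 3^-1 -> expR u <= 1 + u + u ^+ 2.
Proof.
move=> u3; have [u0|u0] := leP 0 u.
  (* expR (u / 2) <= 1 / (1 - u / 2), squared *)
  have h : expR (u / 2) * (1 - u / 2) <= 1.
    have := expR_ge1Dx (- (u / 2)) => h; rewrite -[leRHS](expRxMexpNx_1 (u / 2)).
    by rewrite ler_wpM2l ?expR_ge0.
  have e0 : 0 <= expR (u / 2) by exact: expR_ge0.
  have h2 : expR u * (1 - u / 2) ^+ 2 <= 1.
    have -> : expR u = expR (u / 2) ^+ 2.
      by rewrite -expRM_natl; congr expR; field.
    rewrite -exprMn -[leRHS](expr1n _ 2) ler_sqr ?nnegrE //.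
    by rewrite mulr_ge0 //; lra.
  have p0 : 0 < (1 - u / 2) ^+ 2 by rewrite exprn_gt0 //; lra.
  rewrite -(ler_pM2r p0); apply: le_trans h2 _.
  have : 0 <= u ^+ 2 * (1 - 3 * u + u ^+ 2) by rewrite mulr_ge0 ?sqr_ge0 //; nra.
  have -> : (1 + u + u ^+ 2) * (1 - u / 2) ^+ 2 = 1 + u ^+ 2 * (1 - 3 * u + u ^+ 2) / 4 by field.
  lra.
have h : expR u * (1 - u) <= 1.
  have := expR_ge1Dx (- u) => h; rewrite -[leRHS](expRxMexpNx_1 u).
  by rewrite ler_wpM2l ?expR_ge0.
have p0 : 0 < 1 - u by lra.
rewrite -(ler_pM2r p0); apply: le_trans h _.
have : 0 <= u ^+ 2 * (- u) by rewrite mulr_ge0 ?sqr_ge0 //; lra.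
have -> : (1 + u + u ^+ 2) * (1 - u) = 1 + u ^+ 2 * (- u) by ring.
lra.
Qed.

(** A crude Gaussian bound for [cosh]: the quadratic estimate near 0, and [|u| <= 3 u^2] away from
    it. *)
Lemma expR_sym_le (u : R) : expR u + expR (- u) <= 2 * expR (3 * u ^+ 2).
Proof.
have [u3|u3] := leP `|u| 3^-1.
  have /andP[l r] : - 3^-1 <= u <= 3^-1 by rewrite -ler_norml.
  have h1 := expR_le_quad r; have h2 : expR (- u) <= 1 + (- u) + (- u) ^+ 2.
    by apply: expR_le_quad; lra.
  have h3 := expR_ge1Dx (3 * u ^+ 2); have := sqr_ge0 u; rewrite sqrrN in h2; lra.
have h : `|u| <= 3 * u ^+ 2.
  have -> : u ^+ 2 = `|u| * `|u| by rewrite -expr2 real_normK ?num_real.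
  rewrite mulrA ler_peMl ?normr_ge0 //; lra.
have /andP[l r] : - `|u| <= u <= `|u| by rewrite -ler_norml.
have : expR u <= expR (3 * u ^+ 2) by rewrite ler_expR; lra.
have : expR (- u) <= expR (3 * u ^+ 2) by rewrite ler_expR; lra.
lra.
Qed.

Variable K : nat.
Let sg := {ffun 'I_K -> bool}.

Lemma sum_sign_expR (w : 'I_K -> R) (v t : R) : \sum_i w i ^+ 2 <= v ->
  \sum_(s : sg) expR (t * \sum_i (-1) ^+ s i * w i) <= #|{: sg}|%:R * expR (3 * t ^+ 2 * v).
Proof.
move=> wv; rewrite (eq_bigr (fun s : sg => \prod_i expR (t * ((-1) ^+ s i * w i)))); last first.
  by move=> s _; rewrite mulr_sumr expR_sum.
rewrite -(bigA_distr_bigA (fun i (b : bool) => expR (t * ((-1) ^+ b * w i)))) /=.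
apply: (@le_trans _ _ (\prod_(i < K) (2 * expR (3 * (t * w i) ^+ 2)))).
  apply: ler_prod => i _; rewrite big_bool /= expr0 expr1 mul1r mulN1r mulrN addr_ge0 ?expR_ge0 //=.
  by rewrite addrC expR_sym_le.
rewrite big_split /= prodr_const card_ord card_ffun card_bool card_ord natrX ler_wpM2l ?exprn_ge0 //.
rewrite -expR_sum ler_expR -mulr_sumr -mulrA ler_wpM2l //.
under eq_bigr do rewrite exprMn.
by rewrite -mulr_sumr ler_wpM2l ?sqr_ge0.
Qed.

Lemma sign_tail (w : 'I_K -> R) (v t : R) : 0 < v -> 0 <= t -> \sum_i w i ^+ 2 <= v ->
  \sum_(s : sg) (t ^+ 2 < (\sum_i (-1) ^+ s i * w i) ^+ 2)%R%:R
    <= #|{: sg}|%:R * (2 * expR (- (t ^+ 2 / (12 * v)))).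
Proof.
(* Minimizes [3 th^2 v - th t], with minimum [- t^2 / (12 v)]. *)
move=> v0 t0 wv; pose th := t / (6 * v).
have th0 : 0 <= th by rewrite divr_ge0 // mulr_ge0 // ltW.
have half (z : R) : (t ^+ 2 < z ^+ 2)%R%:R <=
    expR (- (th * t)) * (expR (th * z) + expR (- th * z)).
  have e0 := expR_ge0 (- (th * t)); have e1 := expR_ge0 (th * z); have e2 := expR_ge0 (- th * z).
  case: ltrP => [tz|_]; last by rewrite mulr_ge0 // addr_ge0.
  have tz' : t <= `|z| by rewrite -ler_sqr ?nnegrE ?normr_ge0 // real_normK ?num_real // ltW.
  rewrite mulrDr -!expRD /=; have [z0|z0] := leP 0 z.
    rewrite -[leLHS]addr0 lerD ?expR_ge0 // -expR0 ler_expR.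
    by rewrite addrC subr_ge0 ler_wpM2l // -[z]ger0_norm.
  rewrite -[leLHS]add0r lerD ?expR_ge0 // -expR0 ler_expR.
  by rewrite addrC mulNr -mulrN subr_ge0 ler_wpM2l // -ltr0_norm.
apply: le_trans (ler_sum _ (fun s _ => half _)) _.
rewrite -mulr_sumr big_split /=.
have h1 := @sum_sign_expR w v th wv; have h2 := @sum_sign_expR w v (- th) wv.
rewrite sqrrN in h2.
apply: (@le_trans _ _ (expR (- (th * t)) * (2 * (#|{: sg}|%:R * expR (3 * th ^+ 2 * v))))).
  by rewrite ler_wpM2l ?expR_ge0 // mulr2n mulrDl mul1r lerD.
have -> : - (t ^+ 2 / (12 * v)) = - (th * t) + 3 * th ^+ 2 * v.
  by rewrite /th; field; rewrite gt_eqF.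
rewrite expRD le_eqVlt; apply/orP; left; apply/eqP; ring.
Qed.

(* A union bound over coordinates, the threshold in each coordinate being
   proportional to its variance. *)
Lemma sign_tail_vec n (M : 'M[R]_(n, K)) (c : 'I_K -> R) (V t : R) : 0 < V -> 0 <= t ->
    \sum_i c i ^+ 2 * vnorm (col i M) ^+ 2 <= V ->
  \sum_(s : sg) (t < vnorm (M *m \col_i ((-1) ^+ s i * c i)))%R%:R
    <= #|{: sg}|%:R * (2 * n%:R * expR (- (t ^+ 2 / (12 * V)))).
Proof.
move=> V0 t0 MV; pose Vk k := \sum_i (c i * M k i) ^+ 2.
have Vk0 k : 0 <= Vk k by apply: sumr_ge0 => i _; exact: sqr_ge0.
have sumV : \sum_k Vk k <= V.
  apply: le_trans MV; rewrite exchange_big /= le_eqVlt; apply/orP; left; apply/eqP.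
  apply: eq_bigr => i _; rewrite vnorm_sqr mulr_sumr; apply: eq_bigr => k _.
  by rewrite !mxE exprMn expr2.
pose tk k := t * Num.sqrt (Vk k / V).
have tk2 k : tk k ^+ 2 = t ^+ 2 * (Vk k / V).
  by rewrite exprMn sqr_sqrtr // divr_ge0 // ltW.
pose w (s : sg) (k : 'I_n) := \sum_i (-1) ^+ s i * (c i * M k i).
have wE (s : sg) k : (M *m \col_i ((-1) ^+ s i * c i)) k 0 = w s k.
  by rewrite mxE; apply: eq_bigr => i _; rewrite !mxE; ring.
have union (s : sg) : (t < vnorm (M *m \col_i ((-1) ^+ s i * c i)))%R%:R
    <= \sum_k (tk k ^+ 2 < w s k ^+ 2)%R%:R :> R.
  case: ltrP => [tn|_]; last by apply: sumr_ge0.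
  have [k kP|none] := pickP (fun k => tk k ^+ 2 < w s k ^+ 2).
    by rewrite (bigD1 k) //= kP lerDl; apply: sumr_ge0.
  have : t ^+ 2 < vnorm (M *m \col_i ((-1) ^+ s i * c i)) ^+ 2.
    by rewrite ltr_sqr ?nnegrE ?vnorm_ge0.
  rewrite ltNge => /negP[]; rewrite vnorm_sqr /dotv.
  apply: (@le_trans _ _ (\sum_k tk k ^+ 2)).
    by apply: ler_sum => k _; rewrite wE -expr2 leNgt none.
  under eq_bigr do rewrite tk2.
  by rewrite -mulr_sumr -mulr_suml ler_piMr ?sqr_ge0 // ler_pdivrMr // mul1r.
apply: le_trans (ler_sum _ (fun s _ => union s)) _; rewrite exchange_big /=.
set b := #|{: sg}|%:R * (2 * expR (- (t ^+ 2 / (12 * V)))).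
have -> : #|{: sg}|%:R * (2 * n%:R * expR (- (t ^+ 2 / (12 * V)))) = \sum_(k < n) b.
  by rewrite sumr_const card_ord -[b *+ n]mulr_natl /b; ring.
(* [sign_tail] needs a positive variance. A coordinate of variance 0 vanishes identically, and its
   strict event is empty. *)
apply: ler_sum => k _; have [Vk_0|Vk_p] := eqVneq (Vk k) 0.
  rewrite big1 ?mulr_ge0 ?expR_ge0 // => s _; suff -> : w s k = 0.
    by rewrite expr0n /= ltNge sqr_ge0.
  rewrite /w big1 // => i _; suff -> : c i * M k i = 0 by rewrite mulr0.
  have := Vk_0 => /eqP; rewrite psumr_eq0; last by move=> j _; exact: sqr_ge0.
  by move=> /allP/(_ i); rewrite mem_index_enum sqrf_eq0 => /(_ isT)/eqP.
have Vkp : 0 < Vk k by rewrite lt_def Vk_p Vk0.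
have tk0 : 0 <= tk k by rewrite mulr_ge0 ?sqrtr_ge0.
apply: le_trans (sign_tail Vkp tk0 (lexx _)) _.
by rewrite tk2 /b; apply/ler_wpM2l/ler_wpM2l => //; rewrite ler_expR lerN2 le_eqVlt;
   apply/orP; left; apply/eqP; field; rewrite !gt_eqF.
Qed.

(** Such a set is listed in [S] slots, with [None] as padding. *)
Lemma card_small_sets S : (#|[set I : {set 'I_K} | (#|I| <= S)%N]%SET| <= K.+1 ^ S)%N.
Proof.
have -> : (K.+1 ^ S = #|{: {ffun 'I_S -> option 'I_K}}|)%N.
  by rewrite card_ffun card_option !card_ord.
pose im (f : {ffun 'I_S -> option 'I_K}) : {set 'I_K} := [set k | Some k \in codom f]%SET.
apply: leq_trans (leq_imset_card im _); apply: subset_leq_card; apply/fintype.subsetP => I.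
rewrite inE => IS; apply/imsetP; exists [ffun i : 'I_S => nth None (map Some (enum I)) i] => //.
apply/setP => k; rewrite inE; apply/idP/codomP => [kI|[i]].
  have ki : (index k (enum I) < #|I|)%N by rewrite cardE index_mem mem_enum.
  exists (Ordinal (leq_trans ki IS)); rewrite ffunE /= (nth_map k) -?cardE //.
  by rewrite nth_index // mem_enum.
rewrite ffunE; have [ii|ii] := ltnP i (size (enum I)); last by rewrite nth_default // size_map.
by rewrite (nth_map k) // => -[->]; rewrite -mem_enum mem_nth.
Qed.

End ExponentialBounds.

(** * Exponential moment of the gain of one sample over its orbit *)

Section PointwiseExponentialMoment.
Variable R : realType.
Variables (d K S : nat).
Implicit Types (Phi Psi : 'M[R]_(d, K)) (I : {set 'I_K}) (y : 'cV[R]_d).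

Definition score Psi y : R :=
  \big[Num.max/0]_(I : {set 'I_K} | (#|I| <= S)%N) vnorm (Pproj Psi I *m y) ^+ 2.

Lemma score_ge Psi y I : (#|I| <= S)%N -> vnorm (Pproj Psi I *m y) ^+ 2 <= score Psi y.
Proof. by move=> IS; rewrite /score; apply: le_bigmax_cond. Qed.

Lemma score_ge0 Psi y : 0 <= score Psi y.
Proof. by rewrite /score bigmax_ge_id. Qed.

Lemma score_leP Psi y (b : R) : 0 <= b ->
    (forall I, (#|I| <= S)%N -> vnorm (Pproj Psi I *m y) ^+ 2 <= b) ->
  score Psi y <= b.
Proof. by move=> b0 h; apply/bigmax_leP; split. Qed.

Lemma score_le Psi y : score Psi y <= vnorm y ^+ 2.
Proof.
apply: score_leP; first exact: sqr_ge0.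
by move=> I _; rewrite ler_sqr ?nnegrE ?vnorm_ge0 // vnorm_Pproj.
Qed.

(** The difference of energies is the quadratic form of the difference of the projections at [y]. *)
Lemma energy_dist Phi Psi I y (b : R) :
    vnorm (Pproj Phi I *m y - Pproj Psi I *m y) <= b * vnorm y ->
  `|vnorm (Pproj Psi I *m y) ^+ 2 - vnorm (Pproj Phi I *m y) ^+ 2| <= b * vnorm y ^+ 2.
Proof.
move=> h; rewrite !Pproj_vnorm2 -dotvBr.
apply: le_trans (dotv_le_vnorm _ _) _; rewrite vnormBC expr2 mulrA mulrC.
by rewrite ler_wpM2r ?vnorm_ge0.
Qed.

Variables (Phi Psi : 'M[R]_(d, K)) (A : R) (kappa rho lambda theta : R) (x : 'cV[R]_K).
Hypothesis tight : unit_norm_tight_frame Phi A.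
Hypothesis A0 : 0 <= A.
Hypothesis SK : (0 < S < K)%N.
Hypothesis kappa0 : 0 < kappa.
Hypothesis x1 : vnorm x = 1.
Hypothesis gapx : gap_separated S Phi kappa x.
Hypothesis rho0 : 0 < rho.
Hypothesis close : forall I y, (#|I| <= S)%N ->
  vnorm (Pproj Phi I *m y - Pproj Psi I *m y) <= rho * vnorm y.
Hypothesis resid_kappa : forall I, (#|I| <= S)%N -> resid Phi Psi I <= kappa ^+ 2.

Let sg := {ffun 'I_K -> bool}.
Let m : R := #|{: sg}|%:R.
Let Y (p : 'S_K) (s : sg) := Phi *m c_ps p s x.
Let bad y := [exists I : {set 'I_K}, (#|I| <= S)%N &&
  (kappa < vnorm (Pproj Phi I *m y - Pproj Psi I *m y))].
(** Union bound, over at most [(K + 1)^S] supports, for the fraction of sign patterns that move some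
    projection by more than [kappa]; [rho^2] is the variance parameter. *)
Definition bad_rate : R := K.+1%:R ^+ S * (2 * d%:R * expR (- (kappa ^+ 2 / (12 * rho ^+ 2)))).
Let D p y := vnorm (Pproj Psi (Ip S p) *m y) ^+ 2 - vnorm (Pproj Phi (Ip S p) *m y) ^+ 2.

Let cardIp (p : 'S_K) : #|Ip S p| = S.
Proof. by apply: card_Ip; case/andP: SK => _ /ltnW. Qed.

Let sum_c (p : 'S_K) : \sum_i rearr x (p i) ^+ 2 = 1.
Proof.
transitivity (\sum_(i < K) rearr x i ^+ 2).
  by rewrite [RHS](reindex_inj (@perm_inj _ p)).
by rewrite sum_rearr_sqr -vnorm_sqr x1 expr1n.
Qed.

Let vnorm_Y p s : vnorm (Y p s) ^+ 2 <= A.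
Proof.
apply: le_trans (tight_vnorm_le tight _) _; rewrite ler_piMr // vnorm_sqr /dotv.
under eq_bigr do rewrite !mxE -expr2 exprMn -exprM mulnC exprM sqrrN expr1n expr1n mul1r.
by rewrite sum_c.
Qed.

Let sum_vnorm_Y p : \sum_(s : sg) vnorm (Y p s) ^+ 2 = m.
Proof.
rewrite (sum_sign_vnorm Phi (fun i => rearr x (p i))) -[RHS]mulr1; congr (_ * _).
by rewrite -(sum_c p); apply: eq_bigr => i _; rewrite (tight.1 i) expr1n mulr1.
Qed.

Let score_Phi p s : score Phi (Y p s) = vnorm (Pproj Phi (Ip S p) *m Y p s) ^+ 2.
Proof.
apply/eqP; rewrite eq_le score_ge ?cardIp // andbT; apply: score_leP; first exact: sqr_ge0.
move=> I IS; have [->//|IpI] := eqVneq I (Ip S p).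
rewrite ler_sqr ?nnegrE ?vnorm_ge0 //.
have := gap_le gapx s IS IpI; apply: le_trans; rewrite lerDl mulr_ge0 // ltW //.
Qed.

(** Two projections that move by at most [kappa] each cannot close a gap of [2 * kappa], so [Ip S p]
    remains a maximizer for [Psi]. *)
Let score_diff_good p s : ~~ bad (Y p s) ->
  score Psi (Y p s) - score Phi (Y p s) = D p (Y p s).
Proof.
move=> /existsPn good; rewrite score_Phi; congr (_ - _).
have {}good I : (#|I| <= S)%N -> vnorm (Pproj Phi I *m Y p s - Pproj Psi I *m Y p s) <= kappa.
  by move=> IS; have := good I; rewrite IS /= -leNgt.
apply/eqP; rewrite eq_le score_ge ?cardIp // andbT; apply: score_leP; first exact: sqr_ge0.
move=> I IS; have [->//|IpI] := eqVneq I (Ip S p).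
rewrite ler_sqr ?nnegrE ?vnorm_ge0 //.
have h1 := gap_le gapx s IS IpI; have h2 := good _ IS.
have h3 : vnorm (Pproj Phi (Ip S p) *m Y p s - Pproj Psi (Ip S p) *m Y p s) <= kappa.
  by apply: good; rewrite cardIp.
have h4 := vnorm_sub_ge (Pproj Phi (Ip S p) *m Y p s) (Pproj Psi (Ip S p) *m Y p s).
have h5 := vnorm_sub_ge (Pproj Psi I *m Y p s) (Pproj Phi I *m Y p s).
rewrite vnormBC in h5; move: h1 h2 h3 h4 h5; rewrite -/(Y p s).
move: (vnorm _) (vnorm _) (vnorm _) (vnorm _) (vnorm _) (vnorm _) => a b e f g h.
lra.
Qed.

Let score_bound Ps p s : 0 <= score Ps (Y p s) <= A.
Proof. by rewrite score_ge0 (le_trans (score_le _ _) (vnorm_Y p s)). Qed.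

(** Bad patterns are paid for with the trivial bound [A] on every score. *)
Let score_diff_le p s :
  score Psi (Y p s) - score Phi (Y p s) <= D p (Y p s) + 2 * A * (bad (Y p s))%:R.
Proof.
case: (boolP (bad (Y p s))) => [_|good]; last by rewrite score_diff_good // mulr0 addr0.
have /andP[l1 u1] := score_bound Psi p s; have /andP[l2 u2] := score_bound Phi p s.
rewrite mulr1 /D.
have := sqr_ge0 (vnorm (Pproj Psi (Ip S p) *m Y p s)).
have : vnorm (Pproj Phi (Ip S p) *m Y p s) ^+ 2 <= A.
  by rewrite -score_Phi.
lra.
Qed.

(** One factor of [|Y|^2] is bounded by [A]; the other is kept, because its average over signs is
    1. *)
Let D_sqr p s : D p (Y p s) ^+ 2 <=
  resid Phi Psi (Ip S p) / kappa ^+ 2 * A * vnorm (Y p s) ^+ 2.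
Proof.
set rs := resid _ _ _; have rs0 : 0 <= rs by exact: resid_ge0.
have k2 : 0 < kappa ^+ 2 by rewrite exprn_gt0.
have : `|D p (Y p s)| <= 2 * Num.sqrt rs / (2 * kappa) * vnorm (Y p s) ^+ 2.
  apply: energy_dist; apply: Pproj_dist_res; rewrite ?sqrtr_ge0 ?mulr_gt0 //.
  - rewrite ler_wpM2l // -(ger0_norm (ltW kappa0)) -sqrtr_sqr ler_sqrt ?sqr_ge0 //.
    by apply: resid_kappa; rewrite cardIp.
  - by move=> a aI; apply: (frame_low tight SK kappa0 x1 gapx A0 _ aI); rewrite cardIp.
  - by rewrite sqr_sqrtr.
rewrite -ler_sqr ?nnegrE ?normr_ge0 ?mulr_ge0 ?invr_ge0 ?sqrtr_ge0 ?sqr_ge0 ?(mulr_ge0 _ (ltW kappa0)) //.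
rewrite real_normK ?num_real //.
have -> : (2 * Num.sqrt rs / (2 * kappa) * vnorm (Y p s) ^+ 2) ^+ 2 =
   rs / kappa ^+ 2 * vnorm (Y p s) ^+ 2 * vnorm (Y p s) ^+ 2.
  by rewrite -{2}(sqr_sqrtr rs0); field; rewrite gt_eqF.
move/le_trans; apply; rewrite ler_wpM2r ?sqr_ge0 // ler_wpM2l ?vnorm_Y //.
by rewrite divr_ge0 // ltW.
Qed.

Let score_diff_sqr p s :
  (score Psi (Y p s) - score Phi (Y p s)) ^+ 2 <=
    resid Phi Psi (Ip S p) / kappa ^+ 2 * A * vnorm (Y p s) ^+ 2 + A ^+ 2 * (bad (Y p s))%:R.
Proof.
have r0 : 0 <= resid Phi Psi (Ip S p) / kappa ^+ 2 * A * vnorm (Y p s) ^+ 2.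
  by rewrite !mulr_ge0 ?resid_ge0 ?invr_ge0 ?sqr_ge0 ?vnorm_ge0.
case: (boolP (bad (Y p s))) => [_|good]; last first.
  by rewrite score_diff_good // mulr0 addr0 D_sqr.
have /andP[l1 u1] := score_bound Psi p s; have /andP[l2 u2] := score_bound Phi p s.
rewrite mulr1 -[leLHS]add0r lerD // -subr_ge0 subr_sqr mulr_ge0 //; lra.
Qed.

Let sum_bad p : \sum_(s : sg) (bad (Y p s))%:R <= m * bad_rate.
Proof.
apply: (@le_trans _ _ (\sum_(s : sg) \sum_(I : {set 'I_K} | (#|I| <= S)%N)
    (kappa < vnorm ((Pproj Phi I - Pproj Psi I) *m Phi *m c_ps p s x))%R%:R)).
  apply: ler_sum => s _; case: (boolP (bad _)) => [/existsP[I /andP[IS kI]]|_]; last first.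
    by apply: sumr_ge0.
  rewrite (bigD1 I) //= -mulmxA mulmxBl kI lerDl; exact: sumr_ge0.
rewrite exchange_big /=.
apply: (@le_trans _ _ (\sum_(I : {set 'I_K} | (#|I| <= S)%N)
    m * (2 * d%:R * expR (- (kappa ^+ 2 / (12 * rho ^+ 2)))))).
  apply: ler_sum => I IS; apply: sign_tail_vec; rewrite ?exprn_gt0 ?(ltW kappa0) //.
  apply: (@le_trans _ _ (\sum_i rearr x (p i) ^+ 2 * rho ^+ 2)).
    apply: ler_sum => i _; rewrite ler_wpM2l ?sqr_ge0 // ler_sqr ?nnegrE ?vnorm_ge0 ?(ltW rho0) //.
    have := close (col i Phi) IS; rewrite (tight.1 i) mulr1; apply: le_trans.
    by rewrite colE -mulmxA -colE mulmxBl.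
  by rewrite -mulr_suml sum_c mul1r.
rewrite sumr_const_set mulrCA ler_wpM2l ?ler0n // ler_wpM2r ?mulr_ge0 ?expR_ge0 //.
by rewrite -natrX ler_nat card_small_sets.
Qed.

Let mK : R := #|{: 'S_K}|%:R.
Let G : R := \sum_p resid Phi Psi (Ip S p).

Let sum_D : \sum_p \sum_(s : sg) D p (Y p s) <= - (m * (topS_gap S x * G)).
Proof.
have E (F : 'S_K -> R) : \sum_p F p = \sum_I \sum_(p | Ip S p == I) F p.
  by rewrite (partition_big (Ip S) xpredT).
rewrite E /G E !mulr_sumr -sumrN; apply: ler_sum => I _.
have [IS|IS] := eqVneq #|I| S; last first.
  rewrite !big_pred0 ?mulr0 ?oppr0 // => p; apply/eqP => pI; case/eqP: IS;
  by rewrite -pI cardIp.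
have := sum_energy_diff SK x1 IS (le_trans (frame_trace tight A0 Psi IS)
   (frame_trace_Phi tight kappa0 gapx A0 IS)).
rewrite (eq_bigr (fun p => \sum_(s : sg) D p (Y p s))); last first.
  by move=> p /eqP <-.
move/le_trans; apply; rewrite [X in - (m * (_ * X))](eq_bigr (fun=> resid Phi Psi I)); last first.
  by move=> p /eqP ->.
rewrite sumr_const_set.
have -> : \sum_(i in I) (atom_energy Phi Psi I i - atom_energy Phi Phi I i) = - resid Phi Psi I.
  rewrite /resid -sumrN; apply: eq_bigr => i iI.
  by rewrite (atom_energy_res tight) (atom_energy_in tight) // addrAC subrr add0r.
rewrite -/m le_eqVlt; apply/orP; left; apply/eqP; ring.
Qed.

Hypothesis theta0 : 0 <= theta.
Hypothesis thetaA : theta * A <= 3^-1.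
Hypothesis theta_var : theta * A / kappa ^+ 2 <= lambda / 4.
Hypothesis bad_small : A * (2 + theta * A) * bad_rate * mK <= lambda / 4 * G.

(** In the second order expansion the mean gain has coefficient [- topS_gap]; the second moment and
    the bad patterns cost [lambda / 4] each. *)
Lemma sum_expR_score :
  \sum_p \sum_(s : sg) expR (theta * (score Psi (Y p s) - score Phi (Y p s)))
    <= m * (mK - theta * (topS_gap S x - lambda / 2) * G).
Proof.
have G0 : 0 <= G by apply: sumr_ge0 => p _; exact: resid_ge0.
have m0 : 0 <= m by exact: ler0n.
have step p s : expR (theta * (score Psi (Y p s) - score Phi (Y p s))) <=
   1 + theta * D p (Y p s) + theta * (A * (2 + theta * A)) * (bad (Y p s))%:R
   + theta ^+ 2 * A / kappa ^+ 2 * resid Phi Psi (Ip S p) * vnorm (Y p s) ^+ 2.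
  apply: le_trans (expR_le_quad _) _.
    apply: le_trans thetaA; rewrite ler_wpM2l //.
    have /andP[l1 u1] := score_bound Psi p s; have /andP[l2 u2] := score_bound Phi p s; lra.
  have h1 := ler_wpM2l theta0 (score_diff_le p s).
  have h2 := ler_wpM2l (sqr_ge0 theta) (score_diff_sqr p s).
  rewrite exprMn.
  have -> : theta ^+ 2 * A / kappa ^+ 2 * resid Phi Psi (Ip S p) * vnorm (Y p s) ^+ 2 =
    theta ^+ 2 * (resid Phi Psi (Ip S p) / kappa ^+ 2 * A * vnorm (Y p s) ^+ 2).
    by ring.
  move: h1 h2; move: (resid _ _ _ / _ * _ * _) (_%:R) (score _ _ - _) (D _ _) => a b g e.
  lra.
apply: le_trans (ler_sum _ (fun p _ => ler_sum _ (fun s _ => step p s))) _.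
have [SD SDE] : exists SD : 'S_K -> R, forall p, \sum_(s : sg) D p (Y p s) = SD p.
  by exists (fun p => \sum_(s : sg) D p (Y p s)).
have inner p : \sum_(s : sg) (1 + theta * D p (Y p s) + theta * (A * (2 + theta * A)) * (bad (Y p s))%:R
   + theta ^+ 2 * A / kappa ^+ 2 * resid Phi Psi (Ip S p) * vnorm (Y p s) ^+ 2)
   <= m + theta * SD p + theta * (A * (2 + theta * A)) * (m * bad_rate)
     + theta ^+ 2 * A / kappa ^+ 2 * m * resid Phi Psi (Ip S p).
  rewrite !big_split /= -!mulr_sumr sum_vnorm_Y sumr_const SDE.
  apply: lerD; last by rewrite mulrAC.
  apply: lerD; first exact: lexx.
  by rewrite ler_wpM2l ?sum_bad // !(mulr_ge0, addr_ge0).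
apply: le_trans (ler_sum _ (fun p _ => inner p)) _.
rewrite !big_split /= !sumr_const -!mulr_sumr -/G.
rewrite -[m *+ _]mulr_natl -[(_ * (m * bad_rate)) *+ _]mulr_natl -/mK.
have h1 := ler_wpM2l theta0 sum_D; rewrite (eq_bigr _ (fun p _ => SDE p)) in h1.
have h2 : theta * m * (A * (2 + theta * A) * bad_rate * mK) <= theta * m * (lambda / 4 * G).
  by rewrite ler_wpM2l // mulr_ge0.
have h3 : theta * m * G * (theta * A / kappa ^+ 2) <= theta * m * G * (lambda / 4).
  by rewrite ler_wpM2l // !mulr_ge0.
have e2 : theta ^+ 2 * A / kappa ^+ 2 * m * G = theta * m * G * (theta * A / kappa ^+ 2) by ring.
rewrite e2; move: h1 h2 h3; move: (\sum_p SD p) (theta * A / kappa ^+ 2) => a b.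
lra.
Qed.

End PointwiseExponentialMoment.

(** * Expectations under a symmetric law *)

Section SymmetricExpectation.
Variable R : realType.
Variable K : nat.
Notation vec := (vecM R K).
Implicit Types (p : 'S_K) (h : vec -> R).

Lemma measurable_coord (i : 'I_K) :
  measurable_fun [set: vec] (fun x : vec => (x : 'cV[R]_K) i 0).
Proof.
move=> _ B mB; rewrite setTI; apply: sub_sigma_algebra; exists i, B.
by split.
Qed.

Lemma measurable_vecM d0 (T : measurableType d0) (f : T -> vec) :
    (forall i, measurable_fun [set: T] (fun t => (f t : 'cV[R]_K) i 0)) ->
  measurable_fun [set: T] f.
Proof.
move=> mf; apply: (@measurability _ _ T (vec : measurableType _) _ _ (@coord_sets R K)) => //.
move=> _ [_ [i [B [mB ->]]] <-]; rewrite setTI.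
by have := mf i measurableT _ mB; rewrite setTI.
Qed.

Lemma measurable_sum_cond d0 (T : measurableType d0) (I : finType) (P : pred I)
    (f : I -> T -> R) : (forall i, P i -> measurable_fun setT (f i)) ->
  measurable_fun setT (fun t => \sum_(i | P i) f i t).
Proof.
move=> mf; have -> : (fun t => \sum_(i | P i) f i t) = (fun t => \sum_i (if P i then f i t else 0)).
  by apply/funext => t; rewrite [LHS]big_mkcond.
apply: measurable_sum => i; case: (P i) (mf i) => [/(_ isT)//|_].
exact: measurable_cst.
Qed.

Lemma measurable_bigmax d0 (T : measurableType d0) (I : finType) (P : pred I)
    (f : I -> T -> R) : (forall i, P i -> measurable_fun setT (f i)) ->
  measurable_fun setT (fun t => \big[Num.max/0]_(i | P i) f i t).
Proof.
move=> mf; rewrite /index_enum; move: (Finite.enum _) => l; elim: l => [|i l IH].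
  under eq_fun do rewrite big_nil; exact: measurable_cst.
under eq_fun do rewrite big_cons.
case: (P i) (mf i) => [/(_ isT) mfi|_]; last exact: IH.
exact: measurable_maxr mfi IH.
Qed.

Lemma measurable_quadratic d (M : 'M[R]_(d, K)) :
  measurable_fun setT (fun x : vec => vnorm (M *m (x : 'cV[R]_K)) ^+ 2).
Proof.
under eq_fun do rewrite vnorm_sqr /dotv.
apply: measurable_sum => k; apply: measurable_funM;
  under eq_fun do rewrite mxE; apply: measurable_sum => i;
  by apply: measurable_funM; [exact: measurable_cst|exact: measurable_coord].
Qed.

Lemma measurable_score d S (Phi Psi : 'M[R]_(d, K)) :
  measurable_fun setT (fun x : vec => score S Psi (Phi *m (x : 'cV[R]_K))).
Proof.
apply: measurable_bigmax => I _; under eq_fun do rewrite mulmxA.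
exact: measurable_quadratic.
Qed.

(** Replaces sorting by a finite maximum of polynomials in the coordinates, which makes
    measurability evident. *)
Lemma topS_sq_max S (x : 'cV[R]_K) : (S <= K)%N ->
  topS_sq S x = \big[Num.max/0]_(I : {set 'I_K} | #|I| == S) \sum_(i in I) x i 0 ^+ 2.
Proof.
move=> SK; have [p xp] := rearr_perm x; apply/eqP; rewrite eq_le; apply/andP; split.
  have -> : topS_sq S x = \sum_(i in Ip S p) x i 0 ^+ 2.
    rewrite /topS_sq (reindex_inj (@perm_inj _ p)) /=; apply: eq_big => i.
      by rewrite inE.
    by rewrite -xp real_normK ?num_real.
  by apply: le_bigmax_cond; rewrite card_Ip.
apply/bigmax_leP; split; first exact: topS_sq_ge0.
move=> I /eqP IS.
have -> : \sum_(i in I) x i 0 ^+ 2 = \sum_(j in [set p i | i in I]%SET) rearr x j ^+ 2.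
  rewrite big_imset /=; last by move=> i j _ _; exact: perm_inj.
  by apply: eq_bigr => i _; rewrite -xp real_normK ?num_real.
set J := [set p i | i in I]%SET; have JS : #|J| = S by rewrite card_imset //; exact: perm_inj.
pose L := [set j : 'I_K | (j < S)%N]%SET.
have LS : #|L| = S.
  by rewrite -[RHS](card_Ip 1%g SK); apply: eq_card => j; rewrite !inE perm1.
have -> : topS_sq S x = \sum_(j in L) rearr x j ^+ 2.
  by apply: eq_bigl => j; rewrite inE.
rewrite (big_setID L) [leRHS](big_setID J) /= finset.setIC lerD2l.
(* A threshold: values at ranks in [J] outside [L] lie below it, those at ranks in [L] outside [J]
   above it, and the two differences have equal size. *)
pose b := rearr x S ^+ 2.
have mono a c : (a <= c)%N -> rearr x c ^+ 2 <= rearr x a ^+ 2.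
  by move=> ac; rewrite ler_sqr ?nnegrE ?rearr_ge0 // rearr_mono.
have cJL : #|J :\: L| = #|L :\: J|.
  apply/eqP; rewrite -(eqn_add2l #|J :&: L|) cardsID JS finset.setIC cardsID LS //.
apply: (@le_trans _ _ (\sum_(j in J :\: L) b)).
  by apply: ler_sum => j; rewrite !inE -leqNgt => /andP[Sj _]; exact: mono.
rewrite sumr_const cJL -sumr_const; apply: ler_sum => j.
by rewrite !inE => /andP[_ jS]; apply/mono/ltnW.
Qed.

Lemma measurable_topS_sq S : (S <= K)%N ->
  measurable_fun setT (fun x : vec => topS_sq S (x : 'cV[R]_K)).
Proof.
move=> SK; under eq_fun do rewrite topS_sq_max //.
apply: measurable_bigmax => I _; apply: measurable_sum_cond => i _.
by apply: measurable_funX; exact: measurable_coord.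
Qed.

Variable nu : probability vec R.
Hypothesis sym : symmetric_measure nu.

Let sg := {ffun 'I_K -> bool}.

(** The group action that preserves the law; it acts on [x] itself, whereas [c_ps] acts on the
    sorted absolute values. *)
Definition signed_perm p (s : sg) (x : vec) : vec := (\col_i ((-1) ^+ s i * (x : 'cV[R]_K) (p i) 0) : 'cV[R]_K).

Lemma measurable_signed_perm p s : measurable_fun setT (signed_perm p s).
Proof.
apply: measurable_vecM => i; under eq_fun do rewrite mxE.
by apply: measurable_funM; [exact: measurable_cst|exact: measurable_coord].
Qed.

HB.instance Definition _ p s :=
  isMeasurableFun.Build _ _ _ _ (signed_perm p s) (measurable_signed_perm p s).

Lemma signed_perm_inv p s (B : set vec) : measurable B ->
  nu (signed_perm p s @^-1` B) = nu B.
Proof.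
move=> mB; pose sB := (fun x : vec => (\col_i ((-1) ^+ s i * (x : 'cV[R]_K) i 0) : vec)) @^-1` B.
have msB : measurable sB.
  have m1 : measurable_fun [set: vec] (fun x : vec => (\col_i ((-1) ^+ s i * (x : 'cV[R]_K) i 0) : vec)).
    apply: measurable_vecM => i; under eq_fun do rewrite mxE.
    by apply: measurable_funM; [exact: measurable_cst|exact: measurable_coord].
  by have := m1 measurableT _ mB; rewrite setTI.
rewrite -[RHS](sym.1 s B mB) -[RHS](sym.2 p _ msB); congr (nu _).
apply/seteqP; split=> x; rewrite /signed_perm /sB /=.
  by congr B; apply/colP => i; rewrite !mxE.
by congr B; apply/colP => i; rewrite !mxE.
Qed.

Lemma integral_signed_perm p s (f : vec -> \bar R) : measurable_fun setT f ->
  (forall x, 0 <= f x)%E -> (\int[nu]_x f (signed_perm p s x) = \int[nu]_x f x)%E.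
Proof.
move=> mf f0; rewrite -[LHS]/(\int[nu]_(x in signed_perm p s @^-1` setT) (f \o signed_perm p s) x)%E.
rewrite -(ge0_integral_pushforward (measurable_signed_perm p s)) //.
apply: eq_measure_integral => B mB _.
by rewrite -[RHS](signed_perm_inv p s mB).
Qed.

(** [x] is one of its own signed rearrangements, so both sums run over the same orbit up to a shift
    of [p] and of [s]. *)
Lemma sum_signed_perm h (x : 'cV[R]_K) :
  \sum_p \sum_(s : sg) h (signed_perm p s x) = \sum_p \sum_(s : sg) h (c_ps p s x).
Proof.
have [p0 [s0 xE]] := c_ps_self x.
rewrite [RHS](reindex_inj (mulIg p0)) /=; apply: eq_bigr => p _.
pose t (s : sg) : sg := [ffun i => s i (+) s0 (p i)].
have tK : involutive t by move=> s; apply/ffunP => i; rewrite !ffunE addbK.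
rewrite [RHS](reindex_inj (inv_inj tK)); apply: eq_bigr => s _; congr h.
rewrite /signed_perm [in LHS]xE; apply/colP => i; rewrite !mxE permM ffunE mulrA.
by rewrite -signr_addb.
Qed.

(** [gammaS2] is defined through [fine]; the bound by 1 on the sphere rules out an infinite
    integral. *)
Lemma integral_topS_sq S : (S <= K)%N ->
    {ae nu, forall x : vec, vnorm (x : 'cV[R]_K) = 1} ->
  (\int[nu]_x (topS_sq S x)%:E = (gammaS2 S nu)%:E)%E /\ gammaS2 S nu <= 1.
Proof.
move=> SK norm1.
have mtop : measurable_fun setT (fun x : vec => (topS_sq S x)%:E).
  by apply/measurable_EFinP; exact: measurable_topS_sq.
have top_le1 : (\int[nu]_x (topS_sq S x)%:E <= 1)%E.
  apply: (@le_trans _ _ (\int[nu]_x (cst 1%:E x))%E); last first.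
    by rewrite integral_cst // mul1e; exact: probability_le1.
  apply: ae_ge0_le_integral => //.
  - by move=> x _; rewrite lee_fin topS_sq_ge0.
  - by apply: filterS norm1 => x x1 _; rewrite lee_fin topS_sq_le1.
have topE : (\int[nu]_x (topS_sq S x)%:E = (gammaS2 S nu)%:E)%E.
  rewrite /gammaS2 fineK // ge0_fin_numE; first by rewrite (le_lt_trans top_le1) ?ltry.
  by apply: integral_ge0 => x _; rewrite lee_fin topS_sq_ge0.
by split => //; rewrite -lee_fin -topE.
Qed.

(** By invariance the integral of the orbit sum is a multiple of that of [h]. The pointwise bound is
    affine in [topS_sq], so integration turns it into one in [gammaS2]. *)
Lemma symmetric_expectation S h (u w : R) : (S <= K)%N ->
    measurable_fun setT h -> (forall x, 0 <= h x) -> 0 <= w -> 0 <= u ->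
    {ae nu, forall x : vec, vnorm (x : 'cV[R]_K) = 1} ->
    {ae nu, forall x : vec, \sum_p \sum_(s : sg) h (c_ps p s x) <= u - w * topS_sq S x} ->
  ((#|{: 'S_K}|%:R * #|{: sg}|%:R)%:E * (\int[nu]_x (h x)%:E) <= (u - w * gammaS2 S nu)%:E)%E.
Proof.
move=> SK mh h0 w0 u0 norm1 hle.
have mhE : measurable_fun setT (fun x => (h x)%:E) by exact/measurable_EFinP.
have mtop : measurable_fun setT (fun x : vec => (topS_sq S x)%:E).
  by apply/measurable_EFinP; exact: measurable_topS_sq.
have [topE _] := integral_topS_sq SK norm1.
have sumE : ((#|{: 'S_K}|%:R * #|{: sg}|%:R)%:E * (\int[nu]_x (h x)%:E) =
    \int[nu]_x (\sum_p \sum_(s : sg) h (signed_perm p s x))%:E)%E.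
  have -> : (fun x => (\sum_p \sum_(s : sg) h (signed_perm p s x))%:E) =
     (fun x => \sum_(ps : 'S_K * sg) (h (signed_perm ps.1 ps.2 x))%:E)%E.
    by apply/funext => x; rewrite pair_big /= sumEFin.
  have mhT (ps : 'S_K * sg) : measurable_fun setT (fun x => (h (signed_perm ps.1 ps.2 x))%:E).
    by apply/measurable_EFinP; apply: measurableT_comp => //; exact: measurable_signed_perm.
  rewrite ge0_integral_sum //; last by move=> ps x _; rewrite lee_fin.
  rewrite (eq_bigr (fun=> \int[nu]_x (h x)%:E)%E); last first.
    by move=> ps _; rewrite (integral_signed_perm ps.1 ps.2 (f := fun x => (h x)%:E)).
  set a := (\int[nu]_x _)%E; have a0 : (0 <= a)%E by apply: integral_ge0 => x _; rewrite lee_fin.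
  under [RHS]eq_bigr do rewrite -[a]mul1e.
  rewrite -ge0_sume_distrl; last by move=> ps _; rewrite lee_fin.
  by rewrite sumEFin sumr_const -natrM -card_prod.
rewrite sumE.
under eq_integral do rewrite sum_signed_perm.
have mS : measurable_fun setT (fun x : vec => \sum_p \sum_(s : sg) h (c_ps p s x)).
  under eq_fun do rewrite -sum_signed_perm.
  apply: measurable_sum => p; apply: measurable_sum => s.
  by apply: measurableT_comp => //; exact: measurable_signed_perm.
rewrite EFinB EFinM -topE -ge0_integralZl_EFin //; last first.
  by move=> x _; rewrite lee_fin topS_sq_ge0.
have wt0 x : (0 <= w%:E * (topS_sq S x)%:E :> \bar R)%E.
  by rewrite -EFinM lee_fin mulr_ge0 // topS_sq_ge0.
have mwt : measurable_fun setT (fun x : vec => (w%:E * (topS_sq S x)%:E)%E).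
  by under eq_fun do rewrite -EFinM; apply/measurable_EFinP/measurable_funM => //;
    exact: measurable_topS_sq.
(* The term with [w] moves to the left, so that only nonnegative integrands occur. *)
rewrite leeBrDr; last first.
  rewrite ge0_integralZl_EFin //; last by move=> x _; rewrite lee_fin topS_sq_ge0.
  by rewrite topE.
rewrite -ge0_integralD //; last 2 first.
- by move=> x _; rewrite lee_fin; apply: sumr_ge0 => p _; apply: sumr_ge0.
- exact/measurable_EFinP.
apply: (@le_trans _ _ (\int[nu]_x (cst u%:E x))%E); last first.
  rewrite integral_cst // -[leRHS]mule1; apply: lee_wpmul2l; first by rewrite lee_fin.
  exact: probability_le1.
apply: ae_ge0_le_integral => //.
- move=> x _; rewrite adde_ge0 // lee_fin.
  by apply: sumr_ge0 => p _; apply: sumr_ge0.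
- by apply: emeasurable_funD => //; exact/measurable_EFinP.

by apply: filterS hle => x hx _; rewrite -EFinM -EFinD lee_fin -lerBrDr.
Qed.

End SymmetricExpectation.

(** * Chernoff bound from the product rule on boxes *)

Section IndependentChernoff.
Variable R : realType.

Lemma measure_finU_le d0 (T : measurableType d0) (mu : {measure set T -> \bar R})
    (I : finType) (Q : pred I) (A : I -> set T) :
    (forall i, Q i -> measurable (A i)) ->
  measurable (\big[setU/set0]_(i | Q i) A i) /\
  (mu (\big[setU/set0]_(i | Q i) A i) <= \sum_(i | Q i) mu (A i))%E.
Proof.
move=> mA; rewrite /index_enum; move: (Finite.enum _) => l; elim: l => [|i l [mU leU]].
  by rewrite !big_nil measure0.
rewrite !big_cons; case: (boolP (Q i)) => Qi; last by split.
split; first by apply: measurableU => //; exact: mA.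
by apply: le_trans (measureU2 _ (mA _ Qi) mU) _; rewrite leeD2l.
Qed.

Lemma in_finU T (I : finType) (Q : pred I) (A : I -> set T) i t :
  Q i -> A i t -> (\big[setU/set0]_(i | Q i) A i) t.
Proof. by move=> Qi Ait; rewrite (bigD1 i) //=; left. Qed.

Variables (K N : nat) (nu : probability (vecM R K) R).
Variables (d0 : measure_display) (Omega : measurableType d0) (P : probability Omega R).
Variable X : 'I_N -> Omega -> vecM R K.
Hypothesis iid : iid_with_law P X nu.

(* The product rule is only given for boxes, so [h] is replaced by a step
   function of mesh [eta]. *)
Lemma iid_chernoff (h : vecM R K -> R) (M b eta : R) :
    measurable_fun setT h -> (forall x, 0 <= h x <= M) -> 0 < eta ->
    (\int[nu]_x (h x)%:E <= b%:E)%E ->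
  measurable [set w | 1 <= \prod_(n < N) h (X n w)] /\
  (P [set w | (1 <= \prod_(n < N) h (X n w))%R] <= ((b + eta) ^+ N)%:E)%E.
Proof.
move=> mh hM eta0 hb; pose m := (Num.truncn (M / eta)).+1.
pose B (j : 'I_m) : set (vecM R K) := h @^-1` `[j%:R * eta, j.+1%:R * eta[%classic.
pose v (j : 'I_m) : R := j.+1%:R * eta.
have mB j : measurable (B j) by rewrite -[B j]setTI; apply: mh => //; exact: measurable_itv.
have v0 j : 0 <= v j by rewrite mulr_ge0 // ltW.
have cover x : exists j, B j x.
  have /andP[h0 hx] := hM x.
  have hq : 0 <= h x / eta by rewrite divr_ge0 // ltW.
  have jm : (Num.truncn (h x / eta) < m)%N.
    by rewrite ltnS le_truncn // ler_wpM2r // invr_ge0 ltW.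
  exists (Ordinal jm); rewrite /B /= in_itv /=; have := truncn_itv hq.
  by rewrite ler_pdivlMr // ltr_pdivrMr.
have vB j x : B j x -> h x <= v j <= h x + eta.
  rewrite /B /= in_itv /= => /andP[l r]; rewrite (ltW r) /= /v -natr1 mulrDl mul1r lerD2r //.
have mprod : measurable_fun setT (fun w => \prod_(n < N) h (X n w)).
  apply: measurable_prod => n _; apply: measurableT_comp => //; exact: iid.1.
have mE : measurable [set w | 1 <= \prod_(n < N) h (X n w)].
  rewrite -[X in measurable X]setTI.
  have -> : [set w | 1 <= \prod_(n < N) h (X n w)] =
     (fun w => \prod_(n < N) h (X n w)) @^-1` `[1, +oo[%classic.
    by apply/seteqP; split => w /=; rewrite in_itv /= andbT.
  by apply: mprod => //; exact: measurable_itv.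
split => //.
pose box (J : {ffun 'I_N -> 'I_m}) := \bigcap_(n in [set: 'I_N]) (X n @^-1` B (J n)).
have mbox J : measurable (box J).
  apply: fin_bigcap_measurable => // n _; rewrite -[X in measurable X]setTI.
  by apply: iid.1.
(* Boxes whose cell values multiply to at least 1: they cover the event, and weighting each by that
   product is Markov's inequality. *)
pose Q (J : {ffun 'I_N -> 'I_m}) := 1 <= \prod_(n < N) v (J n).
have sub : [set w | 1 <= \prod_(n < N) h (X n w)] `<=` \big[setU/set0]_(J | Q J) box J.
  move=> w /= hw; pose J := [ffun n => projT1 (cid (cover (X n w)))].
  have JB n : B (J n) (X n w) by rewrite ffunE; case: cid.
  apply: (@in_finU _ _ Q box J); last by move=> n _; exact: JB.
  apply: le_trans hw _; apply: ler_prod => n _.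
  by have /andP[-> _] := hM (X n w); have /andP[-> _] := vB _ _ (JB n).
have [mU leU] := measure_finU_le P (Q := Q) (fun J _ => mbox J).
apply: le_trans (le_measure P _ _ sub) _; rewrite ?inE //.
apply: le_trans leU _.
pose f j : R := fine (nu (B j)).
have fE j : nu (B j) = (f j)%:E by rewrite fineK // fin_num_measure.
have f0 j : 0 <= f j by rewrite fine_ge0.
rewrite (eq_bigr (fun J : {ffun 'I_N -> 'I_m} => (\prod_(n < N) f (J n))%:E)); last first.
  move=> J _; transitivity (\prod_(n < N) nu (B (J n)))%E.
    exact: (iid.2 (fun n => B (J n)) (fun n => mB (J n))).
  by rewrite -prodEFin; apply: eq_bigr => n _; rewrite fE.
rewrite sumEFin lee_fin.
apply: (@le_trans _ _ (\sum_(J : {ffun 'I_N -> 'I_m}) \prod_(n < N) (v (J n) * f (J n)))).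
  rewrite big_mkcond; apply: ler_sum => J _; rewrite big_split /=.
  case: ifP => [QJ|_]; last by rewrite mulr_ge0 // prodr_ge0.
  by rewrite ler_peMl // prodr_ge0.
rewrite -(bigA_distr_bigA (fun (n : 'I_N) j => v j * f j)) /= prodr_const card_ord.
have sum0 : 0 <= \sum_j v j * f j by apply: sumr_ge0 => j _; rewrite mulr_ge0.
suff le_sum : \sum_j v j * f j <= b + eta.
  by apply: lerXn2r => //; rewrite nnegrE // (le_trans sum0).
have -> : \sum_j v j * f j <= b + eta = ((\sum_j v j * f j)%:E <= b%:E + eta%:E)%E :> Prop.
  by rewrite -EFinD lee_fin.
apply: (@le_trans _ _ (\int[nu]_x (h x)%:E + \int[nu]_x (cst eta%:E x))%E); last first.
  rewrite leeD // integral_cst // -[leRHS]mule1; apply: lee_wpmul2l; first by rewrite lee_fin ltW.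
  exact: probability_le1.
rewrite -ge0_integralD //; last 3 first.
- by move=> x _; rewrite lee_fin; case/andP: (hM x).
- exact/measurable_EFinP.
- by move=> x _; rewrite lee_fin ltW.
have -> : ((\sum_j v j * f j)%:E = \int[nu]_x (\sum_j (v j)%:E * (\1_(B j) x)%:E))%E.
  rewrite ge0_integral_sum //; last 2 first.
  - by move=> j; apply: emeasurable_funM => //; apply/measurable_EFinP; exact: measurable_indic.
  - by move=> j x _; rewrite -EFinM lee_fin mulr_ge0.
  rewrite -sumEFin; apply: eq_bigr => j _.
  rewrite ge0_integralZl_EFin //; last by apply/measurable_EFinP; exact: measurable_indic.
  by rewrite integral_indic // setIT EFinM; congr (_ * _)%E; exact/esym/fE.
apply: ge0_le_integral => //.
- by move=> x _; apply: sume_ge0 => j _; rewrite -EFinM lee_fin mulr_ge0.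
- apply: emeasurable_sum => j; apply: emeasurable_funM => //; apply/measurable_EFinP.
  exact: measurable_indic.
- by apply: emeasurable_funD => //; exact/measurable_EFinP.
move=> x _; have [j Bj] := cover x.
rewrite (bigD1 j) //= big1 ?adde0; last first.
  move=> i ij; rewrite indicE memNset ?mule0 // => Bi; case/eqP: ij.
  apply/val_inj/eqP; move: Bi Bj; rewrite /B /= !in_itv /= => /andP[i1 i2] /andP[j1 j2].
  have ij' : (i < j.+1)%N by have := le_lt_trans i1 j2; rewrite ltr_pM2r // ltr_nat.
  have ji' : (j < i.+1)%N by have := le_lt_trans j1 i2; rewrite ltr_pM2r // ltr_nat.
  by move: ij' ji'; rewrite !ltnS eqn_leq => -> ->.
by rewrite indicE mem_set // mule1 -EFinD lee_fin; case/andP: (vB _ _ Bj).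
Qed.

End IndependentChernoff.

(** * Deviation bound for one dictionary *)

Section DictionaryTail.
Variable R : realType.
Variables (d K S : nat).
Implicit Types (I : {set 'I_K}).

Lemma score_lip (Psi Psi' : 'M[R]_(d, K)) (L : R) y : 0 <= L ->
    (forall I, (#|I| <= S)%N -> vnorm (Pproj Psi I *m y - Pproj Psi' I *m y) <= L * vnorm y) ->
  score S Psi y <= score S Psi' y + L * vnorm y ^+ 2.
Proof.
move=> L0 h; apply: score_leP; first by rewrite addr_ge0 ?score_ge0 // mulr_ge0 ?sqr_ge0.
move=> I IS; have := score_ge Psi' y IS.
have := energy_dist (h I IS); rewrite distrC ler_norml => /andP[_]; lra.
Qed.

Variables (Phi : 'M[R]_(d, K)) (A kappa : R).
Hypothesis tight : unit_norm_tight_frame Phi A.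
Hypothesis A0 : 0 <= A.
Hypothesis SK : (0 < S < K)%N.
Hypothesis kappa0 : 0 < kappa.

Variable nu : probability (vecM R K) R.
Hypothesis sym : symmetric_measure nu.
Hypothesis norm1 : {ae nu, forall x : vecM R K, vnorm (x : 'cV[R]_K) = 1}.
Hypothesis gap : {ae nu, forall x : vecM R K, gap_separated S Phi kappa x}.

Let lambda := gammaS2 S nu / S%:R - (1 - gammaS2 S nu) / (K%:R - S%:R).
Hypothesis lambda0 : 0 < lambda.

Variables (N : nat) (d0 : measure_display) (Omega : measurableType d0) (P : probability Omega R).
Variable X : 'I_N -> Omega -> vecM R K.
Hypothesis iid : iid_with_law P X nu.

(** The product rule is used on boxes with [Z] in one factor and the whole space in the others. *)
Lemma null_event (Z : set (vecM R K)) : measurable Z -> nu Z = 0%E ->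
  measurable [set w | exists n, Z (X n w)] /\ P [set w | exists n, Z (X n w)] = 0%E.
Proof.
move=> mZ Z0; have mX n : measurable (X n @^-1` Z).
  by rewrite -[X in measurable X]setTI; apply: iid.1.
have -> : [set w | exists n, Z (X n w)] = \big[setU/set0]_(n < N) (X n @^-1` Z).
  apply/seteqP; split => w /=; first by move=> [n Zn]; apply: (@in_finU _ _ xpredT _ n).
  elim/big_ind: _ => //; first by move=> U V hU hV [/hU|/hV].
  by move=> n _ Zn; exists n.
have [mU leU] := measure_finU_le P (Q := xpredT) (fun n _ => mX n).
split => //; apply/eqP; rewrite -measure_le0; apply: le_trans leU _.
rewrite big1 // => n _.
transitivity (P (\bigcap_(m in [set: 'I_N]) (X m @^-1` (if m == n then Z else setT)))).
  congr (P _); apply/seteqP; split => w /=.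
    by move=> Zn m _; case: eqP => [->|].
  by move=> /(_ n Logic.I); rewrite eqxx.
transitivity (\prod_(m < N) nu (if m == n then Z else setT))%E.
  by apply: (iid.2 (fun m => if m == n then Z else setT)) => m; case: ifP.
by rewrite (bigD1 n) //= eqxx Z0 mul0e.
Qed.

Variables (Psi : 'M[R]_(d, K)) (rho theta Gmin tau : R).
Hypothesis rho0 : 0 < rho.
Hypothesis close : forall I y, (#|I| <= S)%N ->
  vnorm (Pproj Phi I *m y - Pproj Psi I *m y) <= rho * vnorm y.
Hypothesis resid_kappa : forall I, (#|I| <= S)%N -> resid Phi Psi I <= kappa ^+ 2.
Hypothesis theta0 : 0 < theta.
Hypothesis thetaA : theta * A <= 3^-1.
Hypothesis theta_var : theta * A / kappa ^+ 2 <= lambda / 4.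
Hypothesis Gmin0 : 0 < Gmin.
Hypothesis bad_small : A * (2 + theta * A) * bad_rate d K S kappa rho <= lambda / 4 * Gmin.
Hypothesis GminP : Gmin * #|{: 'S_K}|%:R <= \sum_p resid Phi Psi (Ip S p).
Hypothesis tauE : tau = lambda * Gmin / 8.

Let g (x : vecM R K) := score S Psi (Phi *m (x : 'cV[R]_K)) - score S Phi (Phi *m (x : 'cV[R]_K)).

(** The moment bound has rate [theta * lambda * Gmin / 2], of which the margin [tau] consumes a
    quarter. *)
Lemma expectation_expR_score :
  (\int[nu]_x (expR (theta * (Num.min (g x) A + tau)))%:E
     <= (expR (- (3 / 8 * (theta * lambda * Gmin))))%:E)%E.
Proof.
pose mK : R := #|{: 'S_K}|%:R; pose m : R := #|{: {ffun 'I_K -> bool}}|%:R.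
pose G := \sum_p resid Phi Psi (Ip S p).
have GP : Gmin * mK <= G by exact: GminP.
have mK0 : 0 < mK by rewrite ltr0n; apply/card_gt0P; exists 1%g.
have m0 : 0 < m by rewrite ltr0n card_ffun card_bool expn_gt0.
have S0 : 0 < S%:R :> R by rewrite ltr0n; case/andP: SK.
have KS0 : 0 < K%:R - S%:R :> R by rewrite subr_gt0 ltr_nat; case/andP: SK.
have Si0 : 0 < S%:R^-1 :> R by rewrite invr_gt0.
have KSi0 : 0 < (K%:R - S%:R)^-1 :> R by rewrite invr_gt0.
have G0 : 0 < G by apply: lt_le_trans GP; rewrite mulr_gt0.
have mg : measurable_fun setT g by apply: measurable_funB; exact: measurable_score.
pose E := expR (theta * tau); have E0 : 0 < E by exact: expR_gt0.
(* Coefficients of the bound in [sum_expR_score], read as an affine function of [topS_sq]. *)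
pose w := E * (m * (theta * G * (S%:R^-1 + (K%:R - S%:R)^-1))).
pose u := E * (m * (mK + theta * ((K%:R - S%:R)^-1 + lambda / 2) * G)).
have := @symmetric_expectation R K nu sym S (fun x => expR (theta * (Num.min (g x) A + tau))) u w.
case/andP: (SK) => _ /ltnW SK' /(_ SK') H.
have {}H : ((mK * m)%:E * \int[nu]_x (expR (theta * (Num.min (g x) A + tau)))%:E <=
    (u - w * gammaS2 S nu)%:E)%E.
  apply: H => //.
  - apply: measurableT_comp => //; apply: measurable_funM => //; apply: measurable_funD => //.
    by apply: measurable_minr.
  - by rewrite /w !(mulr_ge0, addr_ge0) // ltW.
  - rewrite ltW // /u mulr_gt0 // mulr_gt0 // addr_gt0 // mulr_gt0 // mulr_gt0 // addr_gt0 //.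
    by rewrite divr_gt0.
  move: norm1 gap; apply: filterS2 => x x1 gx.
  have bs : A * (2 + theta * A) * bad_rate d K S kappa rho * mK <= lambda / 4 * G.
    apply: (@le_trans _ _ (lambda / 4 * Gmin * mK)); first by rewrite ler_wpM2r // ltW.
    by rewrite -mulrA ler_wpM2l // divr_ge0 // ltW.
  have := sum_expR_score tight A0 SK kappa0 x1 gx rho0 close resid_kappa (ltW theta0) thetaA
     theta_var bs.
  move=> h; apply: (@le_trans _ _ (E * \sum_p \sum_(s : {ffun 'I_K -> bool})
     expR (theta * (score S Psi (Phi *m c_ps p s x) - score S Phi (Phi *m c_ps p s x))))).
    rewrite mulr_sumr; apply: ler_sum => p _; rewrite mulr_sumr; apply: ler_sum => s _.
    rewrite mulrDr expRD mulrC ler_wpM2l ?(ltW E0) // ler_expR ler_wpM2l ?(ltW theta0) //.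
    by rewrite ge_min lexx.
  apply: le_trans (ler_wpM2l (ltW E0) h) _; rewrite -/G -/mK -/m /u /w /topS_gap.
  rewrite le_eqVlt; apply/orP; left; apply/eqP; field.
  by rewrite !gt_eqF.
have uw : u - w * gammaS2 S nu = E * (m * (mK - theta * lambda / 2 * G)).
  by rewrite /u /w /lambda; field; rewrite !gt_eqF.
rewrite uw in H; set I := (\int[nu]_x _)%E in H *.
have -> : expR (- (3 / 8 * (theta * lambda * Gmin))) = E * expR (- (theta * lambda / 2 * Gmin)).
  by rewrite /E -expRD tauE; congr expR; field.
have mm : 0 < mK * m by rewrite mulr_gt0.
rewrite -(@lee_pmul2l _ (mK * m)%:E) ?lte_fin //; apply: le_trans H _.
rewrite -EFinM lee_fin.
have -> : mK * m * (E * expR (- (theta * lambda / 2 * Gmin))) =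
   E * (m * (mK * expR (- (theta * lambda / 2 * Gmin)))) by ring.
rewrite ler_wpM2l ?(ltW E0) // ler_wpM2l ?(ltW m0) //.
have h1 := expR_ge1Dx (- (theta * lambda / 2 * Gmin)).
have h2 : mK * (1 - theta * lambda / 2 * Gmin) <= mK * expR (- (theta * lambda / 2 * Gmin)).
  by rewrite ler_wpM2l // ltW.
have h3 : theta * lambda / 2 * (Gmin * mK) <= theta * lambda / 2 * G.
  by rewrite ler_wpM2l // !mulr_ge0 ?invr_ge0 // ltW.
lra.
Qed.

(* [g x <= A] as soon as [x] has norm 1; truncating makes the integrand bounded
   on the whole space. *)
Let h (x : vecM R K) := expR (theta * (Num.min (g x) A + tau)).

Lemma dictionary_tail :
  measurable [set w | 1 <= \prod_(n < N) h (X n w)] /\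
  (P [set w | (1 <= \prod_(n < N) h (X n w))%R]
     <= (expR (- (N%:R * (theta * lambda * Gmin / 4))))%:E)%E.
Proof.
have mg : measurable_fun setT g by apply: measurable_funB; exact: measurable_score.
have mh : measurable_fun setT h.
  apply: measurableT_comp => //; apply: measurable_funM => //; apply: measurable_funD => //.
  by apply: measurable_minr.
have hM x : 0 <= h x <= expR (theta * (A + tau)).
  by rewrite expR_ge0 ler_expR ler_wpM2l ?(ltW theta0) // lerD2r ge_min lexx orbT.
pose b := expR (- (3 / 8 * (theta * lambda * Gmin))).
(* The step function uses the slack between the rates 3/8 and 1/4. *)
pose eta := expR (- (theta * lambda * Gmin / 4)) - b.
have eta0 : 0 < eta.
  have : 0 < theta * lambda * Gmin by rewrite !mulr_gt0.
  by move=> tl; rewrite subr_gt0 ltr_expR; lra.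
have [mE leE] := iid_chernoff iid mh hM eta0 expectation_expR_score.
split => //; apply: le_trans leE _; rewrite lee_fin addrC subrK.
by rewrite -expRM_natl mulrN.
Qed.

(** Outside the event the sum of the exponents is negative, and on the sphere the truncation at [A]
    is inactive. *)
Lemma tail_score w : (forall n, vnorm (X n w : 'cV[R]_K) = 1) ->
    ~ (1 <= \prod_(n < N) h (X n w)) ->
  \sum_(n < N) score S Psi (Phi *m (X n w : 'cV[R]_K)) + N%:R * tau
    < \sum_(n < N) score S Phi (Phi *m (X n w : 'cV[R]_K)).
Proof.
move=> w1 /negP; rewrite -ltNge /h -expR_sum -[ltRHS]expR0 ltr_expR -mulr_sumr pmulr_rlt0 //.
rewrite big_split /= sumr_const card_ord -[_ *+ N]mulr_natl.
rewrite (eq_bigr (fun n => g (X n w))); first by rewrite sumrB; lra.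
move=> n _; apply/min_idPl; rewrite /g lerBlDr -[leLHS]addr0.
rewrite lerD ?score_ge0 //; apply: le_trans (score_le _ _ _) _.
by apply: le_trans (tight_vnorm_le tight _) _; rewrite w1 expr1n mulr1.
Qed.

End DictionaryTail.

(** * A finite net inside a set of dictionaries *)

Section GridNet.
Variable R : realType.

Lemma sum_natr_const (n : nat) (c : R) : \sum_(i < n) c = n%:R * c.
Proof. by rewrite sumr_const card_ord mulr_natl. Qed.

(** Grid points need not satisfy [D], so each cell that meets [D] is represented by one of its
    members in [D], and the others by [None]. Two points of a cell differ by at most [h] in every
    entry. *)
Lemma grid_net (d K m : nat) (Phi : 'M[R]_(d, K)) (r h : R) (D : 'M[R]_(d, K) -> Prop) :
    0 < h -> 2 * r < m%:R * h ->
    (forall Psi, D Psi -> forall k, vnorm (col k Psi - col k Phi) <= r) ->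
  exists rep : {ffun 'I_d * 'I_K -> 'I_m} -> option 'M[R]_(d, K),
    (forall J Psi, rep J = Some Psi -> D Psi) /\
    (forall Psi, D Psi -> exists J, exists2 Psi', rep J = Some Psi' &
        forall k, dotv (col k Psi - col k Psi') (col k Psi - col k Psi') <= d%:R * h ^+ 2).
Proof.
move=> h0 rm near.
pose code (Psi : 'M[R]_(d, K)) (J : {ffun 'I_d * 'I_K -> 'I_m}) :=
  forall i k, (J (i, k))%:R * h <= Psi i k - Phi i k + r < (J (i, k)).+1%:R * h.
exists (fun J => if pselect (exists2 Psi, D Psi & code Psi J) is left e
                 then Some (projT1 (cid2 e)) else None).
split=> [J Psi|Psi DPsi].
  by case: pselect => // e [<-]; case: cid2.
have ent i k : 0 <= Psi i k - Phi i k + r <= 2 * r.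
  have := le_trans (ler_coord_vnorm (col k Psi - col k Phi) i) (near _ DPsi k).
  by rewrite !mxE ler_norml => /andP[]; lra.
have lt i k : (Num.truncn ((Psi i k - Phi i k + r) / h) < m)%N.
  have /andP[e0 e1] := ent i k; rewrite truncn_lt_nat ?divr_ge0 ?(ltW h0) //.
  by rewrite ltr_pdivrMr // (le_lt_trans e1).
pose J := [ffun ik : 'I_d * 'I_K => Ordinal (lt ik.1 ik.2)].
have PJ : code Psi J.
  move=> i k; rewrite ffunE /=; have /andP[e0 _] := ent i k.
  have := @truncn_itv R ((Psi i k - Phi i k + r) / h); rewrite divr_ge0 ?(ltW h0) // => /(_ isT).
  by rewrite ler_pdivlMr // ltr_pdivrMr.
exists J; case: pselect => [e|[]]; last by exists Psi.
exists (projT1 (cid2 e)) => //; case: cid2 => Psi' DPsi' PJ' k /=.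
rewrite /dotv; apply: le_trans (ler_sum _ (G := fun=> h ^+ 2) _) _; last by rewrite sum_natr_const.
move=> i _; rewrite -expr2 -real_normK ?num_real // ler_sqr ?nnegrE ?(ltW h0) // !mxE.
have /andP[a1 a2] := PJ i k; have /andP[b1 b2] := PJ' i k.
rewrite -natr1 mulrDl mul1r in a2 b2.
by rewrite ler_norml; apply/andP; split; lra.
Qed.

End GridNet.

(** * Compactness: smallest eigenvalues and local maxima *)

Section CompactnessArguments.
Variable R : realType.
Import numFieldNormedType.Exports.

Lemma continuous_sumR (T : topologicalType) (I : finType) (f : I -> T -> R) :
  (forall i, continuous (f i)) -> continuous (fun t => \sum_i f i t).
Proof.
move=> cf; apply: (@continuous_big R I +%R 0 xpredT) => //.
exact: add_continuous.
Qed.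

Lemma closed_preim (T : topologicalType) (f : T -> R) (A : set R) :
  continuous f -> closed A -> closed (f @^-1` A).
Proof. by move=> /continuous_closedP cf; exact: cf. Qed.

Lemma rV_norm_coord n (v : 'rV[R]_n) i : `|v 0 i| <= `|v|.
Proof. by rewrite [leRHS]/Num.norm /= mx_normrE (le_bigmax _ (fun ij : 'I_1 * 'I_n => `|v ij.1 ij.2|) (0, i)). Qed.

Lemma rV_bounded n (A : set 'rV[R]_n) (M : R) : 0 <= M ->
  (forall v, A v -> forall i, `|v 0 i| <= M) -> bounded_set A.
Proof.
move=> M0 AM; exists M; split; first exact: num_real.
move=> x Mx v Av; apply: le_trans (ltW Mx); rewrite [leLHS]/Num.norm /= mx_normrE.
by apply/bigmax_leP; split => // -[i j] _ /=; rewrite ord1; exact: AM.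
Qed.

Lemma vnorm_le_entries d (u : 'cV[R]_d) (e : R) : 0 <= e ->
  (forall i, `|u i 0| <= e) -> vnorm u <= d%:R * e.
Proof.
move=> e0 ue; rewrite -ler_sqr ?nnegrE ?vnorm_ge0 ?mulr_ge0 // vnorm_sqr.
apply: (@le_trans _ _ (\sum_(i < d) e ^+ 2)).
  apply: ler_sum => i _; rewrite -expr2 -real_normK ?num_real //.
  by rewrite ler_sqr ?nnegrE.
rewrite sumr_const card_ord -[e ^+ 2 *+ d]mulr_natl exprMn ler_wpM2r ?sqr_ge0 //.
by rewrite -natrX ler_nat; case: (d) => // n; rewrite expnS leq_pmulr // expn_gt0.
Qed.

Section LambdaMin.
Variables (d n : nat) (B : 'M[R]_(d, n)).

Let sphere := [set v : 'rV[R]_n | dotv v^T v^T = 1].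

Let continuous_dot p (M : 'M[R]_(p, n)) : continuous (fun v : 'rV[R]_n => dotv (M *m v^T) (M *m v^T)).
Proof.
have ci i : continuous (fun v : 'rV[R]_n => (M *m v^T) i 0).
  have -> : (fun v : 'rV[R]_n => (M *m v^T) i 0) = (fun v => \sum_j M i j * v 0 j).
    by apply/funext => v; rewrite mxE; apply: eq_bigr => j _; rewrite mxE.
  apply: continuous_sumR => j v.
  by apply: continuousM; [exact: cst_continuous|exact: coord_continuous].
by apply: continuous_sumR => i v; apply: continuousM; exact: ci.
Qed.

(** The sphere is compact, and homogeneity extends the minimum to all [w]. *)
Lemma rayleigh_min : (0 < n)%N -> exists v : 'cV[R]_n,
  dotv v v = 1 /\ forall w : 'cV[R]_n, dotv (B *m v) (B *m v) * dotv w w <= dotv (B *m w) (B *m w).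
Proof.
move=> n0.
have cA : compact sphere.
  apply: bounded_closed_compact.
    apply: (@rV_bounded _ _ 1) => // v /= v1 i.
    by have := ler_coord_vnorm v^T i; rewrite mxE => /le_trans; apply;
       rewrite -ler_sqr ?nnegrE ?vnorm_ge0 // vnorm_sqr v1 expr1n.
  apply: (@closed_preim _ (fun v : 'rV[R]_n => dotv v^T v^T) [set x | x = 1]); last exact: closed_eq.
  have -> : (fun v : 'rV[R]_n => dotv v^T v^T) =
      (fun v => dotv (1%:M *m v^T) (1%:M *m v^T)) by apply/funext => v; rewrite mul1mx.
  exact: continuous_dot.
have A0 : sphere !=set0.
  exists (delta_mx 0 (Ordinal n0)); rewrite /sphere /= trmx_delta /dotv.
  rewrite (bigD1 (Ordinal n0)) //= big1 ?addr0; first by rewrite !mxE !eqxx mulr1.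
  by move=> j j0; rewrite !mxE (negbTE j0) mul0r.
have [v vA vmin] := compact_EVT_min A0 cA (continuous_subspaceT (@continuous_dot _ B)).
exists v^T; split; first by move: vA; rewrite inE.
move=> w; have [w0|w0] := eqVneq (dotv w w) 0.
  by rewrite w0 mulr0 dotv_ge0.
have wp : 0 < dotv w w by rewrite lt_def w0 dotv_ge0.
have wn : 0 < vnorm w by rewrite lt_def vnorm_ge0 andbT -sqrf_eq0 vnorm_sqr.
have u1 : ((vnorm w)^-1 *: w)^T \in sphere.
  apply/mem_set; rewrite /sphere /mkset trmxK dotvZl dotvZr mulrA -expr2.
  by rewrite exprVn vnorm_sqr mulVf.
have := vmin _ u1.
rewrite trmxK -scalemxAr dotvZl dotvZr mulrA -expr2 exprVn vnorm_sqr.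
by rewrite ler_pdivlMl // mulrC.
Qed.

Lemma eigenvalue_gram_ge0 a : eigenvalue (B^T *m B) a -> 0 <= a.
Proof.
move=> /eigenvalueP[v vB v0]; have vv : 0 < dotv v^T v^T.
  rewrite lt_def dotv_ge0 andbT; apply: contraNneq v0 => /dotv_eq0/(congr1 trmx).
  by rewrite trmxK trmx0 => ->.
rewrite -(pmulr_lge0 _ vv) -dotvZl.
have -> : a *: v^T = B^T *m (B *m v^T).
  by apply: trmx_inj; rewrite linearZ /= !trmx_mul !trmxK -vB mulmxA.
by rewrite dotv_mulmxl trmxK dotv_ge0.
Qed.

(** [lambda_min] is an infimum over eigenvalues, so bounding it from above requires an actual
    eigenvalue, supplied by a minimizer on the sphere. *)
Lemma eigenvalue_gram_ex : (0 < n)%N -> exists2 m, eigenvalue (B^T *m B) m &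
  forall w : 'cV[R]_n, m * dotv w w <= dotv (B *m w) (B *m w).
Proof.
move=> n0; have [v [v1 vmin]] := rayleigh_min n0.
set m := dotv (B *m v) (B *m v) in vmin *; exists m => //.
pose b w := dotv (B *m v) (B *m w) - m * dotv v w.
have b0 w : b w = 0.
  (* first-order optimality of the minimizer v *)
  pose q := dotv (B *m w) (B *m w) - m * dotv w w.
  have qt t : 0 <= t * (2 * b w) + t ^+ 2 * q.
    have expand p (x y : 'cV[R]_p) : dotv (x + t *: y) (x + t *: y) =
        dotv x x + 2 * t * dotv x y + t ^+ 2 * dotv y y.
      by rewrite dotvDl !dotvDr !dotvZl !dotvZr (dotvC y x); ring.
    have := vmin (v + t *: w); rewrite mulmxDr -scalemxAr !expand -/m v1 /b /q; lra.
  have q0 : 0 <= q by rewrite /q subr_ge0.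
  apply/eqP; rewrite -sqrf_eq0 eq_le sqr_ge0 andbT.
  (* The denominator is [1 + q] because [q] may vanish. *)
  have := qt (- b w / (1 + q)); have p : 0 < 1 + q by rewrite ltr_pwDl.
  have -> : - b w / (1 + q) * (2 * b w) + (- b w / (1 + q)) ^+ 2 * q =
     - (b w ^+ 2 * ((2 + q) / (1 + q) ^+ 2)) by field; rewrite gt_eqF.
  rewrite oppr_ge0 pmulr_lle0 // divr_gt0 ?exprn_gt0 //.
  by rewrite ltr_pwDl.
apply/eigenvalueP; exists v^T; last first.
  apply: contra_eqN v1 => /eqP/(congr1 trmx); rewrite trmxK trmx0 => ->.
  by rewrite dotv0l eq_sym oner_eq0.
apply: trmx_inj; rewrite linearZ /= !trmx_mul !trmxK -mulmxA.
apply/eqP; rewrite -subr_eq0; apply/eqP; apply: dotv_eq0.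
set u := _ - _; rewrite {1}/u dotvBl dotvZl dotv_mulmxl trmxK.
exact: b0.
Qed.

Lemma lambda_min_le (w : 'cV[R]_n) : (0 < n)%N ->
  lambda_min (B^T *m B) * dotv w w <= dotv (B *m w) (B *m w).
Proof.
move=> n0; have [m mE mle] := eigenvalue_gram_ex n0; apply: le_trans (mle w).
rewrite ler_wpM2r ?dotv_ge0 // /lambda_min; apply: ge_inf => //.
by exists 0 => a /= /eigenvalue_gram_ge0.
Qed.

Lemma lambda_min_ge0 : (0 < n)%N -> 0 <= lambda_min (B^T *m B).
Proof.
move=> n0; have [m mE _] := eigenvalue_gram_ex n0; apply: lb_le_inf; first by exists m.
by move=> a /= /eigenvalue_gram_ge0.
Qed.

End LambdaMin.

Section LowerIsometry.
Variables (d K S : nat) (Phi : 'M[R]_(d, K)).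
Hypothesis Phi1 : dictionary Phi.
Implicit Types I : {set 'I_K}.

Let lam I := lambda_min ((subcols Phi I)^T *m subcols Phi I).

Lemma lower_isometry_sup I : (0 < #|I| <= S)%N -> 1 - lam I <= lower_isometry_const S Phi.
Proof.
move=> IS; apply: ub_le_sup; last by exists I.
exists 1 => _ [J /= /andP[J0 _] <-].
by rewrite gerBl; exact: lambda_min_ge0.
Qed.

(** The Gram matrix of a single unit atom has smallest eigenvalue at most 1. *)
Lemma lower_isometry_ge0 (k : 'I_K) : (0 < S)%N -> 0 <= lower_isometry_const S Phi.
Proof.
move=> S0; have ck : (0 < #|[set k]%SET| <= S)%N by rewrite cards1.
apply: le_trans (lower_isometry_sup ck); rewrite subr_ge0.
have k0 : (0 < #|[set k]%SET|)%N by rewrite cards1.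
have j0 : 'I_#|[set k]%SET| by exact: (Ordinal k0).
have := lambda_min_le (subcols Phi [set k]%SET) (delta_mx (Ordinal k0) 0) k0.
rewrite -/(lam _) mulmx_delta.
have -> : dotv (delta_mx (Ordinal k0) 0) (delta_mx (Ordinal k0) 0) = 1 :> R.
  rewrite /dotv (bigD1 (Ordinal k0)) //= big1 ?addr0; first by rewrite !mxE !eqxx mulr1.
  by move=> j /negbTE jk; rewrite !mxE jk mul0r.
rewrite mulr1 => /le_trans; apply.
have -> : col (Ordinal k0) (subcols Phi [set k]%SET) = col k Phi.
  apply/colP => i; rewrite !mxE; congr (Phi i _); apply/set1P; exact: enum_valP.
by rewrite -vnorm_sqr Phi1 expr1n.
Qed.

Lemma lower_isometry_low I a : (#|I| <= S)%N -> supp_in I a ->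
  (1 - lower_isometry_const S Phi) * dotv a a <= dotv (Phi *m a) (Phi *m a).
Proof.
move=> IS aI; have [I0|I0] := posnP #|I|.
  suff -> : a = 0 by rewrite dotv0l mulr0 dotv_ge0.
  apply/colP => k; rewrite mxE aI //; move/eqP: I0; rewrite cards_eq0 => /eqP ->.
  by rewrite inE.
pose u : 'cV[R]_#|I| := \col_j a (enum_val j) 0.
have reI (V : nmodType) (F : 'I_K -> V) : \sum_(k in I) F k = \sum_(j < #|I|) F (enum_val j).
  by rewrite big_enum_val.
have uE : dotv u u = dotv a a.
  rewrite /dotv [RHS](bigID (mem I)) /= [X in _ = _ + X]big1 ?addr0 ?reI; last first.
    by move=> k /aI ->; rewrite mul0r.
  by apply: eq_bigr => j _; rewrite !mxE.
have BuE : subcols Phi I *m u = Phi *m a.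
  rewrite [RHS]mulmx_colE (sum_supp_in _ aI) reI; apply/colP => i.
  by rewrite mxE summxE; apply: eq_bigr => j _; rewrite !mxE mulrC.
have := lambda_min_le (subcols Phi I) u I0; rewrite BuE uE; apply: le_trans.
rewrite ler_wpM2r ?dotv_ge0 // lerBlDr -lerBlDl; apply: lower_isometry_sup.
by rewrite I0 IS.
Qed.

End LowerIsometry.

Section LocalMaximum.
Variables (d K : nat) (Phi : 'M[R]_(d, K)) (F : 'M[R]_(d, K) -> R) (r L : R).
Hypothesis Phi1 : dictionary Phi.
Hypothesis r0 : 0 < r.
Hypothesis L0 : 0 <= L.

Let ball Psi := dictionary Psi /\ forall k, vnorm (col k Psi - col k Phi) <= r.

Hypothesis Flip : forall Psi Psi' e, ball Psi -> ball Psi' -> 0 <= e ->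
  (forall k, vnorm (col k Psi - col k Psi') <= e) -> F Psi <= F Psi' + L * e.
Hypothesis Fboundary : forall Psi k, ball Psi -> vnorm (col k Psi - col k Phi) = r -> F Psi < F Phi.

Lemma dict_dist_le (Psi Psi' : 'M[R]_(d, K)) e : 0 <= e ->
  (forall k, vnorm (col k Psi - col k Psi') <= e) -> dict_dist Psi Psi' <= e.
Proof. by move=> e0 h; apply/bigmax_leP; split. Qed.

Lemma le_dict_dist (Psi Psi' : 'M[R]_(d, K)) k :
  vnorm (col k Psi - col k Psi') <= dict_dist Psi Psi'.
Proof. exact: (le_bigmax _ (fun k => vnorm (col k Psi - col k Psi'))). Qed.

Lemma local_max_in_ball : exists Psi, local_max_on_D F Psi /\ dict_dist Psi Phi <= r.
Proof.
pose A := [set v : 'rV[R]_(d * K) | ball (vec_mx v)].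
have centv i k : continuous (fun v : 'rV[R]_(d * K) => vec_mx v i k).
  have -> : (fun v : 'rV[R]_(d * K) => vec_mx v i k) = (fun v => v 0 (mxvec_index i k)).
    by apply/funext => v; rewrite mxE.
  exact: coord_continuous.
have cdist k (u : 'cV[R]_d) :
    continuous (fun v : 'rV[R]_(d * K) => dotv (col k (vec_mx v) - u) (col k (vec_mx v) - u)).
  have ci i : continuous (fun v : 'rV[R]_(d * K) => (col k (vec_mx v) - u) i 0).
    have -> : (fun v : 'rV[R]_(d * K) => (col k (vec_mx v) - u) i 0) =
       (fun v => v 0 (mxvec_index i k) - u i 0) by apply/funext => v; rewrite !mxE.
    by move=> v; apply: continuousB; [exact: coord_continuous|exact: cst_continuous].
  by apply: continuous_sumR => i v; apply: continuousM; exact: ci.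
(* Squared norms are continuous in the entries, so this form exhibits [A] as closed. *)
have AE : A = (\bigcap_(k in [set: 'I_K])
    ((fun v : 'rV[R]_(d * K) => dotv (col k (vec_mx v) - 0) (col k (vec_mx v) - 0)) @^-1` [set x | x = 1]
    `&` (fun v : 'rV[R]_(d * K) => dotv (col k (vec_mx v) - col k Phi) (col k (vec_mx v) - col k Phi))
       @^-1` [set x | x <= r ^+ 2])).
  apply/seteqP; split => v /=.
    move=> [v1 vr] k _; split => /=; first by rewrite subr0 -vnorm_sqr v1 expr1n.
    by rewrite -vnorm_sqr ler_sqr ?nnegrE ?vnorm_ge0 ?(ltW r0).
  move=> vA; split => k; have [/= v1 vr] := vA k Logic.I.
    move: v1; rewrite subr0 -vnorm_sqr => /eqP; rewrite sqrf_eq1 => /orP[/eqP //|/eqP v1].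
    by have := vnorm_ge0 (col k (vec_mx v)); rewrite v1 oppr_ge0 ler10.
  by rewrite -ler_sqr ?nnegrE ?vnorm_ge0 ?(ltW r0) // vnorm_sqr.
have clA : closed A.
  rewrite AE; apply: closed_bigI => k _; apply: closedI; apply: closed_preim.
  - exact: cdist.
  - exact: closed_eq.
  - exact: cdist.
  - exact: closed_le.
have bA : bounded_set A.
  apply: (@rV_bounded _ _ 1) => // v [v1 _] l; case/mxvec_indexP: l => i k.
  have := ler_coord_vnorm (col k (vec_mx v)) i; rewrite v1.
  by rewrite !mxE.
have cA : compact A by exact: bounded_closed_compact.
have ballPhi : ball Phi by split => // k; rewrite subrr vnorm0 ltW.
have A0 : A !=set0 by exists (mxvec Phi); rewrite /A /= mxvecK.
have cF : {within A, continuous (F \o vec_mx)}.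
  apply/subspace_continuousP => v Av; apply/cvgrPdist_le => e e0.
  (* [L + 1] and [d.+1] keep the denominator positive; an entrywise distance [c] moves a column by
     at most [d * c]. *)
  pose c := e / ((L + 1) * d.+1%:R).
  have L1 : 0 < L + 1 by rewrite ltr_wpDl.
  have c0 : 0 < c by rewrite divr_gt0 // mulr_gt0.
  have key u : A u -> `|v - u| <= c -> `|F (vec_mx v) - F (vec_mx u)| <= e.
    move=> Au uv.
    have de k : vnorm (col k (vec_mx v) - col k (vec_mx u)) <= d%:R * c.
      apply: vnorm_le_entries; first exact: ltW.
      move=> i; have := rV_norm_coord (v - u) (mxvec_index i k).
      by rewrite !mxE => /le_trans; apply.
    have dc0 : 0 <= d%:R * c by rewrite mulr_ge0 // ltW.
    have bound : L * (d%:R * c) <= e.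
      have -> : e = (L + 1) * (d.+1%:R * c) by rewrite /c; field; rewrite !gt_eqF // ltr0n.
      rewrite ler_pM // ?lerDl // ler_wpM2r ?ler_nat // ltW //.
    have h1 := Flip Av Au dc0 de; have h2 : F (vec_mx u) <= F (vec_mx v) + L * (d%:R * c).
      by apply: Flip => // k; rewrite vnormBC.
    by rewrite ler_norml; apply/andP; split; lra.
  apply/nbhs_ballP; exists c => // u; rewrite -ball_normE /= => uv Au.
  by apply: key => //; exact: ltW.
have [v Av vmax] := compact_EVT_max A0 cA cF.
rewrite inE in Av.
have FPhi : F Phi <= F (vec_mx v).
  by have := vmax (mxvec Phi); rewrite inE /A /= mxvecK => /(_ ballPhi).
pose rho := dict_dist (vec_mx v) Phi.
have rho_r : rho < r.
  apply/bigmax_ltP; split => // k _.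
  have [_ /(_ k)] := Av; rewrite le_eqVlt => /orP[/eqP E|//].
  by have := le_lt_trans FPhi (Fboundary Av E); rewrite ltxx.
exists (vec_mx v); split; last by exact: ltW.
split; first by case: Av.
(* By the triangle inequality, dictionaries this close to the maximizer are still in the ball. *)
exists (r - rho); first by rewrite subr_gt0.
move=> Psi' Psi'1 near_v; have := vmax (mxvec Psi'); rewrite inE /A /= mxvecK; apply.
split => // k.
have -> : col k Psi' - col k Phi = (col k Psi' - col k (vec_mx v)) + (col k (vec_mx v) - col k Phi).
  by rewrite addrA subrK.
apply: le_trans (vnormD _ _) _.
have h1 := le_dict_dist Psi' (vec_mx v) k; have h2 := le_dict_dist (vec_mx v) Phi k.
rewrite -/rho in h2; lra.
Qed.

End LocalMaximum.

End CompactnessArguments.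

(** * Numerical consequences of the assumption on [eps] *)

Section Numerics.
Variable R : realType.
Variables (N d K S : nat) (eps kappa B A lambda L : R).
Hypothesis SK : (0 < S < K)%N.
Hypothesis d0 : (0 < d)%N.
Hypothesis Sd : (S <= d)%N.
Hypothesis AE : A = K%:R / d%:R.
Hypothesis A1 : 1 <= A.
Hypothesis kappa0 : 0 < kappa.
Hypothesis kappaS : 2 * kappa * Num.sqrt S%:R <= 1.
Hypothesis lambda0 : 0 < lambda.
Hypothesis lambdaS : lambda * S%:R <= 1.
Hypothesis B0 : 0 < B.
Hypothesis B1 : B <= 1.
Hypothesis LE : L = ln (5 * A * K%:R ^+ S / lambda).
Hypothesis eps0 : 0 < eps.
Hypothesis epsle : eps <= kappa ^+ 2 * B / (68 * Num.sqrt S%:R * L).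

Let sg : R := Num.sqrt S%:R.

Let S1 : 1 <= S%:R :> R. Proof. by rewrite ler1n; case/andP: SK. Qed.
Let K2 : 2 <= K%:R :> R. Proof. by rewrite ler_nat; case/andP: SK => s k; apply: leq_trans k; rewrite ltnS. Qed.
Let K0 : 0 < K%:R :> R. Proof. by apply: lt_le_trans K2. Qed.
Let SKR : S%:R <= K%:R :> R. Proof. by rewrite ler_nat; case/andP: SK => _ /ltnW. Qed.
Let d1 : 1 <= d%:R :> R. Proof. by rewrite ler1n. Qed.
Let dR0 : 0 < d%:R :> R. Proof. exact: lt_le_trans d1. Qed.
Let A0 : 0 < A. Proof. exact: lt_le_trans A1. Qed.
Let dK : d%:R <= K%:R :> R. Proof. by have := A1; rewrite AE ler_pdivlMr // mul1r. Qed.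
Let sg2 : sg ^+ 2 = S%:R. Proof. by rewrite sqr_sqrtr. Qed.
Let sg1 : 1 <= sg.
Proof. by rewrite -(ler_sqr) ?nnegrE ?sqrtr_ge0 // expr1n sg2. Qed.
Let sg0 : 0 < sg. Proof. exact: lt_le_trans sg1. Qed.
Let kappa12 : 2 * kappa <= 1.
Proof. by apply: le_trans kappaS; rewrite ler_peMr // mulr_ge0 // ltW. Qed.
Let lambda1 : lambda <= 1.
Proof. by apply: le_trans lambdaS; rewrite ler_peMr // ltW. Qed.
Let k : R := K%:R ^+ S.
Let kK : K%:R <= k.
Proof.
rewrite /k -{1}(expr1 K%:R); apply: ler_weXn2l; first by apply: le_trans K2; rewrite ler1n.
by case/andP: SK.
Qed.
Let k0 : 0 < k. Proof. by rewrite exprn_gt0. Qed.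
Let Xk : 0 < 5 * A * k / lambda.
Proof. by rewrite divr_gt0 // !mulr_gt0. Qed.
Let expL : expR L = 5 * A * k / lambda.
Proof. by rewrite LE lnK // posrE. Qed.

(** [K^S >= 2^S >= e^(S / 2)], and the factor 5 covers [e]. *)
Lemma L_ge : S%:R / 2 + 1 <= L.
Proof.
have half : expR (2^-1 : R) <= 2.
  have := expR_ge1Dx (- 2^-1 : R); have e0 := expR_gt0 (2^-1 : R) => h.
  have h2 : expR 2^-1 * (1 - 2^-1) <= 1 :> R.
    by rewrite -[leRHS](expRxMexpNx_1 (2^-1 : R)) ler_wpM2l // ltW.
  lra.
rewrite -ler_expR expL expRD.
have e1 : expR 1 <= 4 :> R.
  have -> : expR 1 = expR 2^-1 ^+ 2 :> R by rewrite -expRM_natl; congr expR; field.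
  have -> : 4 = 2 ^+ 2 :> R by ring.
  by rewrite ler_sqr ?nnegrE ?expR_ge0.
have eS : expR (S%:R / 2) <= k.
  apply: (@le_trans _ _ (2 ^+ S)).
    by rewrite mulrC expRM_natr; apply: lerXn2r => //; rewrite nnegrE ?expR_ge0.
  by apply: lerXn2r; rewrite ?nnegrE // ltW.
apply: (@le_trans _ _ (k * 4)); first by rewrite ler_pM ?expR_ge0.
rewrite ler_pdivlMr //; have : k * 4 * lambda <= k * 4 * 1 by rewrite ler_wpM2l // mulr_ge0 // ltW.
have : k * 1 <= k * A by rewrite ler_wpM2l // ltW.
have := k0; lra.
Qed.

Let L32 : 3 / 2 <= L. Proof. by have := L_ge; have := S1; lra. Qed.
Let L1 : 1 <= L. Proof. by have := L32; lra. Qed.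
Let L0 : 0 < L. Proof. by apply: lt_le_trans L32; rewrite divr_gt0. Qed.

Let epsL : 68 * (eps * sg * L) <= kappa ^+ 2 * B.
Proof.
have := epsle; rewrite ler_pdivlMr; last by rewrite !mulr_gt0.
by rewrite -/sg; congr (_ <= _); ring.
Qed.

Let k2 : kappa ^+ 2 <= kappa / 2.
Proof. by have := kappa12; have := kappa0; nra. Qed.

Let es0 : 0 < eps * sg. Proof. by rewrite mulr_gt0. Qed.

Let k2B : kappa ^+ 2 * B <= kappa ^+ 2.
Proof. by rewrite ler_piMr // sqr_ge0. Qed.

(** 102 is 68 times the lower bound 3/2 for [L]. *)
Lemma num_es : 102 * (eps * sg) <= kappa ^+ 2.
Proof.
apply: le_trans k2B; apply: le_trans epsL.
have : eps * sg * (3 / 2) <= eps * sg * L by rewrite ler_wpM2l // ltW.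
lra.
Qed.

(** [near_coord_low] adds up [S + 1] coefficients; the full factor [S] comes from [L_ge]. *)
Lemma num_coord : 2 * (S.+1%:R * (2 * eps)) <= 2 * kappa * sg.
Proof.
have h : 68 * (eps * sg * L) <= kappa / 2 by apply: le_trans epsL (le_trans k2B k2).
have h2 : 68 * (eps * sg * (S%:R / 2 + 1)) <= kappa / 2.
  by apply: le_trans h; rewrite ler_wpM2l // ler_wpM2l ?L_ge // ltW.
rewrite -natr1.
have e1 : eps * (S%:R / 2 + 1) <= eps * sg * (S%:R / 2 + 1).
  rewrite ler_wpM2r ?ler_peMr ?(ltW eps0) //; have := S1; lra.
have : kappa * 1 <= kappa * sg by rewrite ler_wpM2l // ltW.
have : 0 < eps * S%:R by rewrite mulr_gt0 // (lt_le_trans _ S1).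
have := eps0; lra.
Qed.

Lemma num_low : 2 * (2 * eps * sg) <= 2 * kappa.
Proof. have := num_es; have := es0; have := k2; lra. Qed.

Lemma num_lowB : 2 * (2 * eps * sg) <= Num.sqrt B.
Proof.
have sB : B <= Num.sqrt B.
  have s1 : Num.sqrt B <= 1 by rewrite -sqrtr1 ler_sqrt.
  by rewrite -{1}(sqr_sqrtr (ltW B0)) expr2 ler_piMl ?sqrtr_ge0.
apply: le_trans sB.
have : 68 * (eps * sg * (3 / 2)) <= 68 * (eps * sg * L) by rewrite ler_wpM2l // ler_wpM2l // ltW.
have : kappa ^+ 2 * B <= 1 / 4 * B.
  by rewrite ler_wpM2r ?(ltW B0) //; have := kappa12; have := k2; lra.
have := epsL; have := es0; have := B0; lra.
Qed.

Lemma eps_half : eps <= 2^-1.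
Proof.
have : eps * 1 <= eps * sg by rewrite ler_wpM2l // ltW.
have := num_es; have := k2; have := kappa12; lra.
Qed.

Let ek1 : eps * kappa <= 1.
Proof. by have := eps_half; have := kappa12; have := eps0; have := kappa0; nra. Qed.

Let ek3 : eps * kappa ^+ 3 <= 1.
Proof.
have h3 : kappa ^+ 3 <= 1 by rewrite exprn_ile1 ?(ltW kappa0) //; have := kappa12; have := kappa0; lra.
have h0 : 0 <= kappa ^+ 3 by rewrite exprn_ge0 // ltW.
by move: h3 h0; have := eps_half; have := eps0; nra.
Qed.

Let rho := 2 * eps * sg / (Num.sqrt B / 2).
(** Chosen so that [theta * A / kappa^2] equals [lambda / 4]. *)
Let theta := lambda * kappa ^+ 2 / (4 * A).
(** For [r = 2 eps] and [eps <= 1/2], the factor [r^2 - r^4 / 4] of [sum_resid_low] is at least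
    [3 eps^2]. *)
Let Gmin := 3 * eps ^+ 2 * kappa ^+ 2 / K%:R.

Let sB0 : 0 < Num.sqrt B. Proof. by rewrite sqrtr_gt0. Qed.

Lemma num_rho0 : 0 < rho.
Proof. by rewrite divr_gt0 // ?divr_gt0 // !mulr_gt0. Qed.

Lemma num_theta0 : 0 < theta.
Proof. by rewrite divr_gt0 ?mulr_gt0 ?exprn_gt0. Qed.

Let thetaAE : theta * A = lambda * kappa ^+ 2 / 4.
Proof. by rewrite /theta; field; rewrite gt_eqF. Qed.

Let thetaA16 : theta * A <= 16^-1.
Proof.
rewrite thetaAE; have : lambda * kappa ^+ 2 <= 1 * kappa ^+ 2 by rewrite ler_wpM2r ?sqr_ge0.
have := k2; have := kappa12; lra.
Qed.

Lemma num_thetaA : theta * A <= 3^-1.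
Proof. have := thetaA16; lra. Qed.

Lemma num_theta_var : theta * A / kappa ^+ 2 <= lambda / 4.
Proof. by rewrite thetaAE le_eqVlt; apply/orP; left; apply/eqP; field; rewrite gt_eqF. Qed.

Lemma num_Gmin0 : 0 < Gmin.
Proof. by rewrite divr_gt0 // !mulr_gt0 // exprn_gt0. Qed.

(** The large parameter: the exponent of [bad_rate] is quadratic in [y], and the assumption on [eps]
    trades one factor [y] for [L]. *)
Let y := (eps * sg)^-1.
Let y0 : 0 < y. Proof. by rewrite invr_gt0. Qed.

Let yL : 272 * L <= y.
Proof.
suff : 272 * L * (eps * sg) <= 1 by rewrite -ler_pdivlMr ?div1r.
have : kappa ^+ 2 * B <= 1 / 4 by have := k2B; have := k2; have := kappa12; lra.
have := epsL; lra.
Qed.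

Let exponent : 68 / 192 * (L * y) <= kappa ^+ 2 / (12 * rho ^+ 2).
Proof.
have -> : kappa ^+ 2 / (12 * rho ^+ 2) = kappa ^+ 2 * B / 192 * (y * y).
  rewrite /rho /y -{2}(sqr_sqrtr (ltW B0)); field.
  by rewrite !gt_eqF.
have : 68 * (eps * sg * L) * (y * y) <= kappa ^+ 2 * B * (y * y).
  by rewrite ler_wpM2r // mulr_ge0 // ltW.
have -> : 68 * (eps * sg * L) * (y * y) = 68 * (L * y) by rewrite /y; field; rewrite !gt_eqF.
lra.
Qed.

(** With the rate 1/40 the constant [40^3] is below [2^16], hence below [e^16]. *)
Let y3 : y ^+ 3 <= expR (16 + 3 * (y / 40)).
Proof.
rewrite expRD.
have h1 : y <= 40 * expR (y / 40) by have := expR_ge1Dx (y / 40); lra.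
have h2 : y ^+ 3 <= (40 * expR (y / 40)) ^+ 3.
  by apply: lerXn2r => //; rewrite nnegrE ?mulr_ge0 ?expR_ge0 // ltW.
apply: le_trans h2 _; rewrite exprMn -expRM_natl ler_wpM2r ?expR_ge0 //.
have e2 : 2 <= expR 1 :> R by have := expR_ge1Dx (1 : R); lra.
have -> : expR 16 = expR 1 ^+ 16 :> R by rewrite -expRM_natl mulr1.
apply: (@le_trans _ _ (2 ^+ 16)); first by lra.
by apply: lerXn2r; rewrite ?nnegrE ?expR_ge0.
Qed.

Let Sk : S%:R <= k.
Proof. exact: le_trans SKR kK. Qed.

Let kX : k <= expR L.
Proof.
rewrite expL ler_pdivlMr //; have : k * lambda <= k * 1 by rewrite ler_wpM2l // ltW.
have : k * 1 <= k * A by rewrite ler_wpM2l // ltW.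
have := k0; lra.
Qed.

(** One factor [kappa^2] is traded for [eps], so the target becomes [eps^3 = (y * sg)^-3]. Here
    [sg^3] is at most [expR L ^+ 2], and the exponent, of order [L * y] with [y >= 272 L], absorbs
    all powers of [expR L] and [y^3]. *)
Let main_exp : expR L ^+ 4 * expR (- (kappa ^+ 2 / (12 * rho ^+ 2))) <= eps ^+ 2 * kappa ^+ 2.
Proof.
have ek : eps <= kappa ^+ 2.
  have : eps * 1 <= eps * sg by rewrite ler_wpM2l // ltW.
  have := num_es; have := eps0; lra.
apply: (@le_trans _ _ (eps ^+ 3)); last first.
  by rewrite (exprSr _ 2) ler_wpM2l ?sqr_ge0.
have -> : eps ^+ 3 = (y ^+ 3 * sg ^+ 3)^-1 by rewrite /y; field; rewrite !gt_eqF.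
have sg3 : sg ^+ 3 <= expR L ^+ 2.
  apply: (@le_trans _ _ (S%:R ^+ 2)).
    by rewrite -sg2 -exprM; apply: ler_weXn2l.
  by apply: lerXn2r; rewrite ?nnegrE ?expR_ge0 // (le_trans Sk).
have p0 : 0 < y ^+ 3 * sg ^+ 3 by rewrite mulr_gt0 // exprn_gt0.
rewrite -[leRHS]mul1r ler_pdivlMr //.
apply: (@le_trans _ _ (expR L ^+ 4 * expR (- (kappa ^+ 2 / (12 * rho ^+ 2)))
     * (expR (16 + 3 * (y / 40)) * expR L ^+ 2))).
  rewrite ler_wpM2l ?mulr_ge0 ?exprn_ge0 ?expR_ge0 //.
  by apply: ler_pM => //; rewrite exprn_ge0 // ltW.
rewrite -!expRM_natl -!expRD -[leRHS]expR0 ler_expR.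
have : y * (3 / 2) <= y * L by rewrite ler_wpM2l // ltW.
have := exponent; have := yL; have := L32; lra.
Qed.

(** With [K + 1 <= K^2] and [d <= K <= k], the prefactors combine to a multiple of [A k^4 / lambda],
    and [expR L ^+ 4] is at least [5^4] times this quantity. *)
Lemma num_bad : A * (2 + theta * A) * bad_rate d K S kappa rho <= lambda / 4 * Gmin.
Proof.
rewrite /bad_rate; set e := expR (- _).
have e0 : 0 < e by exact: expR_gt0.
have KS1 : K.+1%:R ^+ S <= k ^+ 2.
  rewrite /k -exprM mulnC exprM; apply: lerXn2r; rewrite ?nnegrE ?exprn_ge0 // ?(ltW K0) //.
  by rewrite -natr1; have := K2; nra.
have c1 : A * (2 + theta * A) * (K.+1%:R ^+ S * (2 * d%:R * e)) <= A * (33 / 16) * (k ^+ 2 * (2 * k * e)).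
  have t0 := num_theta0; have tA : 0 < theta * A by rewrite mulr_gt0.
  apply: ler_pM.
  - by rewrite mulr_ge0 ?(ltW A0) //; lra.
  - by rewrite !mulr_ge0 ?exprn_ge0 // ltW.
  - by rewrite ler_wpM2l ?(ltW A0) //; have := thetaA16; lra.
  - apply: ler_pM => //; rewrite ?exprn_ge0 ?mulr_ge0 ?(ltW e0) //.
    by rewrite ler_wpM2r ?(ltW e0) // ler_wpM2l // (le_trans dK kK).
apply: le_trans c1 _.
have c2 : A * k ^+ 4 / lambda * 625 <= expR L ^+ 4.
  have -> : expR L ^+ 4 = A * k ^+ 4 / lambda * 625 * (A ^+ 3 * lambda ^- 3).
    by rewrite expL; field; rewrite gt_eqF.
  have u0 : 0 <= A * k ^+ 4 / lambda by rewrite !mulr_ge0 ?exprn_ge0 ?invr_ge0 // ltW.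
  have a3 : 1 <= A ^+ 3 by rewrite exprn_ege1.
  have l3 : 1 <= lambda ^- 3 by rewrite invf_ge1 ?exprn_gt0 // exprn_ile1 // ltW.
  have al : 1 <= A ^+ 3 * lambda ^- 3 by rewrite -[1]mulr1 ler_pM.
  move: (A * k ^+ 4 / lambda) (A ^+ 3 * lambda ^- 3) u0 al => u v u0 v1.
  have : u * 1 <= u * v by rewrite ler_wpM2l.
  lra.
have c3 : A * k ^+ 4 / lambda * 625 * e <= eps ^+ 2 * kappa ^+ 2.
  by apply: le_trans main_exp; rewrite ler_wpM2r // ltW.
have -> : lambda / 4 * Gmin = 3 / 4 * lambda * (eps ^+ 2 * kappa ^+ 2) / K%:R by rewrite /Gmin; field; rewrite gt_eqF.
rewrite ler_pdivlMr //.
apply: (@le_trans _ _ (3 / 4 * lambda * (A * k ^+ 4 / lambda * 625 * e))); last first.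
  by rewrite ler_wpM2l // mulr_ge0 // ltW.
have -> : 3 / 4 * lambda * (A * k ^+ 4 / lambda * 625 * e) = A * k ^+ 3 * e * k * (1875 / 4).
  by field; rewrite gt_eqF.
have -> : A * (33 / 16) * (k ^+ 2 * (2 * k * e)) * K%:R = A * k ^+ 3 * e * K%:R * (33 / 8) by field.
apply: ler_pM; rewrite ?mulr_ge0 ?exprn_ge0 ?(ltW A0) ?(ltW k0) ?(ltW e0) //; last lra.
by rewrite ler_wpM2l // !mulr_ge0 ?exprn_ge0 // ltW.
Qed.

Let CS := (1 - S%:R / (d%:R * B)) ^+ 2.

(** [CS] may be large for small [B]; [B^2] clears its denominator, and [S <= d] keeps [B - S / d]
    within [[-1, 1]]. *)
Let B2CS : B ^+ 2 * CS <= 1.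
Proof.
have -> : B ^+ 2 * CS = (B - S%:R / d%:R) ^+ 2 by rewrite /CS; field; rewrite !gt_eqF.
have s0 : 0 <= S%:R / d%:R :> R by rewrite divr_ge0.
have s1 : S%:R / d%:R <= 1 :> R by rewrite ler_pdivrMr // mul1r ler_nat.
rewrite -(expr1n R 2) -real_normK ?num_real // ler_sqr ?nnegrE //.
by rewrite ler_norml; apply/andP; split; have := B0; have := B1; lra.
Qed.

Let eps2 : 4624 * (eps ^+ 2 * S%:R * L ^+ 2) <= kappa ^+ 4 * B ^+ 2.
Proof.
have -> : kappa ^+ 4 * B ^+ 2 = (kappa ^+ 2 * B) ^+ 2 by ring.
have -> : 4624 * (eps ^+ 2 * S%:R * L ^+ 2) = (68 * (eps * sg * L)) ^+ 2 by rewrite -sg2; ring.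
by rewrite ler_sqr ?nnegrE ?mulr_ge0 ?sqr_ge0 // ltW.
Qed.

(** The rate obtained is quadratic in [eps], the stated one quartic. What remains is
    [eps^2 S^2 CS <= 3/4 kappa^4 K], from the squared assumption on [eps], [B2CS] and [S <= K]. *)
Lemma num_exponent :
  N%:R * eps ^+ 4 * lambda ^+ 2 * S%:R ^+ 2 * CS / (4 * K%:R ^+ 2 * A)
    <= N%:R * (theta * lambda * Gmin / 4).
Proof.
have -> : N%:R * (theta * lambda * Gmin / 4) =
   N%:R * eps ^+ 2 * lambda ^+ 2 / (4 * K%:R ^+ 2 * A) * (3 / 4 * kappa ^+ 4 * K%:R).
  by rewrite /theta /Gmin; field; rewrite !gt_eqF.
have -> : N%:R * eps ^+ 4 * lambda ^+ 2 * S%:R ^+ 2 * CS / (4 * K%:R ^+ 2 * A) =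
   N%:R * eps ^+ 2 * lambda ^+ 2 / (4 * K%:R ^+ 2 * A) * (eps ^+ 2 * S%:R ^+ 2 * CS).
  by field; rewrite !gt_eqF.
rewrite ler_wpM2l //; first by rewrite !mulr_ge0 ?invr_ge0 ?mulr_ge0 ?sqr_ge0 // ltW.
have CS0 : 0 <= CS by exact: sqr_ge0.
have h1 : 4624 * (eps ^+ 2 * S%:R * L ^+ 2) * CS <= kappa ^+ 4.
  apply: (@le_trans _ _ (kappa ^+ 4 * B ^+ 2 * CS)); first by rewrite ler_wpM2r.
  by rewrite -mulrA ler_piMr // exprn_ge0 // ltW.
have h2 : eps ^+ 2 * S%:R * CS * 1 <= eps ^+ 2 * S%:R * CS * L ^+ 2.
  apply: ler_wpM2l; first by rewrite mulr_ge0 // mulr_ge0 ?sqr_ge0.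
  by rewrite exprn_ege1 ?L1.
have h3 : eps ^+ 2 * S%:R * CS <= kappa ^+ 4 / 4624 by lra.
have -> : eps ^+ 2 * S%:R ^+ 2 * CS = eps ^+ 2 * S%:R * CS * S%:R by ring.
apply: (@le_trans _ _ (kappa ^+ 4 / 4624 * K%:R)).
  by apply: ler_pM => //; rewrite mulr_ge0 // mulr_ge0 ?sqr_ge0.
rewrite ler_wpM2r ?(ltW K0) //; have : 0 <= kappa ^+ 4 by rewrite exprn_ge0 // ltW.
lra.
Qed.

Let tau := lambda * Gmin / 8.
(** Entries within [h] keep columns within [sqrt d * h], and the mean score has Lipschitz constant
    [A * sqrt S / kappa]. *)
Let h := tau * kappa / (A * Num.sqrt (S%:R * d%:R)).

Lemma num_h0 : 0 < h.
Proof.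
by rewrite /h /tau divr_gt0 // ?mulr_gt0 ?num_Gmin0 ?sqrtr_gt0 ?mulr_gt0 ?invr_gt0 // (lt_le_trans _ S1).
Qed.

Hypothesis N2 : (1 < N)%N.

(** As [ln Q >= 1], a rate above the entropy term bounds [N] below by a multiple of
    [1 / (eps^2 kappa^4)]; then [Q] cells of width [h] cover the range [4 eps] of an entry. *)
Lemma num_net :
    K%:R * d%:R * ln (N%:R * K%:R * A / (lambda * S%:R))
      < N%:R * eps ^+ 4 * lambda ^+ 2 * S%:R ^+ 2 * CS / (4 * K%:R ^+ 2 * A) ->
  2 * (2 * eps) / h + 1 <= N%:R * K%:R * A / (lambda * S%:R).
Proof.
set Q := N%:R * K%:R * A / (lambda * S%:R) => ineq.
have N0 : 2 <= N%:R :> R by rewrite ler_nat.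
have S0 : 0 < S%:R :> R by exact: lt_le_trans S1.
have lS0 : 0 < lambda * S%:R by rewrite mulr_gt0.
have Q4 : 4 <= Q.
  rewrite /Q ler_pdivlMr //; apply: (@le_trans _ _ (2 * 2 * 1)); first by have := lambdaS; lra.
  by rewrite !ler_pM.
have lnQ : 1 <= ln Q.
  rewrite -(expRK 1) ler_ln ?posrE ?expR_gt0 //; last by lra.
  apply: le_trans Q4.
  have := expR_ge1Dx (- 2^-1 : R) => hh.
  have e0 := expR_gt0 (2^-1 : R).
  have h2 : expR 2^-1 * (1 - 2^-1) <= 1 :> R.
    by rewrite -[leRHS](expRxMexpNx_1 (2^-1 : R)) ler_wpM2l // ltW.
  have -> : expR 1 = expR 2^-1 ^+ 2 :> R by rewrite -expRM_natl; congr expR; field.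
  have -> : 4 = 2 ^+ 2 :> R by ring.
  by rewrite ler_sqr ?nnegrE ?(ltW e0) //; lra.
have Kd0 : 0 < K%:R * d%:R :> R by rewrite mulr_gt0.
have {}ineq : 4 * K%:R ^+ 3 * d%:R * A <= N%:R * eps ^+ 4 * (lambda * S%:R) ^+ 2 * CS.
  have i1 : K%:R * d%:R * 1 <= N%:R * eps ^+ 4 * lambda ^+ 2 * S%:R ^+ 2 * CS / (4 * K%:R ^+ 2 * A).
    by apply/ltW/le_lt_trans/ineq; rewrite ler_wpM2l // ltW.
  rewrite ler_pdivlMr in i1; last by rewrite !mulr_gt0 ?exprn_gt0.
  have -> : 4 * K%:R ^+ 3 * d%:R * A = K%:R * d%:R * 1 * (4 * K%:R ^+ 2 * A) by ring.
  by apply: le_trans i1 _; rewrite le_eqVlt; apply/orP; left; apply/eqP; ring.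
have i2 : 4 * K%:R ^+ 3 * d%:R * A <= N%:R * eps ^+ 4 * CS.
  apply: le_trans ineq _; rewrite ler_wpM2r ?sqr_ge0 // ler_piMr ?mulr_ge0 ?exprn_ge0 ?(ltW eps0) //.
  by rewrite exprn_ile1 // ltW.
have i3 : 4 * K%:R ^+ 3 * d%:R * A * B ^+ 2 <= N%:R * eps ^+ 4.
  apply: le_trans (ler_wpM2r (sqr_ge0 B) i2) _.
  have -> : N%:R * eps ^+ 4 * CS * B ^+ 2 = N%:R * eps ^+ 4 * (B ^+ 2 * CS) by ring.
  by rewrite ler_piMr // mulr_ge0 ?exprn_ge0 // ltW.
have i4 : 4 * K%:R ^+ 3 * d%:R * A * (4624 * (eps ^+ 2 * S%:R * L ^+ 2)) <= N%:R * eps ^+ 4 * kappa ^+ 4.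
  apply: (@le_trans _ _ (4 * K%:R ^+ 3 * d%:R * A * (kappa ^+ 4 * B ^+ 2))).
    by rewrite ler_wpM2l // !mulr_ge0 ?exprn_ge0 // ltW.
  have -> : 4 * K%:R ^+ 3 * d%:R * A * (kappa ^+ 4 * B ^+ 2) = 4 * K%:R ^+ 3 * d%:R * A * B ^+ 2 * kappa ^+ 4 by ring.
  by rewrite ler_wpM2r // exprn_ge0 // ltW.
have e2 : 0 < eps ^+ 2 by rewrite exprn_gt0.
have i5 : 18496 * (K%:R ^+ 3 * d%:R * A * S%:R * L ^+ 2) <= N%:R * eps ^+ 2 * kappa ^+ 4.
  rewrite -(ler_pM2r e2).
  have -> : 18496 * (K%:R ^+ 3 * d%:R * A * S%:R * L ^+ 2) * eps ^+ 2 =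
     4 * K%:R ^+ 3 * d%:R * A * (4624 * (eps ^+ 2 * S%:R * L ^+ 2)) by ring.
  by apply: le_trans i4 _; rewrite le_eqVlt; apply/orP; left; apply/eqP; ring.
have SdL : S%:R * S%:R * d%:R <= K%:R ^+ 3 * d%:R * A * S%:R * L ^+ 2.
  have l2 : 1 <= L ^+ 2 by rewrite exprn_ege1 ?L1.
  have k2' : S%:R <= K%:R ^+ 3 :> R.
    apply: le_trans SKR _; rewrite -{1}(expr1 K%:R); apply: ler_weXn2l => //.
    by apply: le_trans K2; rewrite ler1n.
  rewrite -[leLHS]mulr1; apply: ler_pM => //; rewrite ?mulr_ge0 //.
  have -> : K%:R ^+ 3 * d%:R * A * S%:R = K%:R ^+ 3 * S%:R * d%:R * A by ring.
  by rewrite -[leLHS]mulr1; apply: ler_pM => //; rewrite ?mulr_ge0 // !ler_wpM2r.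
have i6 : 18496 * (S%:R * S%:R * d%:R) <= N%:R * eps ^+ 2 * kappa ^+ 4.
  apply: le_trans i5; move: (S%:R * S%:R * d%:R) (K%:R ^+ 3 * d%:R * A * S%:R * L ^+ 2) SdL => u v.
  lra.
pose q : R := Num.sqrt (S%:R * d%:R).
have q1 : q <= S%:R * d%:R.
  have Sd1 : 1 <= S%:R * d%:R :> R by rewrite -[leLHS]mulr1 ler_pM.
  rewrite -ler_sqr ?nnegrE ?sqrtr_ge0 ?mulr_ge0 // sqr_sqrtr ?mulr_ge0 //.
  by rewrite expr2 ler_peMr // mulr_ge0.
have q0 : 0 < q by rewrite sqrtr_gt0 mulr_gt0.
have -> : 2 * (2 * eps) / h = 32 / 3 * (q / (eps * kappa ^+ 3)) * (K%:R * A / lambda).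
  by rewrite /h /tau /Gmin -/q; field; rewrite !gt_eqF.
have -> : Q = N%:R / S%:R * (K%:R * A / lambda) by rewrite /Q; field; rewrite !gt_eqF.
have KAl : 1 <= K%:R * A / lambda.
  rewrite ler_pdivlMr // mul1r; apply: le_trans lambda1 _.
  by rewrite -[leLHS]mulr1 ler_pM //; apply: le_trans K2; rewrite ler1n.
have ek30 : 0 < eps * kappa ^+ 3 by rewrite mulr_gt0 ?exprn_gt0.
suff main : 32 / 3 * (q / (eps * kappa ^+ 3)) + 1 <= N%:R / S%:R.
  apply: le_trans (ler_wpM2r (ltW (lt_le_trans ltr01 KAl)) main).
  by rewrite [leRHS]mulrDl [1 * _]mul1r lerD2l.
have ek4 : eps ^+ 2 * kappa ^+ 4 <= eps * kappa ^+ 3.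
  have -> : eps ^+ 2 * kappa ^+ 4 = eps * kappa ^+ 3 * (eps * kappa) by ring.
  by rewrite ler_piMr // ltW.
rewrite ler_pdivlMr //.
have i7 : 18496 * (S%:R * S%:R * d%:R) <= N%:R * (eps * kappa ^+ 3).
  by apply: le_trans i6 _; rewrite -mulrA; apply: ler_wpM2l ek4.
rewrite -(ler_pM2r ek30).
have -> : (32 / 3 * (q / (eps * kappa ^+ 3)) + 1) * S%:R * (eps * kappa ^+ 3) =
   32 / 3 * (q * S%:R) + S%:R * (eps * kappa ^+ 3) by field; rewrite !gt_eqF.
apply: le_trans i7.
have j1 : q * S%:R <= S%:R * S%:R * d%:R.
  have -> : S%:R * S%:R * d%:R = S%:R * d%:R * S%:R :> R by ring.
  by rewrite ler_wpM2r.
have j2 : S%:R * (eps * kappa ^+ 3) <= S%:R by rewrite ler_piMr.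
have j3 : S%:R <= S%:R * S%:R * d%:R :> R.
  by rewrite -mulrA ler_peMr // -[leLHS]mulr1 ler_pM.
clear ineq i2 i3 i4 i5 i6 SdL; lra.
Qed.

End Numerics.

(** * Uniform bounds for dictionaries near [Phi] *)

Section Ball.
Variable R : realType.
Variables (d K S : nat) (Phi : 'M[R]_(d, K)) (kappa r s : R).
Implicit Types (Psi : 'M[R]_(d, K)) (I J : {set 'I_K}) (a : 'cV[R]_K).

Hypothesis Phi1 : dictionary Phi.
Hypothesis SK : (0 < S < K)%N.
Hypothesis kappa0 : 0 < kappa.
Hypothesis kappaS : 2 * kappa * Num.sqrt S%:R <= 1.
Hypothesis r0 : 0 < r.
Hypothesis s0 : 0 < s.
Hypothesis low : forall I a, (#|I| <= S)%N -> supp_in I a ->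
  2 * kappa * vnorm a <= vnorm (Phi *m a).
Hypothesis lows : forall I a, (#|I| <= S)%N -> supp_in I a -> s * vnorm a <= vnorm (Phi *m a).
Hypothesis coord_low : forall J a k, (#|J| <= S.+1)%N -> supp_in J a ->
  2 * kappa * Num.sqrt S%:R * `|a k 0| <= vnorm (Phi *m a).
Hypothesis r_kappa : 2 * (r * Num.sqrt S%:R) <= 2 * kappa.
Hypothesis r_s : 2 * (r * Num.sqrt S%:R) <= s.
Hypothesis r_coord : 2 * (S.+1%:R * r) <= 2 * kappa * Num.sqrt S%:R.

Let sg0 : 0 < Num.sqrt S%:R :> R. Proof. by rewrite sqrtr_gt0 ltr0n; case/andP: SK. Qed.

Definition in_ball Psi := forall k, vnorm (col k Psi - col k Phi) <= r.

Let in_ballC Psi : in_ball Psi -> forall k, vnorm (col k Phi - col k Psi) <= r.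
Proof. by move=> near k; rewrite vnormBC. Qed.

(** With [s = Num.sqrt B] and [r = 2 * eps] the factor is [rho]; this is where the isometry constant
    enters. *)
Lemma ball_close Psi I y : in_ball Psi -> (#|I| <= S)%N ->
  vnorm (Pproj Phi I *m y - Pproj Psi I *m y) <= r * Num.sqrt S%:R / (s / 2) * vnorm y.
Proof.
move=> /in_ballC near IS; have s20 : 0 < s / 2 by rewrite divr_gt0.
have sPsi := near_low (ltW r0) near IS r_s (fun a => lows IS).
apply: Pproj_dist_lip => //; last exact: (sum_near (ltW r0) near IS).
  by rewrite mulr_ge0 ?(ltW r0) ?(ltW sg0).
move=> a aI; apply: le_trans (lows IS aI); rewrite ler_wpM2r ?vnorm_ge0 //.
by rewrite ler_pdivrMr // ler_peMr ?ler1n // ltW.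
Qed.

Lemma ball_low Psi I a : in_ball Psi -> (#|I| <= S)%N -> supp_in I a ->
  kappa * vnorm a <= vnorm (Psi *m a).
Proof.
move=> /in_ballC near IS aI; have := near_low (ltW r0) near IS r_kappa (fun a => low IS) aI.
by have -> : 2 * kappa / 2 = kappa by field.
Qed.

Lemma ball_score_lip Psi Psi' e y : in_ball Psi -> in_ball Psi' -> 0 <= e ->
    (forall k, vnorm (col k Psi - col k Psi') <= e) ->
  score S Psi y <= score S Psi' y + e * Num.sqrt S%:R / kappa * vnorm y ^+ 2.
Proof.
move=> near near' e0 PsiPsi'; have es0 : 0 <= e * Num.sqrt S%:R by rewrite mulr_ge0 // ltW.
apply: score_lip => [|I IS]; first by rewrite divr_ge0 // ltW.
apply: Pproj_dist_lip => //; last exact: (sum_near e0 PsiPsi' IS).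
  by move=> a; exact: ball_low near IS.
by move=> a; exact: ball_low near' IS.
Qed.

Lemma ball_resid_le Psi I : in_ball Psi -> (#|I| <= S)%N -> resid Phi Psi I <= kappa ^+ 2.
Proof.
move=> /in_ballC near IS; apply: le_trans (resid_le (ltW r0) near IS) _.
rewrite ler_sqr ?nnegrE ?(ltW kappa0) ?mulr_ge0 ?(ltW r0) ?(ltW sg0) //; move: r_kappa; lra.
Qed.

(** For [c = kappa * sqrt S] the factor [S] in [sum_resid_low] cancels. *)
Lemma ball_sum_resid Psi k : in_ball Psi -> dictionary Psi -> vnorm (col k Psi - col k Phi) = r ->
  (r ^+ 2 - r ^+ 4 / 4) * kappa ^+ 2 / K%:R * #|{: 'S_K}|%:R <= \sum_p resid Phi Psi (Ip S p).
Proof.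
move=> /in_ballC near Psi1; rewrite vnormBC => far.
have S0 : 0 < S%:R :> R by rewrite ltr0n; case/andP: SK.
have K0 : 0 < K%:R :> R by rewrite ltr0n; case/andP: SK => _; exact: leq_ltn_trans.
pose c := kappa * Num.sqrt S%:R.
have c0 : 0 < c by rewrite mulr_gt0.
have cE : 2 * kappa * Num.sqrt S%:R = 2 * c by rewrite /c mulrA.
have c1 : c <= 1 by move: kappaS c0; rewrite cE; lra.
have lowc J a l : (#|J| <= S.+1)%N -> supp_in J a -> c * `|a l 0| <= vnorm (Psi *m a).
  move=> JS aJ.
  have -> : c = 2 * kappa * Num.sqrt S%:R / 2 by rewrite cE; field.
  apply: (near_coord_low (ltW r0) near l JS _ r_coord (fun k => coord_low k JS aJ) aJ).
  by rewrite cE mulr_gt0.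
have := sum_resid_low Phi1 Psi1 (ltW c0) c1 lowc SK far.
set P : R := #|_|%:R; set G := \sum_p _.
have -> : P * ((r ^+ 2 - r ^+ 4 / 4) * c ^+ 2) = S%:R * (P * ((r ^+ 2 - r ^+ 4 / 4) * kappa ^+ 2)).
  by rewrite /c exprMn sqr_sqrtr ?ler0n //; ring.
by rewrite ler_pM2l // [_ / _ * P]mulrAC ler_pdivrMr // [P * _]mulrC [G * _]mulrC.
Qed.

End Ball.

(** * The case of positive [N] and [S < K]: net, union bound and local maximum *)

Section MainCase.
Variable R : realType.

Lemma ae_nonempty d0 (T : measurableType d0) (mu : probability T R) (Q : T -> Prop) :
  {ae mu, forall x, Q x} -> exists x, Q x.
Proof.
move=> [Z [mZ Z0 sub]]; apply: contrapT => noQ.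
have ZT : Z = setT by apply/seteqP; split => // x _; apply: sub => Qx; apply: noQ; exists x.
by have := probability_setT mu; rewrite -ZT Z0 => /eqP; rewrite eq_sym onee_eq0.
Qed.

Lemma union_bound d0 (T : measurableType d0) (mu : probability T R) (J : finType) (V : Type)
    (rep : J -> option V) (bad : V -> set T) (c : R) : 0 <= c ->
    (forall j v, rep j = Some v -> measurable (bad v) /\ (mu (bad v) <= c%:E)%E) ->
  exists E, [/\ measurable E, (mu E <= (#|J|%:R * c)%:E)%E
    & forall j v, rep j = Some v -> bad v `<=` E].
Proof.
move=> c0 badP; pose B j := if rep j is Some v then bad v else set0.
have BP j : measurable (B j) /\ (mu (B j) <= c%:E)%E.
  rewrite /B; case Erep: (rep j) => [v|]; first exact: badP Erep.
  by split; [exact: measurable0|rewrite measure0 lee_fin].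
have [mU leU] := measure_finU_le mu (Q := xpredT) (fun j _ => (BP j).1).
exists (\big[setU/set0]_j B j); split=> //.
  apply: le_trans leU _; apply: (@le_trans _ _ (\sum_(j : J) c%:E)%E).
    by apply: lee_sum => j _; exact: (BP j).2.
  by rewrite sumEFin sumr_const mulr_natl.
by move=> j v Erep w bw; apply: (@in_finU _ _ xpredT _ j) => //; rewrite /B Erep.
Qed.

Lemma objectiveE d K N S (Y : 'I_N -> 'cV[R]_d) (Psi : 'M[R]_(d, K)) :
  objective S Y Psi = N%:R^-1 * \sum_(n < N) score S Psi (Y n).
Proof. by []. Qed.

Lemma dict_dist0 d K (Phi : 'M[R]_(d, K)) : dict_dist Phi Phi = 0.
Proof.
apply/eqP; rewrite eq_le; apply/andP; split; last by rewrite /dict_dist bigmax_ge_id.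
by apply: dict_dist_le => // k; rewrite subrr vnorm0.
Qed.

Lemma local_max_self d K (Phi : 'M[R]_(d, K)) F : dictionary Phi ->
  (forall Psi, F Psi <= F Phi) -> local_max_on_D F Phi.
Proof. by move=> Phi1 FPhi; split => //; exists 1. Qed.

Variables (d K S N : nat) (Phi : 'M[R]_(d, K)) (kappa eps : R).
Variables (d0 : measure_display) (Omega : measurableType d0) (P : probability Omega R).
Variables (nu : probability (vecM R K) R) (X : 'I_N -> Omega -> vecM R K).

Let A : R := K%:R / d%:R.
Let B : R := 1 - lower_isometry_const S Phi.
Let lambda := gammaS2 S nu / S%:R - (1 - gammaS2 S nu) / (K%:R - S%:R).
Let CS := (1 - S%:R / (d%:R * B)) ^+ 2.
Let L := ln (5 * A * K%:R ^+ S / lambda).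

Hypothesis tight : unit_norm_tight_frame Phi A.
Hypothesis SK : (0 < S < K)%N.
Hypothesis sym : symmetric_measure nu.
Hypothesis norm1 : {ae nu, forall x : vecM R K, vnorm (x : 'cV[R]_K) = 1}.
Hypothesis iid : iid_with_law P X nu.
Hypothesis kappa0 : 0 < kappa.
Hypothesis gap : {ae nu, forall x : vecM R K, gap_separated S Phi kappa x}.
Hypothesis N0 : (0 < N)%N.
Hypothesis eps0 : 0 < eps.
Hypothesis eps_lt1 : (N = 1)%N -> 1 <= eps.
Hypothesis epsle : eps <= kappa ^+ 2 * B / (68 * Num.sqrt S%:R * L).

Lemma main_case : exists E : set Omega,
  [/\ measurable E,
      (P E <= (expR (- (N%:R * eps ^+ 4 * lambda ^+ 2 * S%:R ^+ 2 * CS / (4 * K%:R ^+ 2 * A))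
                     + K%:R * d%:R * ln (N%:R * K%:R * A / (lambda * S%:R))))%:E)%E
    & forall w, ~ E w -> exists Psi : 'M[R]_(d, K),
        local_max_on_D (objective S (fun n => Phi *m (X n w : 'cV[R]_K))) Psi
        /\ dict_dist Psi Phi <= 2 * eps].
Proof.
have S0 : (0 < S)%N by case/andP: SK.
have K0 : (0 < K)%N by case/andP: SK => _; exact: leq_ltn_trans.
have Phi1 : dictionary Phi by case: tight.
pose k0 := Ordinal K0.
have dpos : (0 < d)%N.
  rewrite lt0n; apply/eqP => dE; have := Phi1 k0; rewrite /vnorm big1; last first.
    by move=> [i id] _; exfalso; move: id; rewrite dE.
  by rewrite sqrtr0 => /eqP; rewrite eq_sym oner_eq0.
have A1 : 1 <= A.
  have := tight.2 (col k0 Phi); rewrite Phi1 expr1n mulr1 => <-.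
  rewrite (bigD1 k0) //= -vnorm_sqr Phi1 !expr1n lerDl; apply: sumr_ge0 => i _; exact: sqr_ge0.
have A0 : 0 < A by exact: lt_le_trans A1.
have [x0 [x01 x0gap]] : exists x : vecM R K, vnorm (x : 'cV[R]_K) = 1 /\ gap_separated S Phi kappa x.
  by apply: (@ae_nonempty _ _ nu); move: norm1 gap; apply: filterS2.
have coord_low := frame_coord_low tight SK kappa0 x01 x0gap (ltW A0).
have low := frame_low tight SK kappa0 x01 x0gap (ltW A0).
(* A single atom has norm 1, which bounds [kappa] from above. *)
have kappaS : 2 * kappa * Num.sqrt S%:R <= 1.
  have := @coord_low [set k0]%SET (delta_mx k0 0) k0; rewrite cards1 mulmx_delta Phi1 mxE !eqxx normr1 mulr1.
  by apply => //; apply: supp_in_delta; rewrite inE.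
have Sd : (S <= d)%N.
  rewrite -(ler_nat R); apply: le_trans (Pproj_trace_dim Phi (Ip S 1%g)).
  rewrite -{1}(@card_Ip K S 1%g); last by case/andP: SK => _ /ltnW.
  apply: Pproj_trace_ge => a aI Pa; apply: (gap_indep kappa0 x0gap _ aI Pa).
  by apply: card_Ip; case/andP: SK => _ /ltnW.
have KS0 : 0 < K%:R - S%:R :> R by rewrite subr_gt0 ltr_nat; case/andP: SK.
have SR0 : 0 < S%:R :> R by rewrite ltr0n.
have KR0 : 0 < K%:R :> R by rewrite ltr0n.
have gamma1 : gammaS2 S nu <= 1.
  by case: (@integral_topS_sq R K nu S _ norm1) => //; case/andP: SK => _ /ltnW.
have lambdaS : lambda * S%:R <= 1.
  have : 0 <= (1 - gammaS2 S nu) / (K%:R - S%:R) * S%:R.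
    by rewrite mulr_ge0 ?ler0n // divr_ge0 ?subr_ge0 // -subr_ge0 ltW.
  have -> : lambda * S%:R = gammaS2 S nu - (1 - gammaS2 S nu) / (K%:R - S%:R) * S%:R.
    by rewrite /lambda; field; rewrite !gt_eqF.
  by lra.
have rhs0 : 0 < kappa ^+ 2 * B / (68 * Num.sqrt S%:R * L) by exact: lt_le_trans epsle.
(* Otherwise the logarithm takes its default value 0 at a nonpositive argument, and the right side
   of [epsle] would be 0. *)
have lambda0 : 0 < lambda.
  rewrite ltNge; apply/negP => l0; move: rhs0.
  rewrite /L ln0 ?mulr0 ?invr0 ?mulr0 ?ltxx //.
  by rewrite mulr_ge0_le0 ?invr_le0 // !mulr_ge0 ?exprn_ge0 // ltW.
have B1 : B <= 1 by rewrite gerBl; exact: (lower_isometry_ge0 Phi1 k0 S0).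
have L_pos : 0 <= L.
  rewrite /L ln_ge0 // ler_pdivlMr // mul1r.
  have l1 : lambda <= 1 by apply: le_trans lambdaS; rewrite ler_peMr ?ler1n // ltW.
  apply: le_trans l1 _; rewrite -[leLHS]mulr1 ler_pM ?exprn_ege1 ?ler1n //.
  by rewrite -[leLHS]mulr1 ler_pM // ler1n.
have B0 : 0 < B.
  rewrite ltNge; apply/negP => Bn; move: rhs0; rewrite ltNge => /negP; apply.
  rewrite mulr_le0_ge0 ?invr_ge0 ?mulr_ge0 ?sqrtr_ge0 //.
  by rewrite mulr_ge0_le0 // sqr_ge0.
have epsh := eps_half SK A1 kappa0 kappaS lambda0 lambdaS B1 erefl eps0 epsle.
have N2 : (1 < N)%N.
  rewrite ltn_neqAle eq_sym N0 andbT; apply/eqP => N1.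
  by have := eps_lt1 N1; move: epsh; lra.
(* If the total exponent is nonnegative, the probability bound is at least 1 and the whole space may
   be excluded. *)
have [triv|nontriv] := leP (N%:R * eps ^+ 4 * lambda ^+ 2 * S%:R ^+ 2 * CS / (4 * K%:R ^+ 2 * A))
    (K%:R * d%:R * ln (N%:R * K%:R * A / (lambda * S%:R))).
  exists setT; split => [//||w []//].
  by rewrite probability_setT lee_fin -[leLHS]expR0 ler_expR addrC subr_ge0.
(* [rho] bounds the distance between the projections of [Phi] and [Psi], [Gmin]
   the mean residual of a boundary dictionary from below; the mesh [h] is such
   that moving to the nearest grid point costs at most the margin [tau]. *)
pose rho := 2 * eps * Num.sqrt S%:R / (Num.sqrt B / 2).
pose theta := lambda * kappa ^+ 2 / (4 * A).
pose Gmin := 3 * eps ^+ 2 * kappa ^+ 2 / K%:R.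
pose tau := lambda * Gmin / 8.
pose h := tau * kappa / (A * Num.sqrt (S%:R * d%:R)).
have theta0 : 0 < theta by exact: (num_theta0 A1 kappa0 lambda0).
have Gmin0 : 0 < Gmin by apply: (num_Gmin0 SK kappa0 eps0).
have h0 : 0 < h by apply: (num_h0 SK dpos A1 kappa0 lambda0 eps0).
have net := num_net SK dpos Sd A1 kappa0 kappaS lambda0 lambdaS B0 B1 erefl eps0 epsle N2 nontriv.
have nexp := num_exponent N SK dpos Sd A1 kappa0 lambda0 lambdaS B0 B1 erefl eps0 epsle.
have nbad := num_bad SK dpos erefl A1 kappa0 kappaS lambda0 lambdaS B0 B1 erefl eps0 epsle.
have r0 : 0 < 2 * eps by rewrite mulr_gt0.
have sB0 : 0 < Num.sqrt B by rewrite sqrtr_gt0.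
have sB1 : Num.sqrt B <= 1 by rewrite -sqrtr1 ler_sqrt.
have lowB (I : {set 'I_K}) (a : 'cV[R]_K) : (#|I| <= S)%N -> supp_in I a -> Num.sqrt B * vnorm a <= vnorm (Phi *m a).
  move=> IS aI; rewrite -ler_sqr ?nnegrE ?mulr_ge0 ?vnorm_ge0 // exprMn sqr_sqrtr ?(ltW B0) //.
  by rewrite !vnorm_sqr; exact: lower_isometry_low IS aI.
have r_kappa := num_low SK A1 kappa0 kappaS lambda0 lambdaS B1 erefl eps0 epsle.
have r_s := num_lowB SK A1 kappa0 kappaS lambda0 lambdaS B0 B1 erefl eps0 epsle.
have r_coord := num_coord SK A1 kappa0 kappaS lambda0 lambdaS B1 erefl eps0 epsle.
have close := ball_close SK r0 sB0 lowB r_s.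
have lip := ball_score_lip kappa0 r0 low r_kappa.
have rle := ball_resid_le SK kappa0 r0 r_kappa.
have rge := ball_sum_resid Phi1 SK kappa0 kappaS r0 coord_low r_coord.
have rho0 : 0 < rho := num_rho0 SK B0 eps0.
have thetaA : theta * A <= 3^-1 := num_thetaA SK A1 kappa0 kappaS lambda0 lambdaS.
have theta_var : theta * A / kappa ^+ 2 <= lambda / 4 := num_theta_var lambda A1 kappa0.
set Q := N%:R * K%:R * A / (lambda * S%:R) in nontriv net *.
set rate := _ / (4 * K%:R ^+ 2 * A) in nontriv nexp *.
pose t := 2 * (2 * eps) / h.
have t0 : 0 <= t by apply: divr_ge0 (ltW h0); apply: mulr_ge0 (ltW r0).
pose m := (Num.truncn t).+1.
have /andP[tm mt] := truncn_itv t0.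
have mh : 2 * (2 * eps) < m%:R * h by rewrite -ltr_pdivrMr.
have mQ : m%:R <= Q by apply: le_trans net; rewrite /m -natr1; exact: lerD tm (lexx 1).
(* The net consists of boundary dictionaries, since the residual bound needs an atom at distance
   exactly [2 * eps]. *)
pose D (Psi : 'M[R]_(d, K)) := [/\ dictionary Psi, in_ball Phi (2 * eps) Psi
  & exists k, vnorm (col k Psi - col k Phi) = 2 * eps].
have [rep [repD repN]] := @grid_net R d K m Phi (2 * eps) h D h0 mh (fun Psi DPsi => and3_rec (fun _ n _ => n) DPsi).
pose bad (Psi : 'M[R]_(d, K)) := [set w | 1 <= \prod_(n < N) expR (theta * (Num.min
  (score S Psi (Phi *m (X n w : 'cV[R]_K)) - score S Phi (Phi *m (X n w : 'cV[R]_K))) A + tau))].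
have badP J Psi : rep J = Some Psi -> measurable (bad Psi) /\
    (P (bad Psi) <= (expR (- (N%:R * (theta * lambda * Gmin / 4))))%:E)%E.
  move=> /repD[Psi1 near [k far]].
  apply: (dictionary_tail tight (ltW A0) SK kappa0 sym norm1 gap lambda0 iid rho0 _ _
     theta0 thetaA theta_var Gmin0 nbad) => //.
  - by move=> I y IS; exact: close.
  - by move=> I; exact: rle.
  - apply: le_trans (rge _ _ near Psi1 far).
    rewrite ler_wpM2r // /Gmin ler_wpM2r ?invr_ge0 // ler_wpM2r ?sqr_ge0 //.
    have e4 : eps ^+ 2 <= 4^-1.
      have -> : 4^-1 = 2^-1 ^+ 2 :> R by field.
      by rewrite ler_sqr ?nnegrE ?(ltW eps0).
    rewrite -subr_ge0.
    have -> : (2 * eps) ^+ 2 - (2 * eps) ^+ 4 / 4 - 3 * eps ^+ 2 = eps ^+ 2 * (1 - 4 * eps ^+ 2) by field.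
    by rewrite mulr_ge0 ?sqr_ge0 // subr_ge0 -ler_pdivlMl // mulr1.
have [E2 [mE2 PE2 badE2]] := union_bound (expR_ge0 _) badP.
have [Z [mZ Z0 subZ]] := norm1.
have [mE1 PE1] := null_event iid mZ Z0.
exists ([set w | exists n, Z (X n w)] `|` E2); split; first exact: measurableU.
  apply: (@le_trans _ _ (P E2)); first by rewrite -[leRHS]add0e -PE1; exact: measureU2.
  apply: (le_trans PE2); rewrite lee_fin addrC expRD; apply: ler_pM => //.
    (* The net has at most [m^(d K)] points and [m <= Q]. *)
    rewrite -natrM mulnC expRM_natl lnK ?posrE; last exact: lt_le_trans mQ.
    rewrite card_ffun card_prod !card_ord natrX.
    by apply: lerXn2r; rewrite ?nnegrE ?ler0n //; exact: le_trans (ler0n _ m) mQ.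
  by rewrite ler_expR lerN2.
move=> w /not_orP[w1 w2].
have Xw n : vnorm (X n w : 'cV[R]_K) = 1.
  by apply: contrapT => Xn; apply: w1; exists n; exact: subZ.
pose Y n : 'cV[R]_d := Phi *m (X n w : 'cV[R]_K).
have YA n : vnorm (Y n) ^+ 2 <= A.
  by have := tight_vnorm_le tight (X n w : 'cV[R]_K); rewrite Xw expr1n mulr1.
have NR0 : 0 < N%:R :> R by rewrite ltr0n.
have Flip Psi Psi' e : in_ball Phi (2 * eps) Psi -> in_ball Phi (2 * eps) Psi' -> 0 <= e ->
    (forall k, vnorm (col k Psi - col k Psi') <= e) ->
    \sum_n score S Psi (Y n) <= \sum_n score S Psi' (Y n) + N%:R * (e * Num.sqrt S%:R / kappa * A).
  move=> near near' e0 PsiPsi'; rewrite -sum_natr_const -big_split; apply: ler_sum => n _ /=.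
  apply: le_trans (lip _ _ e (Y n) near near' e0 PsiPsi') _; rewrite lerD2l ler_wpM2l ?YA //.
  by rewrite divr_ge0 ?mulr_ge0 ?sqrtr_ge0 // ltW.
apply: (@local_max_in_ball _ _ _ _ _ _ (Num.sqrt S%:R / kappa * A)) => //.
- by rewrite mulr_ge0 ?divr_ge0 ?sqrtr_ge0 // ltW.
- move=> Psi Psi' e [_ near] [_ near'] e0 PsiPsi'; rewrite !objectiveE.
  have Ni : 0 <= N%:R^-1 :> R by rewrite invr_ge0 ltW.
  apply: le_trans (ler_wpM2l Ni (Flip _ _ _ near near' e0 PsiPsi')) _.
  rewrite mulrDr mulKf ?gt_eqF // lerD2l.
  by have -> : e * Num.sqrt S%:R / kappa * A = Num.sqrt S%:R / kappa * A * e by ring.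
- move=> Psi k [Psi1 near] far; rewrite !objectiveE ltr_pM2l ?invr_gt0 //.
  have [J [Psi' EJ PsiPsi']] := repN Psi (And3 Psi1 near (ex_intro _ k far)).
  have [_ near' _] := repD _ _ EJ.
  have notbad : ~ bad Psi' w by move=> bw; apply: w2; exact: badE2 EJ _ bw.
  (* The representative [Psi'] loses more than [N * tau] against [Phi]; passing from it to [Psi]
     regains at most [N * tau]. *)
  apply: le_lt_trans (tail_score tight theta0 Xw notbad).
  have sd0 : 0 <= Num.sqrt d%:R * h by rewrite mulr_ge0 ?sqrtr_ge0 // ltW.
  apply: le_trans (Flip _ _ (Num.sqrt d%:R * h) near near' sd0 _) _.
    by move=> l; rewrite -ler_sqr ?nnegrE ?vnorm_ge0 // exprMn vnorm_sqr sqr_sqrtr ?ler0n //.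
  rewrite lerD2l ler_wpM2l ?ler0n // le_eqVlt; apply/orP; left; apply/eqP.
  have sdS : 0 < Num.sqrt (S%:R * d%:R) :> R by rewrite sqrtr_gt0 mulr_gt0 // ltr0n.
  rewrite /h.
  have -> : Num.sqrt d%:R * (tau * kappa / (A * Num.sqrt (S%:R * d%:R))) * Num.sqrt S%:R =
     (Num.sqrt S%:R * Num.sqrt d%:R) * (tau * kappa / (A * Num.sqrt (S%:R * d%:R))) by ring.
  rewrite -sqrtrM ?ler0n //; field.
  by rewrite !gt_eqF.
Qed.

End MainCase.

(** * Degenerate cases and conclusion *)

Unset Implicit Arguments.
Set Strict Implicit.

Theorem theorem8 (R : realType) (d K S N : nat) (Phi : 'M[R]_(d, K))
  (mu kappa q : R)
  (d0 : measure_display) (Omega : measurableType d0) (P : probability Omega R)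
  (nu : probability (vecM R K) R) (X : 'I_N -> Omega -> vecM R K) :
  let A := K%:R / d%:R in
  let deltaS := lower_isometry_const S Phi in
  let gamma2 := gammaS2 S nu in
  let lambda := gamma2 / S%:R - (1 - gamma2) / (K%:R - S%:R) in
  let CS := (1 - S%:R / (d%:R * (1 - deltaS))) ^+ 2 in
  unit_norm_tight_frame Phi A ->
  mu = coherence Phi ->
  deltaS <= mu * S%:R ->
  (1 <= S <= K)%N ->
  symmetric_measure nu ->
  {ae nu, forall x : vecM R K, vnorm (x : 'cV[R]_K) = 1} ->
  iid_with_law P X nu ->
  0 < kappa ->
  {ae nu, forall x : vecM R K, forall (p : 'S_K) (s : 'I_K -> bool),
     2 * kappa <=
       vnorm (Pproj Phi (Ip S p) *m (Phi *m c_ps p s x))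
       - \big[Num.max/0]_(I : {set 'I_K} | (#|I| <= S)%N && (I != Ip S p))
            vnorm (Pproj Phi I *m (Phi *m c_ps p s x))} ->
  0 < q < 4^-1 ->
  N%:R `^ (- q) + N%:R `^ (- (2 * q)) / K%:R
    <= kappa ^+ 2 * (1 - deltaS)
       / (68 * Num.sqrt (S%:R) * ln (5 * A * K%:R ^+ S / lambda)) ->
  exists E : set Omega,
    [/\ measurable E,
        (P E <= (expR (- (N%:R `^ (1 - 4 * q) * lambda ^+ 2 * S%:R ^+ 2 * CS)
                          / (4 * K%:R ^+ 2 * A)
                       + K%:R * d%:R * ln (N%:R * K%:R * A / (lambda * S%:R))))%:E)%E
      & forall w, ~ E w ->
          exists Psi : 'M[R]_(d, K),
            local_max_on_D (objective S (fun n => Phi *m (X n w : 'cV[R]_K))) Psi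
            /\ dict_dist Psi Phi <= 2 * N%:R `^ (- q)].
Proof.
move=> A deltaS gamma2 lambda CS tight _ _ SK sym norm1 iid kappa0 gap q01 epsle.
have Phi1 := tight.1.
(* Without samples the objective is constant. *)
have [N0|N0] := posnP N.
  subst N; exists set0; split=> [||w _]; first exact: measurable0.
    by rewrite measure0 lee_fin expR_ge0.
  exists Phi; rewrite dict_dist0 mulr_ge0 ?powR_ge0 //; split=> //.
  by apply: local_max_self => // Psi; rewrite !objectiveE !big_ord0.
(* For [S = K] the full support is admissible and [Phi] reproduces every sample, so [Phi] is a
   global maximum. *)
have [SltK|KS] := ltnP S K; last first.
  exists set0; split=> [||w _]; first exact: measurable0.
    by rewrite measure0 lee_fin expR_ge0.
  exists Phi; rewrite dict_dist0 mulr_ge0 ?powR_ge0 //; split=> //.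
  apply: local_max_self => // Psi; rewrite !objectiveE ler_wpM2l ?invr_ge0 ?ler0n //.
  apply: ler_sum => n _; apply: le_trans (score_le _ _ _) _.
  have KI : (#|[set: 'I_K]%SET| <= S)%N by rewrite cardsT card_ord.
  by have := score_ge Phi (Phi *m (X n w : 'cV[R]_K)) KI; rewrite Pproj_id // => i; rewrite inE.
have SK' : (0 < S < K)%N by case/andP: SK => S0 _; rewrite S0.
set eps := N%:R `^ (- q) in epsle *.
have NR0 : 0 < N%:R :> R by rewrite ltr0n.
have eps0 : 0 < eps by rewrite powR_gt0.
have epsle' : eps <= kappa ^+ 2 * (1 - deltaS)
    / (68 * Num.sqrt S%:R * ln (5 * A * K%:R ^+ S / lambda)).
  by apply: le_trans epsle; rewrite lerDl divr_ge0 ?powR_ge0.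
have eps1 : N = 1%N -> 1 <= eps by move=> N1; rewrite /eps N1 powR1.
have eps4 : N%:R `^ (1 - 4 * q) = N%:R * eps ^+ 4.
  rewrite powRD; last by apply/implyP => _; rewrite gt_eqF.
  rewrite powRr1 ?ler0n // /eps -powR_mulrn ?powR_ge0 // -powRrM; congr (_ * _ `^ _); ring.
have [E [mE PE HE]] := main_case tight SK' sym norm1 iid kappa0 gap N0 eps0 eps1 epsle'.
exists E; split=> //.
by rewrite mulNr eps4.
Qed.
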